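(* Riemann ZMC examples in $\mathbb{L}^3$ foliated by circles (of non-constant radii) contained in spacelike planes form a one-parameter family of surfaces depending on a parameter $\lambda\in\mathbb{R}$ and, up to a rigid motion and a homothety, parametrize as $$X(q,v)=(m(q),0,z(q))+\sqrt{q}\,(\cos v,\sin v,0),$$ where $$z(q)=\frac12\int^q\frac{du}{\sqrt{u^3+\lambda u^2+u}},\qquad m(q)=\frac12\int^q\frac{u\,du}{\sqrt{u^3+\lambda u^2+u}}.$$ Let $\Pi$ be the plane $x_2=0$ and, when $\lambda^2>4$, let $q_1=\frac{-\lambda-\sqrt{\lambda^2-4}}{2}$ and $q_2=\frac{-\lambda+\sqrt{\lambda^2-4}}{2}$. Depending on $\lambda$, we have the following cases (in each of which $z_0$ denotes a suitable constant). (1) Case $\lambda^2=4$. With $r=\sqrt q$ (and up to the reflection $x_1\mapsto -x_1$), the surfaces are the following. (1.i) $\lambda=2$, spacelike: $X(r,v)=(-r+\arctan r,0,\arctan r)+r(\cos v,\sin v,0)$, $r>0$, $v\in(0,2\pi)$. The circles of the foliation are punctured. The surface is contained in the horizontal slab $0<x_3\le\pi/2$. It converges to a conelike point as $x_3\to0$ and converges to a straight line $L$ orthogonal to $\Pi$ as $x_3\to\pi/2$; the line $L$ is contained in the surface. The surface is asymptotic to the horizontal plane $x_3=\pi/2$. The surface can be extended to a lightlike straight line. (1.ii) $\lambda=-2$, spacelike: $$X(r,v)=\left(-r-\tfrac12\log\tfrac{r-1}{r+1},0,\tfrac12\log\tfrac{r-1}{r+1}\right)+r(\cos v,\sin v,0),$$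 where $r\in[r_0,\infty)$ for any $r_0>1$ and $\cos v<1-2/r^2$. The surface is foliated by pieces of circles that can be extended to full circles, the surface then being degenerate at the points $\cos v=1-2/r^2$ and timelike when $\cos v>1-2/r^2$. The surface is contained in the horizontal slab $z_0\le x_3<0$, where $z_0=\frac12\log\frac{r_0-1}{r_0+1}$. At $r=r_0$ the surface has a boundary component that is (part of) a circle, and it converges to a straight line orthogonal to $\Pi$ as $x_3\to0$; this straight line is contained in the surface. (1.iii) $\lambda=-2$, timelike: the parametrization of (1.ii), for any $r_0>1$, with $r\in[r_0,\infty)$ and $1-2/r^2<\cos v<1$. (1.iv) $\lambda=-2$, timelike: $X(r,v)=(r-\operatorname{artanh} r,0,\operatorname{artanh} r)+r(\cos v,\sin v,0)$, $r\in(0,1)$, $v\in(-\pi,\pi)$. This surface extends to a lightlike straight line by considering the points $\cos v=-1$. It is included in the halfspace $x_3>0$, with $x_3\to\infty$ as $r\to1$. (2) Case $\lambda^2<4$. The surface contains regions of points with the three causal characters; it is included in a horizontal slab $0<x_3\le z_0$ with a conelike point at $x_3=0$; the surface contains a straight line orthogonal to $\Pi$. (3) Case $\lambda<-2$. The parameter $q$ belongs to $(0,q_1)\cup(q_2,\infty)$. (a) In the interval $(0,q_1)$ the surface is timelike and included in a horizontal slab $0<x_3<z_0$. As $x_3\to0$ the surface converges to a point, and as $x_3\to z_0$ the surface converges to a circle. (b) If $q\in(q_2,\infty)$, the surface has regions of points with the three causal characters. Moreover, it is included in a horizontal slab $0\le x_3\le z_0$. At $x_3=0$ the surface has a lower boundary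 component that is a circle, and at $x_3=z_0$ the surface is a straight line orthogonal to $\Pi$ at the height $z_0$. (4) Case $\lambda>2$. The surface is spacelike and included in a horizontal slab $0<x_3\le z_0$. As $x_3\to0$ the surface converges to a conelike point, and at $x_3=z_0$ the surface is a straight line $L$ orthogonal to $\Pi$.
   Context: $\mathbb{L}^3$ is $\mathbb{R}^3$ with the metric $\langle,\rangle=dx_1^2+dx_2^2-dx_3^2$. A curve, plane or surface is spacelike, timelike or lightlike (degenerate) where the induced metric is Riemannian, Lorentzian or degenerate; this is its causal character. A straight line is lightlike if its direction $\vec v\ne0$ satisfies $\langle\vec v,\vec v\rangle=0$. The mean curvature $H$ (trace of the second fundamental form) is defined where the induced metric is non-degenerate; zero mean curvature (ZMC) means $H=0$. A circle is a non-degenerate planar curve of nonzero constant curvature; in the planes $x_3=\text{const}$ circles are Euclidean circles. A Riemann ZMC example is a non-rotational surface with zero mean curvature foliated by pieces of circles contained in parallel planes. After a rigid motion the planes of the foliation are parallel to $x_3=0$; $q=r^2$, where $r$ is the radius of the circles, and $q>0$ ranges where $u^3+\lambda u^2+u>0$. ''Horizontal'' means parallel to $x_3=0$. Convergence of the surface to a point, circle or straight line as $x_3\to h$ refers to the limit of the horizontal leaves of the foliation; limit straight lines (obtained as $q\to\infty$) are regarded as contained in the surface. A conelike point is a point to which the circles of the foliation shrink and at which the surface looks like a half light cone with vertex at that point.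
   Formalization: In (1.ii), timelike is claimed only for 1-2/r^2<cos v<1 (degenerate at cos v=1); the slab omits the limit line, which full circles approach (spacelike arcs only its part |x_2|>=2); X(q,v) is given on intervals of leaves where r'≠0, as q is no parameter elsewhere. *)

(* Defs.v *)
From Stdlib Require Import Reals Lra.
From Coquelicot Require Import Coquelicot.
Open Scope R_scope.

Definition vec : Type := (R * R * R)%type.

Definition x1 (p : vec) : R := fst (fst p).
Definition x2 (p : vec) : R := snd (fst p).
Definition x3 (p : vec) : R := snd p.

Definition lprod (p q : vec) : R := x1 p * x1 q + x2 p * x2 q - x3 p * x3 q.

(* [lprod (lcross p q) w] is the determinant of [p], [q], [w]. *)
Definition lcross (p q : vec) : vec :=
  (x2 p * x3 q - x3 p * x2 q,
   x3 p * x1 q - x1 p * x3 q,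
   - (x1 p * x2 q - x2 p * x1 q)).

(* Euclidean norm and distance: used only for limits. *)
Definition enorm (p : vec) : R := sqrt (x1 p ^ 2 + x2 p ^ 2 + x3 p ^ 2).
Definition edist (p q : vec) : R := enorm (minus p q).

Definition rigid_motion (Phi : vec -> vec) : Prop :=
  forall p q, lprod (minus (Phi p) (Phi q)) (minus (Phi p) (Phi q))
              = lprod (minus p q) (minus p q).

Definition refl1 (p : vec) : vec := (- x1 p, x2 p, x3 p).

(* A surface is a map [Y] of two real variables together with a domain
   [D : R -> R -> Prop]; the first variable labels the leaves. *)

Definition dvec (f : R -> vec) (t : R) : vec :=
  (Derive (fun u => x1 (f u)) t,
   Derive (fun u => x2 (f u)) t,
   Derive (fun u => x3 (f u)) t).

Definition d1 (Y : R -> R -> vec) (s v : R) : vec := dvec (fun u => Y u v) s.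
Definition d2 (Y : R -> R -> vec) (s v : R) : vec := dvec (fun u => Y s u) v.

Definition tangent (Y : R -> R -> vec) (s v : R) (a : R * R) : vec :=
  plus (scal (fst a) (d1 Y s v)) (scal (snd a) (d2 Y s v)).

Definition immersed_at (Y : R -> R -> vec) (s v : R) : Prop :=
  forall a, a <> (0, 0) -> tangent Y s v a <> (0, 0, 0).

Definition degenerate_metric_at (Y : R -> R -> vec) (s v : R) : Prop :=
  exists a, a <> (0, 0) /\
    forall b, lprod (tangent Y s v a) (tangent Y s v b) = 0.

Definition spacelike_at (Y : R -> R -> vec) (s v : R) : Prop :=
  forall a, a <> (0, 0) -> 0 < lprod (tangent Y s v a) (tangent Y s v a).

(* In dimension two, Lorentzian means nondegenerate and indefinite, and
   indefinite already implies nondegenerate. *)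
Definition timelike_at (Y : R -> R -> vec) (s v : R) : Prop :=
  (exists a, 0 < lprod (tangent Y s v a) (tangent Y s v a)) /\
  (exists a, lprod (tangent Y s v a) (tangent Y s v a) < 0).

Definition lightlike_at (Y : R -> R -> vec) (s v : R) : Prop :=
  immersed_at Y s v /\ degenerate_metric_at Y s v.

Definition three_causal_characters (Y : R -> R -> vec) (D : R -> R -> Prop)
  : Prop :=
  (exists s v, D s v /\ spacelike_at Y s v) /\
  (exists s v, D s v /\ timelike_at Y s v) /\
  (exists s v, D s v /\ lightlike_at Y s v).

(* Trace, with respect to the induced metric, of the second fundamental form
   relative to the unit normal [N]; only meaningful where the induced metric
   is nondegenerate, i.e. where [W <> 0]. *)
Definition mean_curvature (Y : R -> R -> vec) (s v : R) : R :=
  let E := lprod (d1 Y s v) (d1 Y s v) in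
  let F := lprod (d1 Y s v) (d2 Y s v) in
  let G := lprod (d2 Y s v) (d2 Y s v) in
  let W := E * G - F ^ 2 in
  let N := scal (/ sqrt (Rabs W)) (lcross (d1 Y s v) (d2 Y s v)) in
  let e := lprod N (d1 (d1 Y) s v) in
  let f := lprod N (d1 (d2 Y) s v) in
  let g := lprod N (d2 (d2 Y) s v) in
  (G * e - 2 * F * f + E * g) / W.

Definition zmc (Y : R -> R -> vec) (D : R -> R -> Prop) : Prop :=
  forall s v, D s v -> ~ degenerate_metric_at Y s v -> mean_curvature Y s v = 0.

(* [fun p => lcross w (minus p p0)], with [w <> 0], generates the
   one-parameter group of rotations of [L^3] about the axis [p0 + R w] (an
   axis of any causal character).  A piece of surface need not be globally
   invariant, so invariance is expressed by tangency of this field. *)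
Definition rotational (Y : R -> R -> vec) (D : R -> R -> Prop) : Prop :=
  exists p0 w : vec, w <> (0, 0, 0) /\
    forall s v, D s v ->
      exists a, lcross w (minus (Y s v) p0) = tangent Y s v a.

Definition is_open_interval (I : R -> Prop) : Prop :=
  (exists s, I s) /\ open I /\
  (forall a b s, I a -> I b -> a <= s <= b -> I s).

(* Every leaf [D s] is a piece (a nonempty open arc) of a circle. *)
Definition arc_domain (I : R -> Prop) (D : R -> R -> Prop) : Prop :=
  is_open_interval I /\
  open (fun sv : R * R => D (fst sv) (snd sv)) /\
  (forall s v, D s v -> I s) /\
  (forall s, I s -> is_open_interval (D s)).

Definition C2_on (I : R -> Prop) (f : R -> R) : Prop :=
  forall s, I s ->
    ex_derive f s /\ ex_derive (Derive f) s /\ continuous (Derive (Derive f)) s.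

Definition lorentz_frame (e1 e2 e3 : vec) : Prop :=
  lprod e1 e1 = 1 /\ lprod e2 e2 = 1 /\ lprod e3 e3 = -1 /\
  lprod e1 e2 = 0 /\ lprod e1 e3 = 0 /\ lprod e2 e3 = 0.

(* The leaf labelled [s] is contained in the circle of center [c s] and radius
   [r s] of the spacelike plane through [c s] spanned by [e1], [e2]; the
   height of this plane along the common normal [e3] varies regularly. *)
Definition circle_foliated (I : R -> Prop) (D : R -> R -> Prop)
    (Y : R -> R -> vec) (r : R -> R) : Prop :=
  arc_domain I D /\
  exists (e1 e2 e3 : vec) (c : R -> vec),
    lorentz_frame e1 e2 e3 /\
    C2_on I (fun s => x1 (c s)) /\
    C2_on I (fun s => x2 (c s)) /\
    C2_on I (fun s => x3 (c s)) /\
    C2_on I r /\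
    (forall s, I s -> 0 < r s) /\
    (forall s, I s -> Derive (fun u => lprod (c u) e3) s <> 0) /\
    (forall s v, D s v ->
       Y s v = plus (c s)
                 (scal (r s) (plus (scal (cos v) e1) (scal (sin v) e2)))).

Definition riemann_zmc_example (I : R -> Prop) (D : R -> R -> Prop)
    (Y : R -> R -> vec) (r : R -> R) : Prop :=
  circle_foliated I D Y r /\ zmc Y D /\ ~ rotational Y D.

Definition nonconstant_on (I : R -> Prop) (r : R -> R) : Prop :=
  exists s s', I s /\ I s' /\ r s <> r s'.

Definition cubic (lam u : R) : R := u ^ 3 + lam * u ^ 2 + u.

(* [m] and [z] are indefinite integrals on [J] of the two densities. *)
Definition riemann_primitives (lam : R) (J : R -> Prop) (m z : R -> R) : Prop :=
  forall q, J q ->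
    is_derive m q (1 / 2 * (q / sqrt (cubic lam q))) /\
    is_derive z q (1 / 2 * / sqrt (cubic lam q)).

Definition riemann_X (m z : R -> R) (q v : R) : vec :=
  plus ((m q, 0, z q) : vec)
       (scal (sqrt q) ((cos v, sin v, 0) : vec)).

Definition surf (Y : R -> R -> vec) (D : R -> R -> Prop) (p : vec) : Prop :=
  exists s v, D s v /\ p = Y s v.

(* Limit of the leaves as the parameter (the radius or its square) tends to
   infinity; it is empty when the parameter is bounded. *)
Definition limit_leaf (Y : R -> R -> vec) (D : R -> R -> Prop) (p : vec)
  : Prop :=
  forall eps, 0 < eps ->
    exists Q, forall q, Q < q -> exists v, D q v /\ edist (Y q v) p < eps.

(* The surface together with the limit straight line at infinity. *)
Definition full_surf (Y : R -> R -> vec) (D : R -> R -> Prop) (p : vec)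
  : Prop := surf Y D p \/ limit_leaf Y D p.

(* Inside the window [W], the horizontal leaf of [S] at height [t] and the set
   [T] are within Hausdorff distance [eps]. *)
Definition leaf_close (W S T : vec -> Prop) (t eps : R) : Prop :=
  (forall p, S p -> x3 p = t -> W p -> exists p', T p' /\ edist p p' < eps) /\
  (forall p', T p' -> W p' -> exists p, S p /\ x3 p = t /\ edist p p' < eps).

Definition leaves_cvg_in (W S T : vec -> Prop) (h : R) : Prop :=
  (forall delta, 0 < delta -> exists p, S p /\ 0 < Rabs (x3 p - h) < delta) /\
  (forall eps, 0 < eps -> exists delta, 0 < delta /\
     forall t, 0 < Rabs (t - h) < delta -> (exists p, S p /\ x3 p = t) ->
       leaf_close W S T t eps).

(* As [x3] tends to [h], the leaves of [S] converge to [T] in the Hausdorff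
   sense (for points and circles). *)
Definition leaves_cvg (S T : vec -> Prop) (h : R) : Prop :=
  leaves_cvg_in (fun _ => True) S T h.

(* Same, on bounded sets (for straight lines). *)
Definition leaves_cvg_loc (S T : vec -> Prop) (h : R) : Prop :=
  forall rho, 0 < rho -> leaves_cvg_in (fun p => enorm p <= rho) S T h.

(* [p] is the vertex of a half light cone [x3 = sigma * sqrt (x1^2 + x2^2)]
   (translated to [p]) approximating [S] to first order near [p]. *)
Definition conelike_point (S : vec -> Prop) (p : vec) : Prop :=
  leaves_cvg S (fun p' => p' = p) (x3 p) /\
  exists sigma, (sigma = 1 \/ sigma = -1) /\
    let cone c := x3 c = sigma * sqrt (x1 c ^ 2 + x2 c ^ 2) in
    forall eps, 0 < eps -> exists delta, 0 < delta /\
      forall t, 0 < t < delta ->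
        (forall p', S p' -> edist p' p <= t ->
           exists c, cone c /\ edist p' (plus p c) < eps * t) /\
        (forall c, cone c -> enorm c <= t ->
           exists p', S p' /\ edist p' (plus p c) < eps * t).

(* [Pi] is the plane [x2 = 0]. *)
Definition line_orthogonal_to_Pi (L : vec -> Prop) : Prop :=
  exists p d : vec, d <> (0, 0, 0) /\
    (forall w : vec, x2 w = 0 -> lprod d w = 0) /\
    (forall x, L x <-> exists t : R, x = plus p (scal t d)).

Definition horizontal_circle (C : vec -> Prop) : Prop :=
  exists a b h rho : R, 0 < rho /\
    forall x, C x <-> exists v : R, x = (a + rho * cos v, b + rho * sin v, h).

Definition at_height (h : R) (T : vec -> Prop) : Prop :=
  forall p, T p -> x3 p = h.

Definition asymptotic_to_plane (S : vec -> Prop) (h : R) : Prop :=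
  (forall rho, exists p, S p /\ rho < enorm p) /\
  (forall eps, 0 < eps -> exists rho,
     forall p, S p -> rho < enorm p -> Rabs (x3 p - h) < eps).

(* The points [Y s v0], missing from the domain, are limits of the surface;
   adding them extends it regularly by points of a lightlike straight line. *)
Definition extends_to_lightlike_line (Y : R -> R -> vec) (I : R -> Prop)
    (D : R -> R -> Prop) (v0 : R) : Prop :=
  exists p d : vec, d <> (0, 0, 0) /\ lprod d d = 0 /\
    forall s, I s ->
      ~ surf Y D (Y s v0) /\
      (forall eps, 0 < eps -> exists v, D s v /\ Rabs (v - v0) < eps) /\
      immersed_at Y s v0 /\
      exists t : R, Y s v0 = plus p (scal t d).

(* [p] is a boundary point of the topological surface [S]: a neighborhood of
   [p] in [S] is parametrized by a half square with [p] on its edge.  An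
   injective continuous map on a compact set is a homeomorphism onto its
   image. *)
Definition boundary_point (S : vec -> Prop) (p : vec) : Prop :=
  exists (phi : R * R -> vec) (rho : R),
    0 < rho /\ phi (0, 0) = p /\
    let box (a : R * R) := 0 <= fst a <= rho /\ - rho <= snd a <= rho in
    (forall a, box a -> S (phi a)) /\
    continuous_on box phi /\
    (forall a b, box a -> box b -> phi a = phi b -> a = b) /\
    (exists delta, 0 < delta /\
       forall x, S x -> edist x p < delta -> exists a, box a /\ x = phi a).

Definition artanh (r : R) : R := / 2 * ln ((1 + r) / (1 - r)).

(* Representatives, reflected by [refl1], for [lam = 2] ([X_pos2]) and for
   [lam = -2] with radius greater ([X_neg2_out]) or less ([X_neg2_in]) than 1. *)
Definition X_pos2 (r v : R) : vec :=
  plus ((- r + atan r, 0, atan r) : vec) (scal r ((cos v, sin v, 0) : vec)).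

Definition X_neg2_out (r v : R) : vec :=
  plus ((- r - / 2 * ln ((r - 1) / (r + 1)), 0, / 2 * ln ((r - 1) / (r + 1)))
          : vec)
       (scal r ((cos v, sin v, 0) : vec)).

Definition X_neg2_in (r v : R) : vec :=
  plus ((r - artanh r, 0, artanh r) : vec) (scal r ((cos v, sin v, 0) : vec)).

(* Main.v *)
(* Write a circle foliated surface in a frame adapted to its planes, with center
   (a, b, h) and radius r.  The numerator of its mean curvature is a
   trigonometric polynomial of degree one along each leaf, so zero mean curvature
   amounts to three ordinary differential equations.  Parametrized by height, the
   first two say that (a', b') / r^2 is a constant vector, which is nonzero
   because the surface is not rotational; the third then has the first integral
   r'^2 = K r^4 + L r^2 + 1, and after scaling K to 1 the quantity q = r^2 is a
   parameter in which the center and the height are the elliptic integrals m, z.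

   The causal character at (q, v) is decided by comparing
   |q cos v + sqrt (q^2 + lam q + 1)| with 1.  In the radius r = sqrt q the
   integrands become r^2 / sqrt P and 1 / sqrt P with P = r^4 + lam r^2 + 1;
   as P is palindromic, the inversion r -> 1 / r turns the behavior at infinity
   (the limit straight line) into the behavior at r = 0 (the conelike point),
   and for lam < -2 exchanges the two intervals where P > 0. *)
From Stdlib Require Import Reals.
From Coquelicot Require Import Coquelicot.
From Stdlib Require Import Lra Psatz.
Require Import Defs.
Open Scope R_scope.

Lemma vec_eq (p q : vec) :
  x1 p = x1 q -> x2 p = x2 q -> x3 p = x3 q -> p = q.
Proof.
  destruct p as [[a b] c], q as [[a' b'] c']; unfold x1, x2, x3; simpl.
  now intros -> -> ->.
Qed.


Lemma x1_plus p q : x1 (plus p q) = x1 p + x1 q. Proof. reflexivity. Qed.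
Lemma x2_plus p q : x2 (plus p q) = x2 p + x2 q. Proof. reflexivity. Qed.
Lemma x3_plus p q : x3 (plus p q) = x3 p + x3 q. Proof. reflexivity. Qed.
Lemma x1_minus p q : x1 (minus p q) = x1 p - x1 q. Proof. reflexivity. Qed.
Lemma x2_minus p q : x2 (minus p q) = x2 p - x2 q. Proof. reflexivity. Qed.
Lemma x3_minus p q : x3 (minus p q) = x3 p - x3 q. Proof. reflexivity. Qed.
Lemma x1_scal k p : x1 (scal k p) = k * x1 p. Proof. reflexivity. Qed.
Lemma x2_scal k p : x2 (scal k p) = k * x2 p. Proof. reflexivity. Qed.
Lemma x3_scal k p : x3 (scal k p) = k * x3 p. Proof. reflexivity. Qed.
Lemma x1_pair a b c : x1 (a, b, c) = a. Proof. reflexivity. Qed.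
Lemma x2_pair a b c : x2 (a, b, c) = b. Proof. reflexivity. Qed.
Lemma x3_pair a b c : x3 (a, b, c) = c. Proof. reflexivity. Qed.

Ltac coords :=
  repeat rewrite ?x1_plus, ?x2_plus, ?x3_plus, ?x1_minus, ?x2_minus, ?x3_minus,
    ?x1_scal, ?x2_scal, ?x3_scal, ?x1_pair, ?x2_pair, ?x3_pair.

Definition fcomb (e1 e2 e3 : vec) (a b h : R) : vec :=
  plus (plus (scal a e1) (scal b e2)) (scal h e3).

Lemma lprod_fcomb e1 e2 e3 a b h a' b' h' :
  lorentz_frame e1 e2 e3 ->
  lprod (fcomb e1 e2 e3 a b h) (fcomb e1 e2 e3 a' b' h')
  = a * a' + b * b' - h * h'.
Proof.
  intros (H1 & H2 & H3 & H4 & H5 & H6).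
  transitivity (a * a' * lprod e1 e1 + b * b' * lprod e2 e2
    + h * h' * lprod e3 e3 + (a * b' + b * a') * lprod e1 e2
    + (a * h' + h * a') * lprod e1 e3 + (b * h' + h * b') * lprod e2 e3).
  - unfold lprod, fcomb; coords; ring.
  - rewrite H1, H2, H3, H4, H5, H6; ring.
Qed.

Lemma lprod_fcomb_frame e1 e2 e3 a b h :
  lorentz_frame e1 e2 e3 ->
  lprod (fcomb e1 e2 e3 a b h) e1 = a /\
  lprod (fcomb e1 e2 e3 a b h) e2 = b /\
  lprod (fcomb e1 e2 e3 a b h) e3 = - h.
Proof.
  intros Hf.
  pose proof (lprod_fcomb e1 e2 e3 a b h 1 0 0 Hf) as L1.
  pose proof (lprod_fcomb e1 e2 e3 a b h 0 1 0 Hf) as L2.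
  pose proof (lprod_fcomb e1 e2 e3 a b h 0 0 1 Hf) as L3.
  replace (fcomb e1 e2 e3 1 0 0) with e1 in L1
    by (unfold fcomb; apply vec_eq; coords; ring).
  replace (fcomb e1 e2 e3 0 1 0) with e2 in L2
    by (unfold fcomb; apply vec_eq; coords; ring).
  replace (fcomb e1 e2 e3 0 0 1) with e3 in L3
    by (unfold fcomb; apply vec_eq; coords; ring).
  repeat split; lra.
Qed.

Definition fdet (e1 e2 e3 : vec) : R := lprod (lcross e1 e2) e3.

Lemma fdet_neq0 e1 e2 e3 : lorentz_frame e1 e2 e3 -> fdet e1 e2 e3 <> 0.
Proof.
  intros (H1 & H2 & H3 & H4 & H5 & H6) H0.
  assert (fdet e1 e2 e3 ^ 2 =
    - (lprod e1 e1 * (lprod e2 e2 * lprod e3 e3 - lprod e2 e3 ^ 2)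
       - lprod e1 e2 * (lprod e1 e2 * lprod e3 e3 - lprod e2 e3 * lprod e1 e3)
       + lprod e1 e3 * (lprod e1 e2 * lprod e2 e3 - lprod e2 e2 * lprod e1 e3)))
    as E.
  { unfold fdet, lprod, lcross; coords; ring. }
  rewrite H0, H1, H2, H3, H4, H5, H6 in E; lra.
Qed.

Lemma fdet_fcomb e1 e2 e3 a b h a' b' h' a'' b'' h'' :
  fdet (fcomb e1 e2 e3 a b h) (fcomb e1 e2 e3 a' b' h')
    (fcomb e1 e2 e3 a'' b'' h'')
  = fdet e1 e2 e3 *
    (a * (b' * h'' - h' * b'') - b * (a' * h'' - h' * a'')
     + h * (a' * b'' - b' * a'')).
Proof. unfold fdet, lprod, lcross, fcomb; coords; ring. Qed.

Lemma fcomb_lprod e1 e2 e3 p :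
  lorentz_frame e1 e2 e3 ->
  p = fcomb e1 e2 e3 (lprod p e1) (lprod p e2) (- lprod p e3).
Proof.
  intros H; pose proof (fdet_neq0 _ _ _ H) as Hd.
  set (q := fcomb e1 e2 e3 (lprod p e1) (lprod p e2) (- lprod p e3)).
  assert (L : forall e, lprod (minus p q) e = lprod p e - lprod q e).
  { intros e; unfold lprod; coords; ring. }
  destruct (lprod_fcomb_frame e1 e2 e3 (lprod p e1) (lprod p e2) (- lprod p e3) H)
    as (Q1 & Q2 & Q3); fold q in Q1, Q2, Q3.
  assert (K1 : lprod (minus p q) e1 = 0) by (rewrite L, Q1; ring).
  assert (K2 : lprod (minus p q) e2 = 0) by (rewrite L, Q2; ring).
  assert (K3 : lprod (minus p q) e3 = 0) by (rewrite L, Q3; ring).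
  (* Cramer's rule: [fdet w * w_i] is a combination of the [lprod w e_j]. *)
  assert (C : forall w, fdet e1 e2 e3 * x1 w
      = lprod w e1 * x1 (lcross e2 e3) + lprod w e2 * x1 (lcross e3 e1)
        + lprod w e3 * x1 (lcross e1 e2) /\
     fdet e1 e2 e3 * x2 w
      = lprod w e1 * x2 (lcross e2 e3) + lprod w e2 * x2 (lcross e3 e1)
        + lprod w e3 * x2 (lcross e1 e2) /\
     fdet e1 e2 e3 * x3 w
      = lprod w e1 * x3 (lcross e2 e3) + lprod w e2 * x3 (lcross e3 e1)
        + lprod w e3 * x3 (lcross e1 e2)).
  { intros w; unfold fdet, lprod, lcross; coords; repeat split; ring. }
  destruct (C (minus p q)) as (C1 & C2 & C3).
  rewrite K1, K2, K3 in C1, C2, C3; revert C1 C2 C3; coords; intros C1 C2 C3.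
  apply vec_eq; apply Rminus_diag_uniq; apply (Rmult_eq_reg_l (fdet e1 e2 e3));
    trivial; rewrite Rmult_0_r, ?C1, ?C2, ?C3; ring.
Qed.

(* Works up to eta: [auto_derive] produces [Derive (fun x => f x)]. *)
Ltac derive_values :=
  repeat match goal with
  | H : is_derive ?f ?x ?l |- context [Derive ?g ?x] =>
      rewrite (is_derive_unique g x l H)
  end.

Lemma dvec_ext_loc (f g : R -> vec) t :
  locally t (fun u => f u = g u) -> dvec f t = dvec g t.
Proof.
  intros H; unfold dvec; apply vec_eq; coords; apply Derive_ext_loc;
    revert H; apply filter_imp; now intros u ->.
Qed.

Lemma is_derive_lincomb (A B C : R -> R) t A' B' C' p q k :
  is_derive A t A' -> is_derive B t B' -> is_derive C t C' ->
  is_derive (fun u => A u * p + B u * q + C u * k) t (A' * p + B' * q + C' * k).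
Proof.
  intros HA HB HC.
  auto_derive; [repeat split; eexists; eassumption|].
  derive_values; ring.
Qed.

Lemma dvec_fcomb e1 e2 e3 (A B C : R -> R) t A' B' C' :
  is_derive A t A' -> is_derive B t B' -> is_derive C t C' ->
  dvec (fun u => fcomb e1 e2 e3 (A u) (B u) (C u)) t = fcomb e1 e2 e3 A' B' C'.
Proof.
  intros HA HB HC; unfold dvec, fcomb; apply vec_eq; coords;
    apply is_derive_unique.
  - apply (is_derive_lincomb A B C t A' B' C' (x1 e1) (x1 e2) (x1 e3)); auto.
  - apply (is_derive_lincomb A B C t A' B' C' (x2 e1) (x2 e2) (x2 e3)); auto.
  - apply (is_derive_lincomb A B C t A' B' C' (x3 e1) (x3 e2) (x3 e3)); auto.
Qed.

Definition std1 : vec := (1, 0, 0).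
Definition std2 : vec := (0, 1, 0).
Definition std3 : vec := (0, 0, 1).

Lemma lorentz_frame_std : lorentz_frame std1 std2 std3.
Proof. unfold lorentz_frame, lprod, std1, std2, std3; coords; lra. Qed.

Lemma fcomb_std a b c : fcomb std1 std2 std3 a b c = (a, b, c).
Proof. unfold fcomb, std1, std2, std3; apply vec_eq; coords; ring. Qed.

Lemma pair_neq0 (a : R * R) : a <> (0, 0) -> fst a <> 0 \/ snd a <> 0.
Proof.
  destruct a as [a b]; simpl; intros H.
  destruct (Req_dec a 0) as [->|]; [|now left].
  right; intros ->; now apply H.
Qed.

Lemma sin2_eq v : sin v ^ 2 = 1 - cos v ^ 2.
Proof. pose proof (sin2_cos2 v); unfold Rsqr in *; lra. Qed.

(* In the basis [(cos v, sin v), (- sin v, cos v), e3], the coordinates of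
   [Y_s] are [phi, psi, H'] and those of [Y_v] are [0, rho, 0]. *)
Section Causal.

Variables (Y : R -> R -> vec) (s v A B r H rho : R).
Hypothesis Hd1 : d1 Y s v = (A + r * cos v, B + r * sin v, H).
Hypothesis Hd2 : d2 Y s v = (- rho * sin v, rho * cos v, 0).
Hypothesis Hrho : 0 < rho.

Let phi := A * cos v + B * sin v + r.
Let psi := - A * sin v + B * cos v.

Lemma lprod_tangent (a b : R * R) :
  lprod (tangent Y s v a) (tangent Y s v b) =
  fst a * fst b * (phi ^ 2 - H ^ 2)
  + (psi * fst a + rho * snd a) * (psi * fst b + rho * snd b).
Proof.
  unfold tangent; rewrite Hd1, Hd2; unfold lprod, phi, psi; coords.
  pose proof (sin2_eq v) as T; ring [T].
Qed.

Lemma immersed_intro : H <> 0 -> immersed_at Y s v.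
Proof.
  intros HH a Ha E; apply Ha.
  assert (fst a = 0).
  { apply (f_equal x3) in E; revert E.
    unfold tangent; rewrite Hd1, Hd2; coords; intros E.
    apply (Rmult_eq_reg_r H); lra. }
  assert (snd a * rho = 0).
  { pose proof (f_equal x1 E) as E1; pose proof (f_equal x2 E) as E2.
    revert E1 E2; unfold tangent; rewrite Hd1, Hd2, H0; coords; intros E1 E2.
    pose proof (sin2_eq v) as T.
    replace (snd a * rho) with
      (- sin v * (snd a * (- rho * sin v)) + cos v * (snd a * (rho * cos v)))
      by ring [T].
    replace (snd a * (- rho * sin v)) with 0 by lra.
    replace (snd a * (rho * cos v)) with 0 by lra; ring. }
  destruct a as [a b]; simpl in *; f_equal; trivial.
  apply (Rmult_eq_reg_r rho); lra.
Qed.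

Lemma spacelike_intro : H ^ 2 < phi ^ 2 -> spacelike_at Y s v.
Proof.
  intros HH a Ha; rewrite lprod_tangent.
  destruct (Req_dec (fst a) 0) as [E|E].
  - destruct (pair_neq0 a Ha) as [|E']; [lra|].
    rewrite E.
    assert (0 < (rho * snd a) * (rho * snd a)); [|lra].
    apply Rlt_0_sqr; apply Rmult_integral_contrapositive_currified; lra.
  - assert (0 < fst a * fst a) by now apply Rlt_0_sqr.
    pose proof (Rle_0_sqr (psi * fst a + rho * snd a)); unfold Rsqr in *; nra.
Qed.

Lemma timelike_intro : phi ^ 2 < H ^ 2 -> timelike_at Y s v.
Proof.
  intros HH; split.
  - exists (0, 1); rewrite lprod_tangent; simpl; nra.
  - exists (1, - psi / rho); rewrite lprod_tangent; simpl fst; simpl snd.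
    replace (psi * 1 + rho * (- psi / rho)) with 0 by (field; lra); lra.
Qed.

Lemma lightlike_intro : H <> 0 -> phi ^ 2 = H ^ 2 -> lightlike_at Y s v.
Proof.
  intros HH E; split; [now apply immersed_intro|].
  exists (1, - psi / rho); split.
  - intros K; injection K; lra.
  - intros b; rewrite lprod_tangent, E; simpl fst; simpl snd.
    replace (psi * 1 + rho * (- psi / rho)) with 0 by (field; lra); ring.
Qed.

End Causal.

Lemma nondegenerate_of_gram (Y : R -> R -> vec) s v :
  lprod (d1 Y s v) (d1 Y s v) * lprod (d2 Y s v) (d2 Y s v)
    - lprod (d1 Y s v) (d2 Y s v) ^ 2 <> 0 ->
  ~ degenerate_metric_at Y s v.
Proof.
  intros HW (a & Ha & K); apply HW.
  pose proof (K (1, 0)) as K1; pose proof (K (0, 1)) as K2.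
  set (E := lprod (d1 Y s v) (d1 Y s v)) in *.
  set (F := lprod (d1 Y s v) (d2 Y s v)) in *.
  set (G := lprod (d2 Y s v) (d2 Y s v)) in *.
  assert (L1 : fst a * E + snd a * F = 0).
  { rewrite <- K1; unfold E, F, tangent, lprod; simpl fst; simpl snd; coords; ring. }
  assert (L2 : fst a * F + snd a * G = 0).
  { rewrite <- K2; unfold G, F, tangent, lprod; simpl fst; simpl snd; coords; ring. }
  destruct (pair_neq0 a Ha) as [N|N].
  - apply (Rmult_eq_reg_l (fst a)); trivial.
    transitivity (G * (fst a * E + snd a * F) - F * (fst a * F + snd a * G)); [ring|].
    rewrite L1, L2; ring.
  - apply (Rmult_eq_reg_l (snd a)); trivial.
    transitivity (E * (fst a * F + snd a * G) - F * (fst a * E + snd a * F)); [ring|].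
    rewrite L1, L2; ring.
Qed.

(** * Mean curvature of a surface foliated by circles *)

Lemma derive_zero (U : R -> Prop) (f : R -> R) v l :
  open U -> (forall x, U x -> f x = 0) -> U v -> is_derive f v l -> l = 0.
Proof.
  intros HU Hf Hv Hd.
  rewrite <- (is_derive_unique f v l Hd), (Derive_ext_loc f (fun _ => 0)).
  - apply Derive_const.
  - generalize (HU v Hv); apply filter_imp; exact Hf.
Qed.

Section Trigonometric.

Variable U : R -> Prop.
Hypothesis HU : open U.

Definition trig_poly (a0 a1 b1 a2 b2 v : R) : R :=
  a0 + a1 * cos v + b1 * sin v + a2 * cos (2 * v) + b2 * sin (2 * v).

Lemma trig_poly_derive a0 a1 b1 a2 b2 :
  (forall v, U v -> trig_poly a0 a1 b1 a2 b2 v = 0) ->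
  forall v, U v -> trig_poly 0 b1 (- a1) (2 * b2) (- 2 * a2) v = 0.
Proof.
  intros Hf v Hv; apply (derive_zero U _ v _ HU Hf Hv).
  unfold trig_poly; auto_derive; trivial; ring.
Qed.

Lemma trig_poly_zero a0 a1 b1 a2 b2 :
  (exists v, U v) -> (forall v, U v -> trig_poly a0 a1 b1 a2 b2 v = 0) ->
  a0 = 0 /\ a1 = 0 /\ b1 = 0 /\ a2 = 0 /\ b2 = 0.
Proof.
  intros (v & Hv) H0.
  pose proof (trig_poly_derive _ _ _ _ _ H0) as H1.
  pose proof (trig_poly_derive _ _ _ _ _ H1) as H2.
  pose proof (trig_poly_derive _ _ _ _ _ H2) as H3.
  pose proof (trig_poly_derive _ _ _ _ _ H3) as H4.
  specialize (H0 v Hv); specialize (H1 v Hv); specialize (H2 v Hv).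
  specialize (H3 v Hv); specialize (H4 v Hv).
  unfold trig_poly in *.
  pose proof (sin2_eq v) as T1; pose proof (sin2_eq (2 * v)) as T2.
  set (c := cos v) in *; set (s := sin v) in *.
  set (c2 := cos (2 * v)) in *; set (s2 := sin (2 * v)) in *.
  assert (K1 : a2 * c2 + b2 * s2 = 0) by lra.
  assert (K2 : a2 * s2 - b2 * c2 = 0) by lra.
  assert (a2 = 0).
  { transitivity (c2 * (a2 * c2 + b2 * s2) + s2 * (a2 * s2 - b2 * c2));
      [ring [T2]|rewrite K1, K2; ring]. }
  assert (b2 = 0).
  { transitivity (s2 * (a2 * c2 + b2 * s2) - c2 * (a2 * s2 - b2 * c2));
      [ring [T2]|rewrite K1, K2; ring]. }
  subst a2 b2.
  assert (L1 : a1 * c + b1 * s = 0) by lra.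
  assert (L2 : a1 * s - b1 * c = 0) by lra.
  assert (a1 = 0).
  { transitivity (c * (a1 * c + b1 * s) + s * (a1 * s - b1 * c));
      [ring [T1]|rewrite L1, L2; ring]. }
  assert (b1 = 0).
  { transitivity (s * (a1 * c + b1 * s) - c * (a1 * s - b1 * c));
      [ring [T1]|rewrite L1, L2; ring]. }
  subst; repeat split; lra.
Qed.

Lemma trig_poly1_zero a0 a1 b1 :
  (exists v, U v) -> (forall v, U v -> a0 + a1 * cos v + b1 * sin v = 0) ->
  a0 = 0 /\ a1 = 0 /\ b1 = 0.
Proof.
  intros Hv H.
  destruct (trig_poly_zero a0 a1 b1 0 0 Hv) as (? & ? & ? & _); auto.
  intros v Uv; unfold trig_poly; specialize (H v Uv); lra.
Qed.

End Trigonometric.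

Lemma continuous_neq0 (f : R -> R) v :
  continuous f v -> f v <> 0 -> locally v (fun x => f x <> 0).
Proof.
  intros Hf Hv; apply (Hf (fun y => y <> 0)).
  apply open_neq; exact Hv.
Qed.

Lemma mul_zero_open (U : R -> Prop) (f g : R -> R) :
  open U -> (forall v, continuous f v) ->
  (forall v, U v -> f v * g v = 0) ->
  (forall v, U v -> f v = 0) \/
  (exists V : R -> Prop, open V /\ (exists v, V v) /\
     forall v, V v -> U v /\ g v = 0).
Proof.
  intros HU Hf H.
  destruct (Classical_Prop.classic (exists v, U v /\ f v <> 0)) as [(v0 & Hv0 & N)|N].
  - right; exists (fun v => U v /\ f v <> 0); split; [|split].
    + intros v (Uv & Fv); apply filter_and; [now apply HU|].
      now apply continuous_neq0.
    + now exists v0.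
    + intros v (Uv & Fv); split; trivial.
      destruct (Rmult_integral _ _ (H v Uv)); tauto.
  - left; intros v Uv; destruct (Req_dec (f v) 0); trivial.
    exfalso; apply N; now exists v.
Qed.

Lemma open_section (D : R -> R -> Prop) s v :
  open (fun sv : R * R => D (fst sv) (snd sv)) -> D s v ->
  locally s (fun u => D u v) /\ locally v (fun w => D s w).
Proof.
  intros HD Hsv; destruct (HD (s, v) Hsv) as (eps & Heps).
  split; exists eps; intros y Hy; apply (Heps (_, _)); split; simpl; trivial;
    apply ball_center.
Qed.

Lemma is_derive_add_mul (f g : R -> R) s f' g' k :
  is_derive f s f' -> is_derive g s g' ->
  is_derive (fun u => f u + g u * k) s (f' + g' * k).
Proof.
  intros Hf Hg; auto_derive; [repeat split; eexists; eassumption|].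
  derive_values; ring.
Qed.

Definition twice_derivable_on (I : R -> Prop) (f : R -> R) : Prop :=
  forall s, I s -> ex_derive f s /\ ex_derive (Derive f) s.

Section Foliation.

Variables (I : R -> Prop) (D : R -> R -> Prop) (Y : R -> R -> vec).
Variables (e1 e2 e3 : vec) (a b h r : R -> R).
Hypothesis Hframe : lorentz_frame e1 e2 e3.
Hypothesis HD : open (fun sv : R * R => D (fst sv) (snd sv)).
Hypothesis HDI : forall s v, D s v -> I s.
Hypothesis Ha : twice_derivable_on I a.
Hypothesis Hb : twice_derivable_on I b.
Hypothesis Hh : twice_derivable_on I h.
Hypothesis Hr : twice_derivable_on I r.
Hypothesis Hr0 : forall s, I s -> 0 < r s.
Hypothesis HY : forall s v, D s v ->
  Y s v = fcomb e1 e2 e3 (a s + r s * cos v) (b s + r s * sin v) (h s).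

Let a' := Derive a.
Let b' := Derive b.
Let h' := Derive h.
Let r' := Derive r.
Let a'' := Derive a'.
Let b'' := Derive b'.
Let h'' := Derive h'.
Let r'' := Derive r'.

Lemma d1_foliation s v : D s v ->
  d1 Y s v = fcomb e1 e2 e3 (a' s + r' s * cos v) (b' s + r' s * sin v) (h' s).
Proof.
  intros Hsv; pose proof (HDI _ _ Hsv) as Is; unfold d1.
  rewrite (dvec_ext_loc _ (fun u => fcomb e1 e2 e3 (a u + r u * cos v)
    (b u + r u * sin v) (h u))).
  2:{ generalize (proj1 (open_section D s v HD Hsv)); apply filter_imp.
      intros u Hu; now apply HY. }
  apply dvec_fcomb.
  - apply is_derive_add_mul; apply Derive_correct; [apply (Ha s Is)|apply (Hr s Is)].
  - apply is_derive_add_mul; apply Derive_correct; [apply (Hb s Is)|apply (Hr s Is)].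
  - apply Derive_correct, (Hh s Is).
Qed.

Lemma d2_foliation s v : D s v ->
  d2 Y s v = fcomb e1 e2 e3 (- r s * sin v) (r s * cos v) 0.
Proof.
  intros Hsv; unfold d2.
  rewrite (dvec_ext_loc _ (fun w => fcomb e1 e2 e3 (a s + r s * cos w)
    (b s + r s * sin w) (h s))).
  2:{ generalize (proj2 (open_section D s v HD Hsv)); apply filter_imp.
      intros w Hw; now apply HY. }
  apply dvec_fcomb; auto_derive; trivial; ring.
Qed.

Lemma d11_foliation s v : D s v ->
  d1 (d1 Y) s v
  = fcomb e1 e2 e3 (a'' s + r'' s * cos v) (b'' s + r'' s * sin v) (h'' s).
Proof.
  intros Hsv; pose proof (HDI _ _ Hsv) as Is; unfold d1 at 1.
  rewrite (dvec_ext_loc _ (fun u => fcomb e1 e2 e3 (a' u + r' u * cos v)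
    (b' u + r' u * sin v) (h' u))).
  2:{ generalize (proj1 (open_section D s v HD Hsv)); apply filter_imp.
      intros u Hu; now apply d1_foliation. }
  apply dvec_fcomb.
  - apply is_derive_add_mul; apply Derive_correct; [apply (Ha s Is)|apply (Hr s Is)].
  - apply is_derive_add_mul; apply Derive_correct; [apply (Hb s Is)|apply (Hr s Is)].
  - apply Derive_correct, (Hh s Is).
Qed.

Lemma d12_foliation s v : D s v ->
  d1 (d2 Y) s v = fcomb e1 e2 e3 (- r' s * sin v) (r' s * cos v) 0.
Proof.
  intros Hsv; pose proof (HDI _ _ Hsv) as Is; unfold d1 at 1.
  rewrite (dvec_ext_loc _ (fun u => fcomb e1 e2 e3 (- r u * sin v)
    (r u * cos v) 0)).
  2:{ generalize (proj1 (open_section D s v HD Hsv)); apply filter_imp.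
      intros u Hu; now apply d2_foliation. }
  pose proof (Derive_correct r s (proj1 (Hr s Is))) as Dr.
  apply dvec_fcomb; auto_derive; trivial; try apply (Hr s Is);
    derive_values; unfold r'; ring.
Qed.

Lemma d22_foliation s v : D s v ->
  d2 (d2 Y) s v = fcomb e1 e2 e3 (- r s * cos v) (- r s * sin v) 0.
Proof.
  intros Hsv; unfold d2 at 1.
  rewrite (dvec_ext_loc _ (fun w => fcomb e1 e2 e3 (- r s * sin w)
    (r s * cos w) 0)).
  2:{ generalize (proj2 (open_section D s v HD Hsv)); apply filter_imp.
      intros w Hw; now apply d2_foliation. }
  apply dvec_fcomb; auto_derive; trivial; ring.
Qed.

Definition normal_speed s v := a' s * cos v + b' s * sin v + r' s.

Lemma gram_foliation s v : D s v ->
  lprod (d1 Y s v) (d1 Y s v) * lprod (d2 Y s v) (d2 Y s v)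
    - lprod (d1 Y s v) (d2 Y s v) ^ 2
  = r s ^ 2 * (normal_speed s v - h' s) * (normal_speed s v + h' s).
Proof.
  intros Hsv; rewrite d1_foliation, d2_foliation, !lprod_fcomb by trivial.
  pose proof (sin2_eq v) as T; unfold normal_speed; ring [T].
Qed.

Definition zmc_defect s v :=
  (r s * (h' s * r'' s - h'' s * r' s)
   - h' s * (a' s ^ 2 + b' s ^ 2 + r' s ^ 2 - h' s ^ 2))
  + (r s * (h' s * a'' s - h'' s * a' s) - 2 * h' s * r' s * a' s) * cos v
  + (r s * (h' s * b'' s - h'' s * b' s) - 2 * h' s * r' s * b' s) * sin v.

Lemma mean_curvature_foliation s v : D s v ->
  exists k, mean_curvature Y s v = k * zmc_defect s v /\
    ((normal_speed s v - h' s) * (normal_speed s v + h' s) <> 0 -> k <> 0).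
Proof.
  intros Hsv.
  pose proof (Hr0 s (HDI _ _ Hsv)) as Rpos.
  pose proof (gram_foliation s v Hsv) as EW.
  set (W := lprod (d1 Y s v) (d1 Y s v) * lprod (d2 Y s v) (d2 Y s v)
    - lprod (d1 Y s v) (d2 Y s v) ^ 2) in *.
  pose proof (fdet_neq0 _ _ _ Hframe) as F0.
  exists (- (/ sqrt (Rabs W) * fdet e1 e2 e3 * r s ^ 2 / W)); split.
  2:{ intros HW.
    assert (W0 : W <> 0).
    { rewrite EW, Rmult_assoc.
      apply Rmult_integral_contrapositive_currified; trivial.
      apply pow_nonzero; lra. }
    assert (S0 : sqrt (Rabs W) <> 0).
    { apply Rgt_not_eq, sqrt_lt_R0, Rabs_pos_lt, W0. }
    apply Ropp_neq_0_compat; unfold Rdiv.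
    repeat apply Rmult_integral_contrapositive_currified; trivial;
      try apply Rinv_neq_0_compat; trivial; lra. }
  unfold mean_curvature; fold W; cbv zeta.
  assert (L : forall k n w, lprod (scal k n) w = k * lprod n w).
  { intros; unfold lprod; coords; ring. }
  rewrite !L.
  change (lprod (lcross ?x ?y) ?z) with (fdet x y z).
  rewrite d11_foliation, d12_foliation, d22_foliation, d1_foliation,
    d2_foliation, !lprod_fcomb, !fdet_fcomb by trivial.
  pose proof (sin2_eq v) as T.
  unfold Rdiv; generalize (/ W) (/ sqrt (Rabs W)); intros i j.
  unfold zmc_defect; ring [T].
Qed.

End Foliation.

Definition convex (I : R -> Prop) : Prop :=
  forall x y s, I x -> I y -> x <= s <= y -> I s.

Lemma convex_between (I : R -> Prop) x y s :
  convex I -> I x -> I y -> Rmin x y <= s <= Rmax x y -> I s.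
Proof.
  intros HI Ix Iy; unfold Rmin, Rmax; destruct (Rle_dec x y); intros Hs;
    [apply (HI x y)|apply (HI y x)]; trivial.
Qed.

Lemma MVT_convex (I : R -> Prop) (f df : R -> R) x y :
  convex I -> (forall s, I s -> is_derive f s (df s)) -> I x -> I y ->
  exists c, Rmin x y <= c <= Rmax x y /\ I c /\ f y - f x = df c * (y - x).
Proof.
  intros HI Hf Ix Iy.
  destruct (MVT_gen f x y df) as (c & Hc & E).
  - intros s Hs; apply Hf, (convex_between I x y); trivial; lra.
  - intros s Hs; apply continuity_pt_filterlim, (ex_derive_continuous f).
    exists (df s); apply Hf, (convex_between I x y); trivial; lra.
  - exists c; split; [|split]; trivial; apply (convex_between I x y); trivial; lra.
Qed.

Lemma derive_zero_constant (I : R -> Prop) (f : R -> R) x y :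
  convex I -> (forall s, I s -> is_derive f s 0) -> I x -> I y -> f x = f y.
Proof.
  intros HI Hf Ix Iy.
  destruct (MVT_convex I f (fun _ => 0) x y) as (c & _ & _ & E); trivial; lra.
Qed.

(* If [u] or [u'] vanishes at each point, then [(u ^ 2)' = 0]. *)
Lemma constant_of_zero_or_derive_zero (I : R -> Prop) (u du : R -> R) :
  convex I -> (exists s, I s) ->
  (forall s, I s -> is_derive u s (du s)) ->
  (forall s, I s -> u s = 0 \/ du s = 0) ->
  exists c, forall s, I s -> u s = c.
Proof.
  intros HI (s0 & I0) Hu H0.
  assert (Sq : forall s, I s -> u s ^ 2 = u s0 ^ 2).
  { intros s Is; apply (derive_zero_constant I (fun x => u x ^ 2)); trivial.
    intros x Ix; pose proof (Hu x Ix) as Dx; auto_derive; [now exists (du x)|].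
    derive_values; destruct (H0 x Ix) as [->| ->]; ring. }
  exists (u s0); intros s Is.
  destruct (Req_dec (u s0) 0) as [E|E].
  - rewrite E; specialize (Sq s Is); rewrite E in Sq; nra.
  - apply (derive_zero_constant I u); trivial; intros x Ix.
    replace 0 with (du x); [now apply Hu|].
    destruct (H0 x Ix) as [E'|]; trivial.
    specialize (Sq x Ix); rewrite E' in Sq; exfalso; apply E; nra.
Qed.

Lemma sq_le_between x y : 0 <= y -> x ^ 2 <= y ^ 2 -> - y <= x <= y.
Proof. intros Hy H; split; nra. Qed.

Lemma gronwall_zero (I : R -> Prop) (y dy k : R -> R) x0 x :
  convex I -> (forall s, I s -> is_derive y s (dy s)) ->
  (forall s, I s -> continuous k s) ->
  (forall s, I s -> dy s ^ 2 = k s ^ 2 * y s ^ 2) ->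
  I x0 -> I x -> y x0 = 0 -> y x = 0.
Proof.
  intros HI Hy Hk E I0 Ix Y0.
  destruct (continuity_ab_maj (fun s => k s ^ 2) (Rmin x0 x) (Rmax x0 x))
    as (sM & HM & _).
  { apply Rmin_Rmax. }
  { intros s Hs; apply continuity_pt_filterlim.
    apply (continuous_comp k (fun t => t ^ 2)).
    - apply Hk, (convex_between I x0 x); trivial.
    - apply (ex_derive_continuous (fun t => t ^ 2)); auto_derive; trivial. }
  set (M := 1 + k sM ^ 2).
  assert (B : forall s, Rmin x0 x <= s <= Rmax x0 x ->
    - M * y s ^ 2 <= y s * dy s <= M * y s ^ 2).
  { intros s Hs; specialize (HM s Hs); cbv beta in HM.
    assert (Is : I s) by now apply (convex_between I x0 x).
    specialize (E s Is).
    assert (k s ^ 2 <= M ^ 2).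
    { apply Rle_trans with (1 := HM); unfold M.
      generalize (pow2_ge_0 (k sM)); generalize (k sM ^ 2); intros; nra. }
    assert (M1 : 1 <= M) by (unfold M; pose proof (pow2_ge_0 (k sM)); lra).
    assert ((y s * dy s) ^ 2 <= (M * y s ^ 2) ^ 2).
    { replace ((y s * dy s) ^ 2) with (k s ^ 2 * (y s ^ 2 * y s ^ 2)) by
        (rewrite Rpow_mult_distr, E; ring).
      replace ((M * y s ^ 2) ^ 2) with (M ^ 2 * (y s ^ 2 * y s ^ 2)) by ring.
      apply Rmult_le_compat_r; trivial.
      pose proof (pow2_ge_0 (y s)); nra. }
    assert (0 <= M * y s ^ 2) by (pose proof (pow2_ge_0 (y s)); nra).
    rewrite Ropp_mult_distr_l_reverse; now apply sq_le_between. }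
  assert (G : forall t, exists c, Rmin x0 x <= c <= Rmax x0 x /\
    y x ^ 2 * exp (t * x) =
    (2 * (y c * dy c) + t * y c ^ 2) * exp (t * c) * (x - x0)).
  { intros t.
    destruct (MVT_convex I (fun s => y s ^ 2 * exp (t * s))
      (fun s => (2 * (y s * dy s) + t * y s ^ 2) * exp (t * s)) x0 x)
      as (c & Hc & _ & Ec); trivial.
    - intros s Is; pose proof (Hy s Is) as Dy; auto_derive.
      + now exists (dy s).
      + derive_values; ring.
    - exists c; split; trivial; rewrite <- Ec, Y0; ring. }
  assert (Z : y x ^ 2 <= 0).
  { destruct (Rle_dec x0 x) as [L|L].
    - destruct (G (- (2 * M))) as (c & Hc & Ec); specialize (B c Hc).
      pose proof (exp_pos (- (2 * M) * x)); pose proof (exp_pos (- (2 * M) * c)).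
      assert (0 <= exp (- (2 * M) * c) * (x - x0)) by nra.
      nra.
    - destruct (G (2 * M)) as (c & Hc & Ec); specialize (B c Hc).
      pose proof (exp_pos (2 * M * x)); pose proof (exp_pos (2 * M * c)).
      assert (0 <= exp (2 * M * c) * (x0 - x)) by nra.
      nra. }
  nra.
Qed.

Lemma ivt_convex (J : R -> Prop) (f : R -> R) x y t :
  convex J -> (forall s, J s -> continuous f s) -> J x -> J y ->
  f x <= t <= f y -> exists s, J s /\ f s = t.
Proof.
  intros HJ Hf Jx Jy Ht.
  destruct (Req_dec (f x) t) as [|Nx]; [now exists x|].
  destruct (Req_dec (f y) t) as [|Ny]; [now exists y|].
  assert (C : forall s, Rmin x y <= s <= Rmax x y -> continuous f s).
  { intros s Hs; apply Hf, (convex_between J x y); trivial. }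
  assert (exists s, Rmin x y <= s <= Rmax x y /\ f s = t) as (s & Hs & E).
  { destruct (Rtotal_order x y) as [L|[->|L]]; [| lra |].
    - rewrite Rmin_left, Rmax_right in * by lra.
      destruct (Ranalysis5.IVT_interv (fun s => f s - t) x y) as (s & Hs & E);
        [|lra|lra|lra|exists s; split; trivial; lra].
      intros s Hs; apply continuity_pt_minus;
        [apply continuity_pt_filterlim, C; lra|].
      apply continuity_pt_const; intros ? ?; reflexivity.
    - rewrite Rmin_right, Rmax_left in * by lra.
      destruct (Ranalysis5.IVT_interv (fun s => t - f s) y x) as (s & Hs & E);
        [|lra|lra|lra|exists s; split; trivial; lra].
      intros s Hs; apply continuity_pt_minus;
        [|apply continuity_pt_filterlim, C; lra].
      apply continuity_pt_const; intros ? ?; reflexivity. }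
  exists s; split; trivial; apply (convex_between J x y); trivial.
Qed.

Lemma constant_sign (J : R -> Prop) (f : R -> R) :
  convex J -> (exists s, J s) -> (forall s, J s -> continuous f s) ->
  (forall s, J s -> f s <> 0) ->
  exists e, (e = 1 \/ e = -1) /\ forall s, J s -> 0 < e * f s.
Proof.
  intros HJ (s0 & J0) Hf N.
  assert (P : forall x y, J x -> J y -> f x < 0 -> 0 < f y -> False).
  { intros x y Jx Jy Hx Hy.
    destruct (ivt_convex J f x y 0) as (s & Js & E); trivial; [lra|].
    now apply (N s). }
  destruct (Rlt_dec 0 (f s0)) as [L|L].
  - exists 1; split; [now left|]; intros s Js; specialize (N s Js).
    destruct (Rlt_dec (f s) 0); [exfalso; now apply (P s s0)|lra].
  - exists (-1); split; [now right|]; intros s Js.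
    pose proof (N s Js); pose proof (N s0 J0).
    destruct (Rlt_dec 0 (f s)); [exfalso; apply (P s0 s); trivial; lra|lra].
Qed.

Lemma polar x y rho :
  0 < rho -> rho ^ 2 = x ^ 2 + y ^ 2 ->
  exists t, - PI < t <= PI /\ x = rho * cos t /\ y = rho * sin t.
Proof.
  intros Hr E; pose proof PI_RGT_0.
  assert (B : -1 <= x / rho <= 1).
  { split; [apply Rle_div_r|apply Rle_div_l]; trivial;
      pose proof (pow2_ge_0 y); nra. }
  pose proof (acos_bound (x / rho)) as Bt.
  assert (C : rho * cos (acos (x / rho)) = x).
  { rewrite cos_acos by trivial; field; lra. }
  assert (S : (rho * sin (acos (x / rho))) ^ 2 = y ^ 2).
  { pose proof (sin2_eq (acos (x / rho))) as T.
    replace (y ^ 2) with (rho ^ 2 - (rho * cos (acos (x / rho))) ^ 2)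
      by (rewrite C; lra).
    ring [T]. }
  assert (S0 : 0 <= rho * sin (acos (x / rho))).
  { apply Rmult_le_pos; [lra|]; apply sin_ge_0; lra. }
  destruct (Rle_dec 0 y) as [L|L].
  - exists (acos (x / rho)); split; [lra|]; split; [lra|nra].
  - exists (- acos (x / rho)); rewrite cos_neg, sin_neg.
    assert (rho * sin (acos (x / rho)) = - y) by nra.
    split; [|split; lra].
    destruct (Req_dec (acos (x / rho)) PI) as [Q|Q]; [|lra].
    rewrite Q, sin_PI in *; lra.
Qed.

Lemma is_derive_RInt_between (P : R -> Prop) (f : R -> R) a q :
  open P -> (forall x, P x -> continuous f x) ->
  (forall t, Rmin a q <= t <= Rmax a q -> P t) ->
  is_derive (RInt f a) q (f q).
Proof.
  intros HP Hf Hq.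
  assert (Pq : P q) by (apply Hq; split; [apply Rmin_r|apply Rmax_r]).
  apply (is_derive_RInt f (RInt f a) a q); [|now apply Hf].
  destruct (HP q Pq) as (eps & Heps); exists eps; intros x Hx.
  apply (RInt_correct f), (ex_RInt_continuous (V := R_CompleteNormedModule)).
  intros t Ht; apply Hf.
  destruct (Rle_dec (Rmin a q) t) as [L|L];
    [destruct (Rle_dec t (Rmax a q)) as [L'|L']|]; [now apply Hq| |];
    apply Heps; revert Hx; unfold ball; simpl; unfold AbsRing_ball, minus, plus,
      opp, abs; simpl; intros Hx; apply Rabs_def2 in Hx; apply Rabs_def1;
    revert L Ht; try revert L'; unfold Rmin, Rmax;
    destruct (Rle_dec a q), (Rle_dec a x); intros; lra.
Qed.

(** * The differential equations of a zero mean curvature foliation *)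

Lemma twice_derivable_lincomb (I : R -> Prop) (f g k : R -> R) p q w :
  open I -> twice_derivable_on I f -> twice_derivable_on I g ->
  twice_derivable_on I k ->
  twice_derivable_on I (fun s => f s * p + g s * q + k s * w).
Proof.
  intros HI Hf Hg Hk.
  assert (D1 : forall s, I s -> is_derive (fun s => f s * p + g s * q + k s * w)
    s (Derive f s * p + Derive g s * q + Derive k s * w)).
  { intros s Is; apply is_derive_lincomb; apply Derive_correct;
      [apply (Hf s Is)|apply (Hg s Is)|apply (Hk s Is)]. }
  intros s Is; split; [eexists; now apply D1|].
  apply (ex_derive_ext_loc (fun s => Derive f s * p + Derive g s * q + Derive k s * w)).
  - generalize (HI s Is); apply filter_imp; intros u Iu.
    symmetry; now apply is_derive_unique, D1.
  - eexists; apply is_derive_lincomb; apply Derive_correct;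
      [apply (Hf s Is)|apply (Hg s Is)|apply (Hk s Is)].
Qed.

Lemma twice_derivable_of_C2 I f : C2_on I f -> twice_derivable_on I f.
Proof. intros H s Is; split; apply (H s Is). Qed.

Lemma circle_foliated_coords I D Y r :
  circle_foliated I D Y r ->
  exists (e1 e2 e3 : vec) (a b h : R -> R),
    lorentz_frame e1 e2 e3 /\
    twice_derivable_on I a /\ twice_derivable_on I b /\
    twice_derivable_on I h /\ twice_derivable_on I r /\
    (forall s, I s -> 0 < r s) /\ (forall s, I s -> Derive h s <> 0) /\
    (forall s v, D s v ->
      Y s v = fcomb e1 e2 e3 (a s + r s * cos v) (b s + r s * sin v) (h s)).
Proof.
  intros ((HI & _) & e1 & e2 & e3 & c & Hf & C1 & C2 & C3 & Cr & Hr & Hh & HY).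
  apply twice_derivable_of_C2 in C1, C2, C3, Cr.
  assert (L : forall e, twice_derivable_on I (fun s => lprod (c s) e)).
  { intros e; unfold lprod.
    assert (H := twice_derivable_lincomb I _ _ _ (x1 e) (x2 e) (- x3 e)
      (proj1 (proj2 HI)) C1 C2 C3).
    intros s Is; destruct (H s Is) as (H1 & H2).
    assert (E : forall u, x1 (c u) * x1 e + x2 (c u) * x2 e + x3 (c u) * - x3 e
      = x1 (c u) * x1 e + x2 (c u) * x2 e - x3 (c u) * x3 e) by (intros; ring).
    split.
    - revert H1; now apply ex_derive_ext.
    - revert H2; apply ex_derive_ext; intros u; now apply Derive_ext. }
  exists e1, e2, e3, (fun s => lprod (c s) e1), (fun s => lprod (c s) e2),
    (fun s => - lprod (c s) e3).
  split; [exact Hf|]; split; [apply L|]; split; [apply L|]; split.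
  { intros s Is; destruct (L e3 s Is) as (H1 & H2); split.
    - now apply (ex_derive_opp (fun s => lprod (c s) e3)).
    - apply (ex_derive_ext (fun u => - Derive (fun s => lprod (c s) e3) u)).
      + intros u; now rewrite Derive_opp.
      + now apply (ex_derive_opp (Derive (fun s => lprod (c s) e3))). }
  split; [exact Cr|]; split; [exact Hr|]; split.
  { intros s Is; rewrite Derive_opp; apply Ropp_neq_0_compat, (Hh s Is). }
  intros s v Dsv; rewrite (HY s v Dsv), (fcomb_lprod e1 e2 e3 (c s) Hf) at 1.
  unfold fcomb; apply vec_eq; coords; ring.
Qed.

Lemma rotational_of_constant_axis D Y e1 e2 e3 a b h r :
  lorentz_frame e1 e2 e3 ->
  (forall s v, D s v ->
     d2 Y s v = fcomb e1 e2 e3 (- r s * sin v) (r s * cos v) 0) ->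
  (forall s v, D s v ->
     Y s v = fcomb e1 e2 e3 (a + r s * cos v) (b + r s * sin v) (h s)) ->
  rotational Y D.
Proof.
  intros Hf Hd HY; exists (fcomb e1 e2 e3 a b 0), e3; split.
  - intros E; destruct Hf as (_ & _ & H & _); rewrite E in H.
    revert H; unfold lprod; coords; lra.
  - intros s v Dsv; exists (0, fdet e1 e2 e3).
    rewrite (fcomb_lprod e1 e2 e3 (lcross _ _) Hf).
    unfold tangent; simpl fst; simpl snd; rewrite Hd, HY by trivial.
    match goal with |- fcomb _ _ _ ?A ?B ?C = _ =>
      replace A with (fdet e1 e2 e3 * (- r s * sin v))
        by (unfold fdet, fcomb, lprod, lcross; coords; ring);
      replace B with (fdet e1 e2 e3 * (r s * cos v))
        by (unfold fdet, fcomb, lprod, lcross; coords; ring);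
      replace C with 0
        by (unfold fdet, fcomb, lprod, lcross; coords; ring)
    end.
    unfold fcomb; apply vec_eq; coords; ring.
Qed.

Section ZeroMeanCurvature.

Variables (I : R -> Prop) (D : R -> R -> Prop) (Y : R -> R -> vec).
Variables (e1 e2 e3 : vec) (a b h r : R -> R).
Hypothesis Hframe : lorentz_frame e1 e2 e3.
Hypothesis HDom : arc_domain I D.
Hypothesis Ha : twice_derivable_on I a.
Hypothesis Hb : twice_derivable_on I b.
Hypothesis Hh : twice_derivable_on I h.
Hypothesis Hr : twice_derivable_on I r.
Hypothesis Hr0 : forall s, I s -> 0 < r s.
Hypothesis Hh0 : forall s, I s -> Derive h s <> 0.
Hypothesis HY : forall s v, D s v ->
  Y s v = fcomb e1 e2 e3 (a s + r s * cos v) (b s + r s * sin v) (h s).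
Hypothesis Hzmc : zmc Y D.
Hypothesis Hrot : ~ rotational Y D.

Let a' := Derive a.
Let b' := Derive b.
Let h' := Derive h.
Let r' := Derive r.
Let a'' := Derive a'.
Let b'' := Derive b'.
Let h'' := Derive h'.
Let r'' := Derive r'.

Let HD : open (fun sv : R * R => D (fst sv) (snd sv)).
Proof. apply HDom. Qed.
Let HDI : forall s v, D s v -> I s.
Proof. apply HDom. Qed.
Let Icvx : convex I.
Proof. exact (proj2 (proj2 (proj1 HDom))). Qed.
Let Inonempty : exists s, I s.
Proof. exact (proj1 (proj1 HDom)). Qed.

Lemma zmc_coefficients s : I s ->
  (a' s = 0 /\ b' s = 0) \/
  (r s * (h' s * r'' s - h'' s * r' s)
     = h' s * (a' s ^ 2 + b' s ^ 2 + r' s ^ 2 - h' s ^ 2) /\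
   r s * (h' s * a'' s - h'' s * a' s) = 2 * h' s * r' s * a' s /\
   r s * (h' s * b'' s - h'' s * b' s) = 2 * h' s * r' s * b' s).
Proof.
  intros Is.
  destruct (proj2 (proj2 (proj2 HDom)) s Is) as (NE & OU & _).
  set (ns := normal_speed a b r s).
  assert (Cns : forall c v, continuous (fun v => ns v + c) v).
  { intros c v; apply (ex_derive_continuous (fun v => ns v + c)).
    unfold ns, normal_speed; auto_derive; trivial. }
  assert (Cd : forall v, continuous (zmc_defect a b h r s) v).
  { intros v; apply (ex_derive_continuous (zmc_defect a b h r s)).
    unfold zmc_defect; auto_derive; trivial. }
  destruct (mul_zero_open (D s) (zmc_defect a b h r s)
    (fun v => (ns v + - h' s) * (ns v + h' s))) as [Q|(V & OV & NV & HV)]; trivial.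
  - intros v Dsv.
    destruct (Req_dec ((ns v + - h' s) * (ns v + h' s)) 0) as [-> |N]; [ring|].
    destruct (mean_curvature_foliation I D Y e1 e2 e3 a b h r Hframe HD HDI
      Ha Hb Hh Hr Hr0 HY s v Dsv) as (k & Ek & K0).
    specialize (K0 N); rewrite Hzmc in Ek; trivial.
    + destruct (Rmult_integral k _ (eq_sym Ek)) as [| ->]; [easy|ring].
    + apply nondegenerate_of_gram.
      rewrite (gram_foliation I D Y e1 e2 e3 a b h r Hframe HD HDI
        Ha Hb Hh Hr HY s v Dsv), Rmult_assoc.
      apply Rmult_integral_contrapositive_currified; [|exact N].
      apply pow_nonzero; specialize (Hr0 s Is); lra.
  - right.
    destruct (trig_poly1_zero (D s) OU _ _ _ NE Q) as (Q0 & Q1 & Q2).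
    unfold a'', b'', h'', r'', a', b', h', r'; repeat split; lra.
  - left.
    assert (L : forall (W : R -> Prop) c, open W -> (exists v, W v) ->
      (forall v, W v -> ns v + c = 0) -> a' s = 0 /\ b' s = 0).
    { intros W c OW NW HW.
      destruct (trig_poly1_zero W OW (r' s + c) (a' s) (b' s) NW) as (_ & ? & ?);
        [|now split].
      intros v Wv; rewrite <- (HW v Wv); unfold ns, normal_speed, a', b', r'; ring. }
    destruct (mul_zero_open V (fun v => ns v + - h' s) (fun v => ns v + h' s))
      as [Q|(V' & OV' & NV' & HV')]; trivial.
    + intros v Vv; exact (proj2 (HV v Vv)).
    + now apply (L V (- h' s)).
    + apply (L V' (h' s)); trivial; intros v Vv; now apply HV'.
Qed.

(* Where the second alternative of [zmc_coefficients] holds, the density of the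
   center in height divided by [r ^ 2] has zero derivative; elsewhere it
   vanishes. *)
Lemma center_direction :
  exists al be, 0 < al ^ 2 + be ^ 2 /\
    forall s, I s -> a' s = al * h' s * r s ^ 2 /\ b' s = be * h' s * r s ^ 2.
Proof.
  assert (L : forall f, twice_derivable_on I f ->
    (forall s, I s -> Derive f s = 0 \/
       r s * (h' s * Derive (Derive f) s - h'' s * Derive f s)
       = 2 * h' s * r' s * Derive f s) ->
    exists c, forall s, I s -> Derive f s = c * h' s * r s ^ 2).
  { intros f Hf E.
    destruct (constant_of_zero_or_derive_zero I
      (fun s => Derive f s / (h' s * r s ^ 2))
      (fun s => (r s * (h' s * Derive (Derive f) s - h'' s * Derive f s)
        - 2 * h' s * r' s * Derive f s) / (h' s ^ 2 * r s ^ 3))) as (c & Hc);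
      trivial.
    - intros s Is; specialize (Hr0 s Is); specialize (Hh0 s Is); fold h' in Hh0.
      pose proof (Derive_correct _ _ (proj2 (Hf s Is))) as D1.
      pose proof (Derive_correct _ _ (proj2 (Hh s Is))) as D2.
      pose proof (Derive_correct _ _ (proj1 (Hr s Is))) as D3.
      auto_derive.
      + repeat split; try (eexists; eassumption).
        assert (r s <> 0) by lra.
        repeat apply Rmult_integral_contrapositive_currified; trivial; lra.
      + derive_values; unfold h'', h', r' in *; field; split; trivial; lra.
    - intros s Is; destruct (E s Is) as [-> |E'].
      + left; unfold Rdiv; ring.
      + right; rewrite E'; unfold Rdiv; ring.
    - exists c; intros s Is; rewrite <- (Hc s Is).
      specialize (Hr0 s Is); specialize (Hh0 s Is); fold h' in Hh0.
      field; split; trivial; lra. }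
  destruct (L a Ha) as (al & Hal).
  { intros s Is; destruct (zmc_coefficients s Is) as [|]; tauto. }
  destruct (L b Hb) as (be & Hbe).
  { intros s Is; destruct (zmc_coefficients s Is) as [|]; tauto. }
  exists al, be; split; [|intros s Is; split; auto].
  destruct (Rlt_dec 0 (al ^ 2 + be ^ 2)) as [|N]; trivial.
  exfalso; apply Hrot.
  pose proof (pow2_ge_0 al); pose proof (pow2_ge_0 be).
  assert (al = 0) by nra; assert (be = 0) by nra; subst al be.
  destruct Inonempty as (s0 & I0).
  apply (rotational_of_constant_axis D Y e1 e2 e3 (a s0) (b s0) h r Hframe).
  - intros; now apply (d2_foliation D Y e1 e2 e3 a b h r HD HY).
  - intros s v Dsv; pose proof (HDI s v Dsv) as Is.
    rewrite (HY s v Dsv).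
    rewrite (derive_zero_constant I a s s0), (derive_zero_constant I b s s0); trivial.
    + intros t It; replace 0 with (b' t) by (rewrite Hbe; trivial; ring).
      apply Derive_correct, (Hb t It).
    + intros t It; replace 0 with (a' t) by (rewrite Hal; trivial; ring).
      apply Derive_correct, (Ha t It).
Qed.

Lemma radius_first_integral :
  exists al be K L, 0 < K /\ K = al ^ 2 + be ^ 2 /\ forall s, I s ->
    a' s = al * h' s * r s ^ 2 /\ b' s = be * h' s * r s ^ 2 /\
    r s * (h' s * r'' s - h'' s * r' s)
      = h' s * (K * h' s ^ 2 * r s ^ 4 + r' s ^ 2 - h' s ^ 2) /\
    r' s ^ 2 = h' s ^ 2 * (K * r s ^ 4 + L * r s ^ 2 + 1).
Proof.
  destruct center_direction as (al & be & Kpos & Hc).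
  set (K := al ^ 2 + be ^ 2) in *.
  assert (O : forall s, I s -> r s * (h' s * r'' s - h'' s * r' s)
      = h' s * (K * h' s ^ 2 * r s ^ 4 + r' s ^ 2 - h' s ^ 2)).
  { intros s Is; destruct (Hc s Is) as (Ea & Eb).
    destruct (zmc_coefficients s Is) as [(Za & Zb)|(E & _)].
    - exfalso; specialize (Hr0 s Is); specialize (Hh0 s Is); fold h' in Hh0.
      rewrite Za in Ea; rewrite Zb in Eb.
      assert (h' s * r s ^ 2 <> 0).
      { apply Rmult_integral_contrapositive_currified; trivial.
        apply pow_nonzero; lra. }
      assert (al = 0) by (apply (Rmult_eq_reg_r (h' s * r s ^ 2)); trivial; lra).
      assert (be = 0) by (apply (Rmult_eq_reg_r (h' s * r s ^ 2)); trivial; lra).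
      subst al be; unfold K in Kpos; lra.
    - rewrite E, Ea, Eb; unfold K; ring. }
  destruct Inonempty as (s0 & I0).
  set (g := fun s => ((r' s / h' s) ^ 2 - K * r s ^ 4 - 1) / r s ^ 2).
  assert (G : forall s, I s -> g s = g s0).
  { intros s Is; apply (derive_zero_constant I g); trivial; clear s Is.
    intros s Is; specialize (O s Is); specialize (Hr0 s Is).
    specialize (Hh0 s Is); fold h' in Hh0.
    pose proof (Derive_correct _ _ (proj2 (Hr s Is))) as D1.
    pose proof (Derive_correct _ _ (proj2 (Hh s Is))) as D2.
    pose proof (Derive_correct _ _ (proj1 (Hr s Is))) as D3.
    unfold g; auto_derive.
    - repeat split; try (eexists; eassumption); trivial.
      assert (r s <> 0) by lra.
      repeat apply Rmult_integral_contrapositive_currified; trivial; lra.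
    - derive_values; fold r' h'; fold r'' h''.
      transitivity (2 * r' s * (r s * (h' s * r'' s - h'' s * r' s)
        - h' s * (K * h' s ^ 2 * r s ^ 4 + r' s ^ 2 - h' s ^ 2))
        / (h' s ^ 3 * r s ^ 3)).
      + field; split; trivial; lra.
      + rewrite O; unfold Rdiv; ring. }
  exists al, be, K, (g s0); split; [exact Kpos|]; split; [reflexivity|].
  intros s Is; destruct (Hc s Is) as (Ea & Eb).
  repeat split; auto.
  rewrite <- (G s Is); unfold g.
  specialize (Hr0 s Is); specialize (Hh0 s Is); fold h' in Hh0.
  field; split; trivial; lra.
Qed.
End ZeroMeanCurvature.

(* The equilibrium [r = K ^ (-1/4)] of the first integral is reached in no
   finite height. *)
Lemma radius_equilibrium (I : R -> Prop) (r h : R -> R) K L s :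
  convex I -> twice_derivable_on I r -> twice_derivable_on I h ->
  (forall t, I t -> 0 < r t) -> (forall t, I t -> Derive h t <> 0) ->
  (forall t, I t ->
     r t * (Derive h t * Derive (Derive r) t - Derive (Derive h) t * Derive r t)
     = Derive h t * (K * Derive h t ^ 2 * r t ^ 4 + Derive r t ^ 2 - Derive h t ^ 2)) ->
  (forall t, I t ->
     Derive r t ^ 2 = Derive h t ^ 2 * (K * r t ^ 4 + L * r t ^ 2 + 1)) ->
  I s -> Derive r s = 0 -> Derive (Derive r) s = 0 ->
  forall t, I t -> r t = r s.
Proof.
  intros HI Hr Hh Hr0 Hh0 O F Is R1 R2 t It.
  set (q := r s).
  assert (q0 : 0 < q) by now apply Hr0.
  assert (HK : K * q ^ 4 = 1).
  { pose proof (O s Is) as Os; rewrite R1, R2 in Os; fold q in Os.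
    pose proof (Hh0 s Is).
    apply (Rmult_eq_reg_l (Derive h s ^ 3)); [nra|now apply pow_nonzero]. }
  assert (HL : L * q ^ 2 = -2).
  { pose proof (F s Is) as Fs; rewrite R1 in Fs; fold q in Fs.
    pose proof (Hh0 s Is).
    apply (Rmult_eq_reg_l (Derive h s ^ 2)); [nra|now apply pow_nonzero]. }
  assert (Y0 : r t ^ 2 - q ^ 2 = 0).
  { apply (gronwall_zero I (fun t => r t ^ 2 - q ^ 2)
      (fun t => 2 * r t * Derive r t) (fun t => 2 * r t * Derive h t / q ^ 2) s t);
      trivial; clear t It.
    - intros t It; pose proof (Derive_correct _ _ (proj1 (Hr t It))) as D1.
      auto_derive; [now exists (Derive r t)|derive_values; ring].
    - intros t It.
      pose proof (Derive_correct _ _ (proj1 (Hr t It))) as D1.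
      pose proof (Derive_correct _ _ (proj2 (Hh t It))) as D2.
      apply (ex_derive_continuous (fun t => 2 * r t * Derive h t / q ^ 2)).
      auto_derive; repeat split; try (eexists; eassumption).
    - intros t It.
      replace ((2 * r t * Derive r t) ^ 2) with (4 * r t ^ 2 * Derive r t ^ 2) by ring.
      rewrite (F t It).
      replace K with (/ q ^ 4) by (apply (Rmult_eq_reg_r (q ^ 4));
        [rewrite HK; field; lra|apply pow_nonzero; lra]).
      replace L with (- 2 / q ^ 2) by (apply (Rmult_eq_reg_r (q ^ 2));
        [rewrite HL; field; lra|apply pow_nonzero; lra]).
      field; lra.
    - unfold q; ring. }
  specialize (Hr0 t It); nra.
Qed.

Lemma sqrt_unique_sqr x y : 0 <= y -> x = y ^ 2 -> sqrt x = y.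
Proof. intros Hy ->; now apply sqrt_pow2. Qed.

Lemma open_cubic_pos lam : open (fun u => 0 < cubic lam u).
Proof.
  apply (open_comp (cubic lam) (fun y => 0 < y)); [|apply open_gt].
  intros u _; apply (ex_derive_continuous (cubic lam)).
  unfold cubic; auto_derive; trivial.
Qed.

Lemma continuous_density lam (g : R -> R) u :
  continuous g u -> 0 < cubic lam u ->
  continuous (fun u => 1 / 2 * (g u / sqrt (cubic lam u))) u.
Proof.
  intros Hg Hu.
  apply (continuous_mult (fun _ => 1 / 2)); [apply continuous_const|].
  apply (continuous_mult g (fun u => / sqrt (cubic lam u))); trivial.
  apply (ex_derive_continuous (fun u => / sqrt (cubic lam u))).
  unfold cubic in *; auto_derive; repeat split; trivial.
  now apply Rgt_not_eq, sqrt_lt_R0.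
Qed.

Lemma rigid_motion_frame e1 e2 e3 (c s eps : R) (w : vec) :
  lorentz_frame e1 e2 e3 -> c ^ 2 + s ^ 2 = 1 -> eps ^ 2 = 1 ->
  rigid_motion (fun p =>
    (lprod p e1 * c + lprod p e2 * s + x1 w,
     - lprod p e1 * s + lprod p e2 * c + x2 w,
     - eps * lprod p e3 + x3 w)).
Proof.
  intros Hf E1 E2 p q.
  rewrite (fcomb_lprod e1 e2 e3 (minus p q) Hf), (lprod_fcomb _ _ _ _ _ _ _ _ _ Hf).
  assert (L : forall e, lprod (minus p q) e = lprod p e - lprod q e).
  { intros e; unfold lprod; coords; ring. }
  rewrite !L; unfold lprod at 1; coords.
  assert (E1' : s ^ 2 = 1 - c ^ 2) by lra.
  ring [E1' E2].
Qed.

Theorem riemann_classification (I : R -> Prop) (D : R -> R -> Prop)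
    (Y : R -> R -> vec) (r : R -> R) :
  riemann_zmc_example I D Y r -> nonconstant_on I r ->
  (forall s eps, I s -> 0 < eps ->
     exists s', I s' /\ Rabs (s' - s) < eps /\ Derive r s' <> 0) /\
  exists lam mu : R, 0 < mu /\
    forall J : R -> Prop,
      is_open_interval J -> (forall s, J s -> I s /\ Derive r s <> 0) ->
      exists (m z : R -> R) (Phi : vec -> vec) (theta : R),
        rigid_motion Phi /\
        (forall s, J s -> 0 < cubic lam (mu ^ 2 * r s ^ 2)) /\
        riemann_primitives lam
          (fun q => exists s, J s /\ q = mu ^ 2 * r s ^ 2) m z /\
        (forall s v, J s -> D s v ->
           Phi (scal mu (Y s v))
           = riemann_X m z (mu ^ 2 * r s ^ 2) (v + theta)).
Proof.
  intros (HC & Hzmc & Hrot) Hnc.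
  assert (HDom : arc_domain I D) by apply HC.
  destruct (circle_foliated_coords I D Y r HC) as
    (e1 & e2 & e3 & a & b & h & Hf & Ha & Hb & Hh & Hr & Hr0 & Hh0 & HY).
  destruct (radius_first_integral I D Y e1 e2 e3 a b h r Hf HDom Ha Hb Hh Hr
    Hr0 Hh0 HY Hzmc Hrot) as (al & be & K & L & K0 & EK & HF).
  assert (Icvx : convex I) by exact (proj2 (proj2 (proj1 HDom))).
  assert (Iop : open I) by exact (proj1 (proj2 (proj1 HDom))).
  split.
  { intros s eps Is Heps.
    apply Classical_Prop.NNPP; intros N.
    assert (Z : locally s (fun u => Derive r u = 0)).
    { generalize (filter_and _ _ (Iop s Is) (locally_ball s (mkposreal eps Heps))).
      apply filter_imp; intros u (Iu & Bu).
      destruct (Req_dec (Derive r u) 0) as [|Nu]; trivial.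
      exfalso; apply N; exists u; repeat split; trivial. }
    destruct Hnc as (t & t' & It & It' & Nt); apply Nt.
    assert (C : forall t, I t -> r t = r s).
    { apply (radius_equilibrium I r h K L s); trivial.
      - intros u Iu; apply (HF u Iu).
      - intros u Iu; apply (HF u Iu).
      - now apply locally_singleton in Z.
      - rewrite (Derive_ext_loc _ (fun _ => 0)); trivial; apply Derive_const. }
    now rewrite (C t It), (C t' It'). }
  set (mu := sqrt (sqrt K)).
  assert (mu0 : 0 < mu) by (apply sqrt_lt_R0, sqrt_lt_R0, K0).
  assert (Emu : mu ^ 4 = K).
  { replace (mu ^ 4) with ((mu ^ 2) ^ 2) by ring; unfold mu.
    rewrite !pow2_sqrt; trivial; try apply sqrt_pos; lra. }
  exists (L / mu ^ 2), mu; split; trivial.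
  intros J HJ HJI.
  set (lam := L / mu ^ 2).
  assert (EL : L = lam * mu ^ 2) by (unfold lam; field; lra).
  assert (Jcvx : convex J) by exact (proj2 (proj2 HJ)).
  destruct HJ as ((s0 & J0) & Jop & _).
  set (rd := Derive r); set (hd := Derive h).
  destruct (constant_sign J (fun s => rd s * hd s)) as (eps & Heps & Hsgn);
    trivial; [now exists s0| | |].
  { intros s Js; destruct (HJI s Js) as (Is & _).
    apply (ex_derive_continuous (fun s => rd s * hd s)).
    apply (ex_derive_mult rd hd); [apply (Hr s Is)|apply (Hh s Is)]. }
  { intros s Js; destruct (HJI s Js) as (Is & Ns).
    apply Rmult_integral_contrapositive_currified; trivial; now apply Hh0. }
  assert (Eeps : eps ^ 2 = 1) by (destruct Heps; subst eps; lra).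
  set (q := fun s => mu ^ 2 * r s ^ 2).
  assert (Hq : forall s, J s -> is_derive q s (2 * mu ^ 2 * r s * rd s)).
  { intros s Js; destruct (HJI s Js) as (Is & _).
    pose proof (Derive_correct _ _ (proj1 (Hr s Is))) as D1.
    unfold q; auto_derive; [now exists (rd s)|derive_values; unfold rd; ring]. }
  assert (Hs : forall s, J s -> 0 < eps * rd s / hd s).
  { intros s Js; specialize (Hsgn s Js); destruct (HJI s Js) as (Is & _).
    specialize (Hh0 s Is); fold hd in Hh0.
    replace (eps * rd s / hd s) with ((eps * (rd s * hd s)) * / (hd s ^ 2))
      by (field; trivial).
    apply Rmult_lt_0_compat; trivial; apply Rinv_0_lt_compat, pow2_gt_0; trivial. }
  assert (Ecub : forall s, J s ->
    cubic lam (q s) = (mu * r s * (eps * rd s / hd s)) ^ 2).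
  { intros s Js; destruct (HJI s Js) as (Is & _).
    specialize (Hh0 s Is); fold hd in Hh0.
    destruct (HF s Is) as (_ & _ & _ & F); fold rd hd in F.
    replace ((mu * r s * (eps * rd s / hd s)) ^ 2)
      with (mu ^ 2 * r s ^ 2 * eps ^ 2 * rd s ^ 2 / hd s ^ 2) by (field; trivial).
    rewrite F, Eeps, EL, <- Emu; unfold cubic, q; field; trivial. }
  assert (Pcub : forall s, J s -> 0 < cubic lam (q s)).
  { intros s Js; rewrite Ecub by trivial; apply pow_lt.
    specialize (Hr0 s (proj1 (HJI s Js))).
    apply Rmult_lt_0_compat; [now apply Rmult_lt_0_compat|now apply Hs]. }
  assert (Scub : forall s, J s -> sqrt (cubic lam (q s)) = mu * r s * (eps * rd s / hd s)).
  { intros s Js; apply sqrt_unique_sqr; [|now apply Ecub].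
    specialize (Hr0 s (proj1 (HJI s Js))).
    apply Rlt_le, Rmult_lt_0_compat; [now apply Rmult_lt_0_compat|now apply Hs]. }
  assert (Cq : forall s, J s -> continuous q s).
  { intros s Js; apply (ex_derive_continuous q); eexists; now apply Hq. }
  assert (Bq : forall s t, J s -> Rmin (q s0) (q s) <= t <= Rmax (q s0) (q s) ->
    0 < cubic lam t).
  { intros s t Js Ht.
    destruct (Rle_dec (q s0) (q s)) as [Lq|Lq].
    - rewrite Rmin_left, Rmax_right in Ht by lra.
      destruct (ivt_convex J q s0 s t) as (x & Jx & <-); trivial; now apply Pcub.
    - rewrite Rmin_right, Rmax_left in Ht by lra.
      destruct (ivt_convex J q s s0 t) as (x & Jx & <-); trivial; now apply Pcub. }
  set (m := RInt (fun u => 1 / 2 * (u / sqrt (cubic lam u))) (q s0)).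
  set (z := RInt (fun u => 1 / 2 * (1 / sqrt (cubic lam u))) (q s0)).
  assert (Hm : forall s, J s -> is_derive m (q s) (1 / 2 * (q s / sqrt (cubic lam (q s))))).
  { intros s Js.
    apply (is_derive_RInt_between (fun u => 0 < cubic lam u)
      (fun u => 1 / 2 * (u / sqrt (cubic lam u)))); [apply open_cubic_pos| |].
    - intros u Hu; apply (continuous_density lam (fun u => u)); trivial.
      apply continuous_id.
    - intros t Ht; now apply (Bq s). }
  assert (Hz : forall s, J s -> is_derive z (q s) (1 / 2 * (1 / sqrt (cubic lam (q s))))).
  { intros s Js.
    apply (is_derive_RInt_between (fun u => 0 < cubic lam u)
      (fun u => 1 / 2 * (1 / sqrt (cubic lam u)))); [apply open_cubic_pos| |].
    - intros u Hu; apply (continuous_density lam (fun _ => 1)); trivial.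
      apply continuous_const.
    - intros t Ht; now apply (Bq s). }
  destruct (polar (eps * al) (eps * be) (mu ^ 2)) as (tau & _ & Eal & Ebe).
  { now apply pow_lt. }
  { replace ((mu ^ 2) ^ 2) with (mu ^ 4) by ring; rewrite Emu, EK; ring [Eeps]. }
  assert (Eal' : al = eps * mu ^ 2 * cos tau).
  { transitivity (eps * (eps * al)); [ring [Eeps]|rewrite Eal; ring]. }
  assert (Ebe' : be = eps * mu ^ 2 * sin tau).
  { transitivity (eps * (eps * be)); [ring [Eeps]|rewrite Ebe; ring]. }
  pose proof (sin2_eq tau) as T.
  assert (C1 : exists c, forall s, J s ->
    m (q s) - mu * (a s * cos tau + b s * sin tau) = c).
  { exists (m (q s0) - mu * (a s0 * cos tau + b s0 * sin tau)); intros s Js.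
    apply (derive_zero_constant J
      (fun s => m (q s) - mu * (a s * cos tau + b s * sin tau))); trivial.
    clear s Js; intros s Js; destruct (HJI s Js) as (Is & _).
    pose proof (Derive_correct _ _ (proj1 (Ha s Is))) as D1.
    pose proof (Derive_correct _ _ (proj1 (Hb s Is))) as D2.
    pose proof (Hq s Js) as D3; pose proof (Hm s Js) as D4.
    destruct (HF s Is) as (Ea & Eb & _ & _).
    auto_derive; [repeat split; eexists; eassumption|].
    derive_values; rewrite Ea, Eb, Scub, Eal', Ebe' by trivial.
    specialize (Hs s Js); specialize (Hh0 s Is); specialize (Hr0 s Is).
    fold hd in Hh0 |- *; unfold q.
    assert (rd s <> 0) by apply (HJI s Js).
    assert (eps <> 0) by (destruct Heps; lra).
    transitivity (mu ^ 3 * r s ^ 2 * hd s * (1 - eps ^ 2 * (cos tau ^ 2 + sin tau ^ 2)) / eps);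
      [field; repeat split; trivial; lra|rewrite Eeps, T; field; trivial]. }
  assert (C2 : exists c, forall s, J s ->
    mu * (- a s * sin tau + b s * cos tau) = c).
  { exists (mu * (- a s0 * sin tau + b s0 * cos tau)); intros s Js.
    apply (derive_zero_constant J
      (fun s => mu * (- a s * sin tau + b s * cos tau))); trivial.
    clear s Js; intros s Js; destruct (HJI s Js) as (Is & _).
    pose proof (Derive_correct _ _ (proj1 (Ha s Is))) as D1.
    pose proof (Derive_correct _ _ (proj1 (Hb s Is))) as D2.
    destruct (HF s Is) as (Ea & Eb & _ & _).
    auto_derive; [repeat split; eexists; eassumption|].
    derive_values; rewrite Ea, Eb, Eal', Ebe'; ring. }
  assert (C3 : exists c, forall s, J s -> z (q s) - mu * eps * h s = c).
  { exists (z (q s0) - mu * eps * h s0); intros s Js.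
    apply (derive_zero_constant J (fun s => z (q s) - mu * eps * h s)); trivial.
    clear s Js; intros s Js; destruct (HJI s Js) as (Is & _).
    pose proof (Derive_correct _ _ (proj1 (Hh s Is))) as D1.
    pose proof (Hq s Js) as D3; pose proof (Hz s Js) as D4.
    auto_derive; [repeat split; eexists; eassumption|].
    derive_values; rewrite Scub by trivial.
    specialize (Hs s Js); specialize (Hh0 s Is); specialize (Hr0 s Is).
    fold hd in Hh0 |- *.
    assert (rd s <> 0) by apply (HJI s Js).
    assert (eps <> 0) by (destruct Heps; lra).
    transitivity (mu * hd s * (1 - eps ^ 2) / eps);
      [field; repeat split; trivial; lra|rewrite Eeps; field; trivial]. }
  destruct C1 as (c1 & C1); destruct C2 as (c2 & C2); destruct C3 as (c3 & C3).
  exists m, z, (fun p =>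
    (lprod p e1 * cos tau + lprod p e2 * sin tau + x1 (c1, - c2, c3),
     - lprod p e1 * sin tau + lprod p e2 * cos tau + x2 (c1, - c2, c3),
     - eps * lprod p e3 + x3 (c1, - c2, c3))), (- tau).
  split; [|split; [|split]].
  - apply rigid_motion_frame; trivial; lra.
  - exact Pcub.
  - intros u (s & Js & ->); split; [now apply Hm|].
    replace (/ sqrt (cubic lam (mu ^ 2 * r s ^ 2)))
      with (1 / sqrt (cubic lam (mu ^ 2 * r s ^ 2))) by (unfold Rdiv; ring).
    now apply Hz.
  - intros s v Js Dsv; rewrite (HY s v Dsv).
    assert (E : forall a b c, scal mu (fcomb e1 e2 e3 a b c)
      = fcomb e1 e2 e3 (mu * a) (mu * b) (mu * c)).
    { intros; unfold fcomb; apply vec_eq; coords; ring. }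
    rewrite E.
    destruct (lprod_fcomb_frame e1 e2 e3 (mu * (a s + r s * cos v))
      (mu * (b s + r s * sin v)) (mu * h s) Hf) as (P1 & P2 & P3).
    rewrite P1, P2, P3; unfold riemann_X.
    specialize (C1 s Js); specialize (C2 s Js); specialize (C3 s Js).
    fold (q s).
    assert (Sq : sqrt (q s) = mu * r s).
    { apply sqrt_unique_sqr; [|unfold q; ring].
      specialize (Hr0 s (proj1 (HJI s Js))); nra. }
    rewrite Sq, cos_plus, sin_plus, cos_neg, sin_neg.
    apply vec_eq; coords; [rewrite <- C1|rewrite <- C2|rewrite <- C3]; ring.
Qed.

(** * The converse *)

Lemma C2_on_intro (J : R -> Prop) (f g dg : R -> R) :
  open J -> (forall s, J s -> is_derive f s (g s)) ->
  (forall s, J s -> is_derive g s (dg s)) ->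
  (forall s, J s -> continuous dg s) ->
  C2_on J f /\ (forall s, J s -> Derive f s = g s /\ Derive (Derive f) s = dg s).
Proof.
  intros HJ Hf Hg Hc.
  assert (E1 : forall s, J s -> Derive f s = g s).
  { intros s Js; now apply is_derive_unique, Hf. }
  assert (E2 : forall s, J s -> is_derive (Derive f) s (dg s)).
  { intros s Js; apply (is_derive_ext_loc g); [|now apply Hg].
    generalize (HJ s Js); apply filter_imp; intros u Ju; symmetry; now apply E1. }
  assert (E3 : forall s, J s -> Derive (Derive f) s = dg s).
  { intros s Js; now apply is_derive_unique, E2. }
  split; [|intros s Js; split; auto].
  intros s Js; split; [eexists; now apply Hf|]; split; [eexists; now apply E2|].
  apply (continuous_ext_loc _ dg s); [|now apply Hc].
  generalize (HJ s Js); apply filter_imp; intros u Ju; symmetry; now apply E3.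
Qed.

Lemma riemann_X_fcomb m z q v :
  riemann_X m z q v
  = fcomb std1 std2 std3 (m q + sqrt q * cos v) (0 + sqrt q * sin v) (z q).
Proof. rewrite fcomb_std; unfold riemann_X; apply vec_eq; coords; ring. Qed.

Section Converse.

Variables (lam : R) (J : R -> Prop) (D : R -> R -> Prop) (m z : R -> R).
Hypothesis HDom : arc_domain J D.
Hypothesis HJ : forall q, J q -> 0 < q /\ 0 < cubic lam q.
Hypothesis Hp : riemann_primitives lam J m z.

Let w q := sqrt (cubic lam q).
Let dc q := 3 * q ^ 2 + 2 * lam * q + 1.

Let Jop : open J.
Proof. exact (proj1 (proj2 (proj1 HDom))). Qed.

Let w_pos q : J q -> 0 < w q.
Proof. intros Jq; apply sqrt_lt_R0, (HJ q Jq). Qed.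

Let w_derive q : J q -> is_derive w q (dc q / (2 * w q)).
Proof.
  intros Jq; pose proof (w_pos q Jq) as W0; unfold w in *.
  assert (Dc : is_derive (cubic lam) q (dc q)).
  { unfold cubic, dc; auto_derive; trivial; ring. }
  auto_derive; [split; [eexists; exact Dc|split; [apply (HJ q Jq)|trivial]]|].
  derive_values; field; lra.
Qed.

Let z_C2 : C2_on J z /\ forall q, J q ->
  Derive z q = 1 / 2 * / w q /\ Derive (Derive z) q = - (dc q / (4 * w q ^ 3)).
Proof.
  apply C2_on_intro; trivial.
  - intros q Jq; apply (Hp q Jq).
  - intros q Jq; pose proof (w_pos q Jq); pose proof (w_derive q Jq) as Dw.
    auto_derive; [split; [eexists; exact Dw|split; [lra|trivial]]|].
    derive_values; field; lra.
  - intros q Jq; pose proof (w_pos q Jq); pose proof (w_derive q Jq) as Dw.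
    apply (ex_derive_continuous (fun q => - (dc q / (4 * w q ^ 3)))).
    unfold dc; auto_derive; split; [eexists; exact Dw|split; [|trivial]].
    apply Rgt_not_eq; repeat apply Rmult_lt_0_compat; lra.
Qed.

Let m_C2 : C2_on J m /\ forall q, J q ->
  Derive m q = 1 / 2 * (q / w q) /\
  Derive (Derive m) q = 1 / 2 * / w q - q * dc q / (4 * w q ^ 3).
Proof.
  apply (C2_on_intro J m (fun q => 1 / 2 * (q / w q))
    (fun q => 1 / 2 * / w q - q * dc q / (4 * w q ^ 3))); trivial.
  - intros q Jq; apply (Hp q Jq).
  - intros q Jq; pose proof (w_pos q Jq); pose proof (w_derive q Jq) as Dw.
    auto_derive; [split; [eexists; exact Dw|split; [lra|trivial]]|].
    derive_values; field; lra.
  - intros q Jq; pose proof (w_pos q Jq); pose proof (w_derive q Jq) as Dw.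
    apply (ex_derive_continuous (fun q => 1 / 2 * / w q - q * dc q / (4 * w q ^ 3))).
    unfold dc; auto_derive; repeat split; try (eexists; exact Dw);
    apply Rgt_not_eq; repeat apply Rmult_lt_0_compat; lra.
Qed.

Let r_C2 : C2_on J sqrt /\ forall q, J q ->
  Derive sqrt q = / (2 * sqrt q) /\ Derive (Derive sqrt) q = - / (4 * sqrt q ^ 3).
Proof.
  assert (Q : forall q, J q -> 0 < q /\ 0 < sqrt q).
  { intros q Jq; split; [|apply sqrt_lt_R0]; apply (HJ q Jq). }
  apply (C2_on_intro J sqrt (fun q => / (2 * sqrt q)) (fun q => - / (4 * sqrt q ^ 3)));
    trivial; intros q Jq; destruct (Q q Jq) as (Q1 & Q2).
  - auto_derive; trivial; field; lra.
  - auto_derive; [split; [|split]; trivial; lra|field; lra].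
  - apply (ex_derive_continuous (fun q => - / (4 * sqrt q ^ 3))).
    auto_derive; repeat split; trivial.
    apply Rgt_not_eq; repeat apply Rmult_lt_0_compat; lra.
Qed.

Let const_C2 : C2_on J (fun _ => 0) /\ forall q, J q ->
  Derive (fun _ => 0) q = 0 /\ Derive (Derive (fun _ => 0)) q = 0.
Proof.
  apply (C2_on_intro J (fun _ => 0) (fun _ => 0) (fun _ => 0)); trivial; intros;
    try apply @is_derive_const; apply continuous_const.
Qed.

Let HD : open (fun sv : R * R => D (fst sv) (snd sv)).
Proof. apply HDom. Qed.
Let HDJ : forall s v, D s v -> J s.
Proof. apply HDom. Qed.
Let Ta : twice_derivable_on J m.
Proof. apply twice_derivable_of_C2, m_C2. Qed.
Let Tb : twice_derivable_on J (fun _ => 0).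
Proof. apply twice_derivable_of_C2, const_C2. Qed.
Let Th : twice_derivable_on J z.
Proof. apply twice_derivable_of_C2, z_C2. Qed.
Let Tr : twice_derivable_on J sqrt.
Proof. apply twice_derivable_of_C2, r_C2. Qed.
Let Rpos : forall s, J s -> 0 < sqrt s.
Proof. intros s Js; apply sqrt_lt_R0, (HJ s Js). Qed.
Let XE : forall s v, D s v -> riemann_X m z s v =
  fcomb std1 std2 std3 (m s + sqrt s * cos v) (0 + sqrt s * sin v) (z s).
Proof. intros; apply riemann_X_fcomb. Qed.

Lemma riemann_X_foliated : circle_foliated J D (riemann_X m z) sqrt.
Proof.
  split; [exact HDom|].
  exists std1, std2, std3, (fun q => (m q, 0, z q)).
  split; [apply lorentz_frame_std|].
  split; [apply m_C2|]; split; [apply const_C2|]; split; [apply z_C2|].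
  split; [apply r_C2|]; split; [exact Rpos|]; split.
  - intros s Js; rewrite (Derive_ext _ (fun u => - z u)).
    + rewrite Derive_opp, (proj1 (proj2 z_C2 s Js)).
      specialize (w_pos s Js); pose proof (Rinv_0_lt_compat _ w_pos); lra.
    + intros t; unfold lprod, std3; coords; ring.
  - intros s v _; unfold riemann_X, std1, std2; apply vec_eq; coords; ring.
Qed.

Lemma riemann_X_zmc : zmc (riemann_X m z) D.
Proof.
  intros s v Dsv _.
  destruct (mean_curvature_foliation J D (riemann_X m z) std1 std2 std3 m
    (fun _ => 0) z sqrt lorentz_frame_std HD HDJ Ta Tb Th Tr Rpos XE s v Dsv)
    as (k & -> & _).
  pose proof (HDJ s v Dsv) as Js.
  unfold zmc_defect.
  destruct (proj2 m_C2 s Js) as (-> & ->); destruct (proj2 z_C2 s Js) as (-> & ->).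
  destruct (proj2 r_C2 s Js) as (-> & ->); destruct (proj2 const_C2 s Js) as (-> & ->).
  destruct (HJ s Js) as (S0 & C0); pose proof (w_pos s Js); pose proof (Rpos s Js).
  assert (Es : sqrt s ^ 2 = s) by (apply pow2_sqrt; lra).
  assert (Ew : w s ^ 2 = s * (s ^ 2 + lam * s + 1)).
  { unfold w; rewrite pow2_sqrt by lra; unfold cubic; ring. }
  assert (A : sqrt s * (1 / 2 * / w s * - / (4 * sqrt s ^ 3)
      - - (dc s / (4 * w s ^ 3)) * / (2 * sqrt s))
    - 1 / 2 * / w s * ((1 / 2 * (s / w s)) ^ 2 + 0 ^ 2 + (/ (2 * sqrt s)) ^ 2
      - (1 / 2 * / w s) ^ 2) = 0).
  { transitivity ((s * dc s - 2 * w s ^ 2 - s * (s ^ 2 - 1)) / (8 * s * w s ^ 3)).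
    - replace ((/ (2 * sqrt s)) ^ 2) with (/ (4 * s)) by (rewrite <- Es at 1; field; lra).
      replace (4 * sqrt s ^ 3) with (4 * s * sqrt s) by (rewrite <- Es at 1; ring).
      field; lra.
    - rewrite Ew; unfold dc; field; split; lra. }
  assert (B : sqrt s * (1 / 2 * / w s * (1 / 2 * / w s - s * dc s / (4 * w s ^ 3))
      - - (dc s / (4 * w s ^ 3)) * (1 / 2 * (s / w s)))
    - 2 * (1 / 2 * / w s) * / (2 * sqrt s) * (1 / 2 * (s / w s)) = 0).
  { transitivity ((sqrt s ^ 2 - s) / (4 * w s ^ 2 * sqrt s)).
    - field; lra.
    - rewrite Es; field; lra. }
  rewrite A, B; ring.
Qed.

Lemma riemann_X_not_rotational : ~ rotational (riemann_X m z) D.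
Proof.
  intros (p & n & Hn & H); apply Hn.
  assert (K : forall s, J s -> x1 n = 0 /\ x2 n = 0 /\ x3 n * (m s - x1 p) = 0).
  { intros s Js.
    destruct (proj2 (proj2 (proj2 HDom)) s Js) as (NE & OU & _).
    destruct (HJ s Js) as (S0 & C0); pose proof (w_pos s Js); pose proof (Rpos s Js).
    set (r := sqrt s) in *; set (r' := / (2 * r)); set (h' := 1 / 2 * / w s).
    set (m' := 1 / 2 * (s / w s)); set (A := m s - x1 p); set (Z := z s - x3 p).
    assert (h0 : 0 < h').
    { unfold h'; pose proof (Rinv_0_lt_compat (w s)); lra. }
    assert (m0 : 0 < m').
    { replace m' with (s * h') by (unfold m', h'; field; lra).
      now apply Rmult_lt_0_compat. }
    destruct (trig_poly_zero (D s) OU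
      (r' * (- x1 n * x2 p - x2 n * A) - m' * x2 n * r / 2)
      (h' * (x2 n * Z + x3 n * x2 p) - m' * (x1 n * x2 p + x2 n * A) - r' * x2 n * r)
      (h' * (x3 n * A - x1 n * Z) + r' * x1 n * r)
      (- (m' * x2 n * r / 2)) (m' * x1 n * r / 2) NE) as (_ & _ & E3 & E4 & E5).
    - intros v Dsv; destruct (H s v Dsv) as (a & Ea).
      assert (F : fdet (d1 (riemann_X m z) s v) (d2 (riemann_X m z) s v)
        (lcross n (minus (riemann_X m z s v) p)) = 0).
      { rewrite Ea; unfold tangent, fdet, lprod, lcross; coords; ring. }
      rewrite (d1_foliation J D _ std1 std2 std3 m (fun _ => 0) z sqrt HD HDJ
        Ta Tb Th Tr XE s v Dsv) in F.
      rewrite (d2_foliation D _ std1 std2 std3 m (fun _ => 0) z sqrt HD XE s v Dsv),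
        XE in F by trivial.
      rewrite (proj1 (proj2 m_C2 s Js)), (proj1 (proj2 z_C2 s Js)),
        (proj1 (proj2 r_C2 s Js)), (proj1 (proj2 const_C2 s Js)), !fcomb_std in F.
      fold r in F; fold r' h' m' in F.
      revert F; unfold fdet, lprod, lcross; coords; intros F.
      apply (Rmult_eq_reg_l (- r)); [|lra]; rewrite Rmult_0_r, <- F.
      unfold trig_poly, A, Z; rewrite sin_2a, cos_2a.
      pose proof (sin2_eq v) as T; field [T].
    - assert (N : m' * r <> 0).
      { apply Rgt_not_eq; now apply Rmult_lt_0_compat. }
      assert (x1 n = 0) by (apply (Rmult_eq_reg_r (m' * r)); lra).
      assert (x2 n = 0) by (apply (Rmult_eq_reg_r (m' * r)); lra).
      repeat split; trivial.
      rewrite H2 in E3; apply (Rmult_eq_reg_l h'); lra. }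
  destruct (proj1 (proj1 HDom)) as (s0 & J0).
  destruct (K s0 J0) as (K1 & K2 & _).
  destruct (Req_dec (x3 n) 0) as [K3|K3].
  - apply vec_eq; trivial.
  - exfalso.
    assert (Z : 1 / 2 * (s0 / w s0) = 0).
    { apply (derive_zero J (fun s => m s - x1 p) s0); trivial.
      - intros s Js; destruct (K s Js) as (_ & _ & E).
        apply (Rmult_eq_reg_l (x3 n)); lra.
      - pose proof (proj1 (Hp s0 J0)) as Dm.
        auto_derive; [eexists; exact Dm|derive_values; unfold w; ring]. }
    pose proof (w_pos s0 J0); destruct (HJ s0 J0) as (S0 & _).
    assert (0 < s0 / w s0) by now apply Rdiv_lt_0_compat.
    lra.
Qed.

Theorem riemann_X_example :
  riemann_zmc_example J D (riemann_X m z) sqrt /\ nonconstant_on J sqrt.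
Proof.
  split; [split; [|split]|].
  - apply riemann_X_foliated.
  - apply riemann_X_zmc.
  - apply riemann_X_not_rotational.
  - destruct (proj1 (proj1 HDom)) as (s & Js).
    destruct (Jop s Js) as (eps & Heps); pose proof (cond_pos eps).
    exists s, (s + eps / 2); split; [exact Js|split].
    + apply Heps; unfold ball; simpl; unfold AbsRing_ball, abs, minus, plus, opp; simpl.
      replace (s + eps / 2 + - s) with (eps / 2) by ring.
      rewrite Rabs_pos_eq; lra.
    + apply Rlt_not_eq, sqrt_lt_1_alt; destruct (HJ s Js); lra.
Qed.

End Converse.

(** * Leaves and limits *)

Ltac note_bounds l r a b :=
  let T := type of (l a b) in
  lazymatch goal with
  | _ : T |- _ => fail
  | _ => pose proof (l a b); pose proof (r a b)
  end.

Ltac minmax :=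
  repeat match goal with
  | |- context [Rmin ?a ?b] => note_bounds Rmin_l Rmin_r a b
  | _ : context [Rmin ?a ?b] |- _ => note_bounds Rmin_l Rmin_r a b
  | _ := context [Rmin ?a ?b] |- _ => note_bounds Rmin_l Rmin_r a b
  | |- context [Rmax ?a ?b] => note_bounds Rmax_l Rmax_r a b
  | _ : context [Rmax ?a ?b] |- _ => note_bounds Rmax_l Rmax_r a b
  | _ := context [Rmax ?a ?b] |- _ => note_bounds Rmax_l Rmax_r a b
  end.

Lemma min_pos a b : 0 < a -> 0 < b -> exists e, 0 < e /\ e <= a /\ e <= b.
Proof.
  intros Ha Hb; exists (Rmin a b); minmax; repeat split; trivial.
  now apply Rmin_glb_lt.
Qed.

Lemma enorm_coords_le p :
  Rabs (x1 p) <= enorm p /\ Rabs (x2 p) <= enorm p /\ Rabs (x3 p) <= enorm p.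
Proof.
  assert (E : forall x, Rabs x = sqrt (x ^ 2)).
  { intros x; rewrite <- (pow2_abs x), sqrt_pow2; trivial; apply Rabs_pos. }
  unfold enorm; rewrite !E.
  pose proof (pow2_ge_0 (x1 p)); pose proof (pow2_ge_0 (x2 p)).
  pose proof (pow2_ge_0 (x3 p)).
  repeat split; apply sqrt_le_1_alt; lra.
Qed.

Lemma enorm_le_coords p : enorm p <= Rabs (x1 p) + Rabs (x2 p) + Rabs (x3 p).
Proof.
  pose proof (Rabs_pos (x1 p)); pose proof (Rabs_pos (x2 p)).
  pose proof (Rabs_pos (x3 p)).
  unfold enorm; rewrite <- (sqrt_pow2 (Rabs (x1 p) + Rabs (x2 p) + Rabs (x3 p)))
    by lra.
  apply sqrt_le_1_alt; rewrite <- (pow2_abs (x1 p)), <- (pow2_abs (x2 p)),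
    <- (pow2_abs (x3 p)); nra.
Qed.

Lemma edist_coords_le p q :
  Rabs (x1 p - x1 q) <= edist p q /\ Rabs (x2 p - x2 q) <= edist p q /\
  Rabs (x3 p - x3 q) <= edist p q.
Proof. exact (enorm_coords_le (minus p q)). Qed.

Lemma edist_le_coords p q :
  edist p q <= Rabs (x1 p - x1 q) + Rabs (x2 p - x2 q) + Rabs (x3 p - x3 q).
Proof. exact (enorm_le_coords (minus p q)). Qed.

Definition ringpt (M Z : R -> R) (r v : R) : vec :=
  (M r + r * cos v, r * sin v, Z r).

Lemma x1_ringpt M Z r v : x1 (ringpt M Z r v) = M r + r * cos v.
Proof. reflexivity. Qed.
Lemma x2_ringpt M Z r v : x2 (ringpt M Z r v) = r * sin v.
Proof. reflexivity. Qed.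
Lemma x3_ringpt M Z r v : x3 (ringpt M Z r v) = Z r.
Proof. reflexivity. Qed.

Ltac rcoords :=
  repeat (progress (coords; rewrite ?x1_ringpt, ?x2_ringpt, ?x3_ringpt)).

Lemma angle_reduce v : exists v', - PI < v' <= PI /\ cos v' = cos v /\ sin v' = sin v.
Proof.
  destruct (polar (cos v) (sin v) 1) as (t & Ht & E1 & E2); [lra| |].
  - pose proof (sin2_eq v); lra.
  - exists t; repeat split; lra.
Qed.

Lemma cos_sin_near_0 t : 0 <= t <= 1 -> Rabs (cos t - 1) <= t /\ Rabs (sin t) <= t.
Proof.
  intros Ht; pose proof PI2_1.
  destruct (Req_dec t 0) as [->|N].
  - rewrite cos_0, sin_0; split; rewrite Rabs_pos_eq; lra.
  - pose proof (sin_lt_x t ltac:(lra)) as S1.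
    assert (S0 : 0 <= sin t) by (apply sin_ge_0; lra).
    assert (C0 : 0 <= cos t) by (apply cos_ge_0; lra).
    pose proof (COS_bound t); pose proof (sin2_eq t).
    split; [rewrite Rabs_left1 by lra; nra|rewrite Rabs_pos_eq by lra; lra].
Qed.

Definition dense_angles (Dv : R -> Prop) : Prop :=
  forall v eps, 0 < eps ->
    exists v', Dv v' /\ Rabs (cos v' - cos v) < eps /\ Rabs (sin v' - sin v) < eps.

Lemma dense_angles_full : dense_angles (fun _ => True).
Proof.
  intros v eps H; exists v; split; [trivial|].
  rewrite !Rminus_diag, Rabs_R0; lra.
Qed.

Lemma dense_angles_punctured : dense_angles (fun v => 0 < v < 2 * PI).
Proof.
  intros v eps Heps; pose proof PI_RGT_0.
  destruct (angle_reduce v) as (t & Ht & <- & <-).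
  destruct (Rtotal_order t 0) as [L|[E|L]].
  - exists (t + 2 * PI); split; [lra|].
    rewrite cos_plus, sin_plus, cos_2PI, sin_2PI, !Rmult_1_r, !Rmult_0_r,
      Rminus_0_r, Rplus_0_r, !Rminus_diag, Rabs_R0; lra.
  - set (u := Rmin 1 (eps / 2)).
    assert (0 < u) by (apply Rmin_glb_lt; lra).
    assert (u <= 1) by apply Rmin_l; assert (u <= eps / 2) by apply Rmin_r.
    pose proof PI2_1.
    destruct (cos_sin_near_0 u) as (A & B); [lra|].
    exists u; rewrite E, cos_0, sin_0, Rminus_0_r; split; [|split]; lra.
  - exists t; split; [lra|]; rewrite !Rminus_diag, Rabs_R0; lra.
Qed.

Lemma leaves_cvg_in_intro (W S T : vec -> Prop) (h : R) (P : R -> Prop)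
    (Z : R -> R) (leaf : R -> vec -> Prop) delta0 :
  0 < delta0 ->
  (forall p, S p -> 0 < Rabs (x3 p - h) < delta0 -> exists r, P r /\ x3 p = Z r) ->
  (forall r p, P r -> (S p /\ x3 p = Z r <-> leaf r p)) ->
  (forall delta, 0 < delta ->
     exists r p, P r /\ leaf r p /\ 0 < Rabs (Z r - h) < delta) ->
  (forall eps, 0 < eps -> exists delta, 0 < delta /\
     forall r, P r -> 0 < Rabs (Z r - h) < delta ->
       (forall p, leaf r p -> W p -> exists p', T p' /\ edist p p' < eps) /\
       (forall p', T p' -> W p' -> exists p, leaf r p /\ edist p p' < eps)) ->
  leaves_cvg_in W S T h.
Proof.
  intros H0 HA HB HD HC; split.
  - intros delta Hd; destruct (HD delta Hd) as (r & p & Pr & Lp & B).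
    apply HB in Lp; trivial; exists p; split; [apply Lp|].
    destruct Lp as (_ & ->); exact B.
  - intros eps Heps; destruct (HC eps Heps) as (delta & Hd & H).
    exists (Rmin delta delta0); split; [now apply Rmin_glb_lt|].
    intros t Ht (p0 & S0 & Et).
    minmax.
    destruct (HA p0 S0) as (r & Pr & Er); [rewrite Et; lra|].
    destruct (H r Pr) as (H1' & H2'); [rewrite <- Er, Et; lra|].
    split.
    + intros p Sp Ep Wp; apply H1'; trivial.
      apply HB; trivial; split; trivial; lra.
    + intros p' Tp' Wp'; destruct (H2' p' Tp' Wp') as (p & Lp & Dp).
      apply HB in Lp; trivial; exists p; split; [apply Lp|split; trivial].
      destruct Lp as (_ & ->); lra.
Qed.

Definition ring_leaf (M Z : R -> R) (D : R -> R -> Prop) (r : R) (p : vec) : Prop :=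
  exists v, D r v /\ p = ringpt M Z r v.

Lemma leaves_cvg_point (M Z : R -> R) (P : R -> Prop) (D : R -> R -> Prop)
    (S : vec -> Prop) delta0 :
  (forall r, P r -> 0 < r) ->
  (forall r r', P r -> 0 < r' <= r -> P r') -> (exists r, P r) ->
  (forall r, P r -> 0 < Z r) ->
  (forall r r', P r -> P r' -> r < r' -> Z r < Z r') ->
  (forall r, P r -> exists v, D r v) ->
  0 < delta0 ->
  (forall p, S p -> 0 < Rabs (x3 p - 0) < delta0 -> exists r, P r /\ x3 p = Z r) ->
  (forall r p, P r -> (S p /\ x3 p = Z r <-> ring_leaf M Z D r p)) ->
  (forall eps, 0 < eps -> exists d, 0 < d /\ forall r, 0 < r < d ->
     Rabs (M r) <= eps * r /\ Rabs (Z r - r) <= eps * r) ->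
  leaves_cvg S (fun p' => p' = (0, 0, 0)) 0.
Proof.
  intros HP0 HPd (ra & Pa) HZ0 HZ HD Hd0 HA HB Hs'.
  assert (Hs : forall eps, 0 < eps -> exists d, 0 < d /\ forall r, P r -> r < d ->
    Rabs (M r) < eps /\ Rabs (Z r) < eps).
  { intros eps Heps; destruct (Hs' 1) as (d & d0 & H); [lra|].
    exists (Rmin d (eps / 3)); split; [apply Rmin_glb_lt; lra|].
    intros r Hr Lr; minmax; specialize (HP0 r Hr).
    destruct (H r) as (A & B); [lra|]; split; [lra|].
    apply Rabs_le_between in B; apply Rabs_def1; lra. }
  apply (leaves_cvg_in_intro _ S _ 0 P Z (ring_leaf M Z D) delta0); trivial.
  - intros delta Hd; destruct (Hs delta Hd) as (d & d0 & H).
    pose proof (HP0 ra Pa).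
    assert (Pr : P (Rmin ra (d / 2))).
    { apply (HPd ra); trivial; split; [apply Rmin_glb_lt; lra|apply Rmin_l]. }
    destruct (HD _ Pr) as (v & Dv).
    exists (Rmin ra (d / 2)), (ringpt M Z (Rmin ra (d / 2)) v).
    split; trivial; split; [now exists v|].
    rewrite Rminus_0_r; split; [apply Rabs_pos_lt, Rgt_not_eq, HZ0; trivial|].
    apply H; trivial; minmax; lra.
  - intros eps Heps; destruct (Hs (eps / 5)) as (d & d0 & H); [lra|].
    pose proof (HP0 ra Pa).
    set (d' := Rmin (d / 2) (eps / 5)).
    assert (Hd' : 0 < Rmin ra d').
    { apply Rmin_glb_lt; [lra|apply Rmin_glb_lt; lra]. }
    assert (Pr : P (Rmin ra d')).
    { apply (HPd ra); trivial; split; [trivial|apply Rmin_l]. }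
    exists (Z (Rmin ra d')); split; [now apply HZ0|].
    intros r Hr (_ & Br).
    assert (Rr : r < Rmin ra d').
    { destruct (Rlt_dec r (Rmin ra d')) as [|N]; trivial; exfalso.
      rewrite Rminus_0_r, Rabs_pos_eq in Br by (apply Rlt_le, HZ0; trivial).
      destruct (Req_dec r (Rmin ra d')) as [E|NE]; [rewrite E in Br; lra|].
      assert (Z (Rmin ra d') < Z r) by (apply HZ; trivial; lra); lra. }
    pose proof (Rmin_r ra d'); pose proof (Rmin_l (d / 2) (eps / 5)).
    pose proof (Rmin_r (d / 2) (eps / 5)); fold d' in H2, H3.
    destruct (H r Hr) as (B1 & B2); [lra|].
    assert (C : forall v, edist (ringpt M Z r v) (0, 0, 0) < eps).
    { intros v; apply Rle_lt_trans with (1 := edist_le_coords _ _); rcoords.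
      rewrite !Rminus_0_r.
      pose proof (Rabs_triang (M r) (r * cos v)).
      rewrite (Rabs_mult r (cos v)) in H4; rewrite (Rabs_mult r (sin v)).
      pose proof (HP0 r Hr); rewrite (Rabs_pos_eq r) in * by lra.
      assert (Rabs (cos v) <= 1) by (apply Rabs_le, COS_bound).
      assert (Rabs (sin v) <= 1) by (apply Rabs_le, SIN_bound).
      assert (r * Rabs (cos v) <= r) by nra.
      assert (r * Rabs (sin v) <= r) by nra.
      lra. }
    split.
    + intros p (v & Dv & ->) _; eexists; split; [reflexivity|apply C].
    + intros p' -> _; destruct (HD r Hr) as (v & Dv).
      exists (ringpt M Z r v); split; [now exists v|apply C].
Qed.

Lemma conelike_ring (M Z : R -> R) (Dv : R -> Prop) (S : vec -> Prop) z0 :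
  dense_angles Dv ->
  (forall p, S p ->
     (exists r v, 0 < r /\ Dv v /\ p = ringpt M Z r v) \/ x3 p = z0) ->
  (forall r v, 0 < r -> Dv v -> S (ringpt M Z r v)) ->
  (forall r, 0 < r -> 0 < Z r < z0) ->
  (forall r r', 0 < r < r' -> Z r < Z r') ->
  (forall eps, 0 < eps -> exists d, 0 < d /\ forall r, 0 < r < d ->
     Rabs (M r) <= eps * r /\ Rabs (Z r - r) <= eps * r) ->
  conelike_point S (0, 0, 0).
Proof.
  intros HDv HS HS' HZ0 HZ Hs; split.
  - change (x3 (0, 0, 0)) with 0.
    apply (leaves_cvg_point M Z (fun r => 0 < r) (fun _ => Dv) S (Z 1)).
    + trivial.
    + intros; lra.
    + exists 1; lra.
    + intros r Hr; now apply HZ0.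
    + intros; apply HZ; lra.
    + intros r _; destruct (HDv 0 1) as (v & Hv & _); [lra|now exists v].
    + apply HZ0; lra.
    + intros p Sp Bp; destruct (HS p Sp) as [(r & v & Hr & _ & ->)|E].
      * now exists r.
      * exfalso; rewrite E, Rminus_0_r in Bp.
        pose proof (Rle_abs z0); pose proof (HZ0 1 Rlt_0_1); lra.
    + intros r p Hr; split.
      * intros (Sp & Ep); destruct (HS p Sp) as [(r' & v & Hr' & Hv & ->)|E].
        -- exists v; split; trivial; rewrite x3_ringpt in Ep.
           destruct (Rtotal_order r r') as [L|[->|L]]; trivial; exfalso;
             [pose proof (HZ r r')|pose proof (HZ r' r)]; lra.
        -- exfalso; pose proof (HZ0 r Hr); lra.
      * intros (v & Hv & ->); split; [now apply HS'|apply x3_ringpt].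
    + exact Hs.
  - exists 1; split; [now left|]; intros cone eps Heps.
    destruct (min_pos (1 / 2) (eps / 8)) as (e & e0 & e1 & e2); [lra|lra|].
    destruct (Hs e e0) as (d & d0 & H).
    exists (Rmin (d / 2) (Z (d / 2))); split.
    { apply Rmin_glb_lt; [lra|apply HZ0; lra]. }
    intros t (t0 & Ht); pose proof (Rmin_l (d / 2) (Z (d / 2))).
    pose proof (Rmin_r (d / 2) (Z (d / 2))).
    split.
    + intros p' Sp' Dp'; destruct (edist_coords_le p' (0, 0, 0)) as (_ & _ & D3).
      destruct (HS p' Sp') as [(r & v & Hr & Hv & ->)|E].
      2:{ exfalso; revert D3; rcoords; rewrite E, Rminus_0_r; intros D3.
          pose proof (Rle_abs z0); pose proof (HZ0 (d / 2)); lra. }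
      assert (Lr : r < d / 2).
      { destruct (Rlt_dec r (d / 2)) as [|N]; trivial; exfalso.
        revert D3; rcoords; rewrite Rminus_0_r; intros D3.
        pose proof (Rle_abs (Z r)).
        destruct (Req_dec r (d / 2)) as [E|NE]; [rewrite E in *; lra|].
        assert (Z (d / 2) < Z r) by (apply HZ; lra); lra. }
      destruct (H r) as (A & B); [lra|].
      assert (Rt : r <= 2 * t).
      { revert D3; rcoords; rewrite Rminus_0_r; intros D3.
        pose proof (Rle_abs (Z r)); apply Rabs_le_between in B; nra. }
      exists (r * cos v, r * sin v, r); split.
      * unfold cone; coords.
        replace ((r * cos v) ^ 2 + (r * sin v) ^ 2) with (r ^ 2)
          by (pose proof (sin2_eq v) as T; ring [T]).
        rewrite sqrt_pow2; lra.
      * apply Rle_lt_trans with (1 := edist_le_coords _ _); rcoords.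
        replace (M r + r * cos v - (0 + r * cos v)) with (M r) by ring.
        replace (r * sin v - (0 + r * sin v)) with 0 by ring.
        rewrite Rabs_R0, Rplus_0_l; nra.
    + intros c Hc Nc; unfold cone in Hc.
      destruct (enorm_coords_le c) as (_ & _ & C3).
      set (rho := x3 c) in *.
      assert (Erho : rho ^ 2 = x1 c ^ 2 + x2 c ^ 2).
      { rewrite Hc, Rmult_1_l, pow2_sqrt; trivial.
        pose proof (pow2_ge_0 (x1 c)); pose proof (pow2_ge_0 (x2 c)); lra. }
      assert (rho0 : 0 <= rho).
      { rewrite Hc, Rmult_1_l; apply sqrt_pos. }
      rewrite (Rabs_pos_eq rho rho0) in C3.
      destruct (Req_dec rho 0) as [E|NE].
      * assert (x1 c = 0) by nra; assert (x2 c = 0) by nra.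
        set (r := Rmin (d / 2) (e * t)).
        assert (r0 : 0 < r) by (apply Rmin_glb_lt; [lra|now apply Rmult_lt_0_compat]).
        assert (r1 : r <= d / 2) by apply Rmin_l.
        assert (r2 : r <= e * t) by apply Rmin_r.
        destruct (HDv 0 1) as (v & Hv & _); [lra|].
        destruct (H r) as (A & B); [lra|].
        exists (ringpt M Z r v); split; [now apply HS'|].
        apply Rle_lt_trans with (1 := edist_le_coords _ _); rcoords.
        fold rho; rewrite H2, H3, E, !Rplus_0_l, !Rminus_0_r.
        pose proof (Rabs_triang (M r) (r * cos v)) as T1.
        rewrite (Rabs_mult r (cos v)) in T1; rewrite (Rabs_mult r (sin v)).
        rewrite (Rabs_pos_eq r) in * by lra.
        assert (Rabs (cos v) <= 1) by (apply Rabs_le, COS_bound).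
        assert (Rabs (sin v) <= 1) by (apply Rabs_le, SIN_bound).
        assert (r * Rabs (cos v) <= r) by nra.
        assert (r * Rabs (sin v) <= r) by nra.
        assert (e * r <= r / 2) by nra.
        assert (Rabs (Z r) <= 2 * r).
        { apply Rabs_le_between in B; apply Rabs_le; lra. }
        assert (e * t <= eps / 8 * t) by nra.
        assert (0 < eps * t) by now apply Rmult_lt_0_compat.
        lra.
      * destruct (polar (x1 c) (x2 c) rho) as (v & _ & E1 & E2); trivial; [lra|].
        destruct (HDv v e e0) as (v' & Hv' & V1 & V2).
        destruct (H rho) as (A & B); [lra|].
        exists (ringpt M Z rho v'); split; [apply HS'; trivial; lra|].
        apply Rle_lt_trans with (1 := edist_le_coords _ _); rcoords.
        fold rho; rewrite E1, E2, !Rplus_0_l.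
        replace (M rho + rho * cos v' - rho * cos v)
          with (M rho + rho * (cos v' - cos v)) by ring.
        replace (rho * sin v' - rho * sin v) with (rho * (sin v' - sin v)) by ring.
        pose proof (Rabs_triang (M rho) (rho * (cos v' - cos v))) as T1.
        rewrite (Rabs_mult rho) in T1; rewrite (Rabs_mult rho).
        rewrite (Rabs_pos_eq rho) in * by lra.
        assert (rho * Rabs (cos v' - cos v) <= rho * e) by nra.
        assert (rho * Rabs (sin v' - sin v) <= rho * e) by nra.
        assert (e * rho <= eps / 8 * t) by nra.
        assert (0 < eps * t) by now apply Rmult_lt_0_compat.
        lra.
Qed.

Definition tends_at_infty (f : R -> R) (l : R) : Prop :=
  forall eps, 0 < eps -> exists Q, forall r, Q < r -> Rabs (f r - l) < eps.

Lemma one_minus_cos_bound r t y :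
  0 < r -> 0 <= t <= 1 -> y ^ 2 = r ^ 2 * (1 - t ^ 2) ->
  0 <= r * (1 - t) <= y ^ 2 / r.
Proof.
  intros Hr Ht E; split; [apply Rmult_le_pos; lra|].
  replace (y ^ 2 / r) with (r * (1 - t) * (1 + t)) by (rewrite E; field; lra).
  assert (0 <= r * (1 - t)) by (apply Rmult_le_pos; lra); nra.
Qed.

Lemma sq_div_lt y rho r eps :
  0 < eps -> 0 < r -> Rabs y <= rho -> rho ^ 2 / eps < r -> y ^ 2 / r < eps.
Proof.
  intros He Hr Hy H; apply Rlt_div_l in H; trivial.
  apply Rlt_div_l; trivial.
  rewrite <- (pow2_abs y); pose proof (Rabs_pos y); nra.
Qed.

Definition line_at (kappa h : R) (p : vec) : Prop := x1 p = kappa /\ x3 p = h.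

Lemma line_at_orthogonal kappa h : line_orthogonal_to_Pi (line_at kappa h).
Proof.
  exists (kappa, 0, h), (0, 1, 0); split; [|split].
  - intros E; injection E; lra.
  - intros w Hw; unfold lprod; rewrite Hw; coords; ring.
  - intros x; split.
    + intros (E1 & E3); exists (x2 x); apply vec_eq; coords; lra.
    + intros (t & ->); unfold line_at; coords; lra.
Qed.

Section Line.

Variables (M Z : R -> R) (sg kappa zinf : R).
Hypothesis Hsg : sg = 1 \/ sg = -1.
Hypothesis HM : tends_at_infty (fun r => M r + sg * r) kappa.
Hypothesis HZ : tends_at_infty Z zinf.

Lemma ring_near_line rho eps : 0 < rho -> 0 < eps ->
  exists Q, 0 < Q /\ forall r v, Q < r ->
    Rabs (M r + r * cos v) <= rho -> Rabs (r * sin v) <= rho ->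
    Rabs (M r + r * cos v - kappa) < eps /\ 1 / 2 <= sg * cos v.
Proof.
  intros Hrho Heps.
  destruct (min_pos 1 (eps / 2)) as (e & e0 & e1 & e2); [lra|lra|].
  destruct (HM e e0) as (Q1 & HQ1).
  set (C := Rabs kappa + 1 + rho).
  assert (C0 : 0 < C) by (unfold C; pose proof (Rabs_pos kappa); lra).
  assert (P2 : 0 < rho ^ 2 / (eps / 2)).
  { apply Rdiv_lt_0_compat; [now apply pow_lt|lra]. }
  exists (Rmax Q1 (2 * C) + rho ^ 2 / (eps / 2)); split.
  { minmax; lra. }
  intros r v Hr B1 B2.
  pose proof (Rmax_l Q1 (2 * C)); pose proof (Rmax_r Q1 (2 * C)).
  assert (HQ := HQ1 r ltac:(lra)).
  assert (SQ := sq_div_lt (r * sin v) rho r (eps / 2) ltac:(lra) ltac:(lra) B2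
    ltac:(lra)).
  pose proof (sin2_eq v) as T; pose proof (COS_bound v).
  pose proof (Rle_abs kappa); pose proof (Rle_abs (- kappa)).
  rewrite Rabs_Ropp in H3.
  apply Rabs_le_between in B1; apply Rabs_def2 in HQ.
  assert (Bt : r * (1 - sg * cos v) <= C).
  { unfold C; destruct Hsg as [E|E]; rewrite E in *; lra. }
  assert (1 / 2 <= sg * cos v <= 1).
  { split; [nra|destruct Hsg as [E|E]; rewrite E; lra]. }
  split; [|lra].
  destruct (one_minus_cos_bound r (sg * cos v) (r * sin v)) as (L1 & L2).
  - lra.
  - lra.
  - rewrite Rpow_mult_distr, T; destruct Hsg as [E|E]; rewrite E; ring.
  - apply Rabs_def1; destruct Hsg as [E|E]; rewrite E in *; lra.
Qed.

Lemma ring_reaches_line rho eps : 0 < rho -> 0 < eps ->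
  exists Q, 0 < Q /\ forall r y, Q < r -> Rabs y <= rho ->
    exists v, r * sin v = y /\ Rabs (M r + r * cos v - kappa) < eps /\
      0 <= sg * cos v.
Proof.
  intros Hrho Heps.
  destruct (HM (eps / 2)) as (Q1 & HQ1); [lra|].
  assert (P2 : 0 < rho ^ 2 / (eps / 2)).
  { apply Rdiv_lt_0_compat; [now apply pow_lt|lra]. }
  exists (Rmax Q1 rho + rho ^ 2 / (eps / 2)); split.
  { minmax; lra. }
  intros r y Hr By; minmax.
  assert (r0 : 0 < r) by lra.
  assert (HQ := HQ1 r ltac:(lra)).
  assert (SQ := sq_div_lt y rho r (eps / 2) ltac:(lra) r0 By ltac:(lra)).
  assert (Y2 : y ^ 2 <= r ^ 2).
  { rewrite <- (pow2_abs y); pose proof (Rabs_pos y); nra. }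
  assert (ES : sqrt (r ^ 2 - y ^ 2) ^ 2 = r ^ 2 - y ^ 2) by (apply pow2_sqrt; lra).
  pose proof (sqrt_pos (r ^ 2 - y ^ 2)) as S0.
  destruct (polar (sg * sqrt (r ^ 2 - y ^ 2)) y r) as (v & _ & E1 & E2); trivial.
  { rewrite Rpow_mult_distr, ES; destruct Hsg as [-> | ->]; ring. }
  pose proof (sin2_eq v) as T; pose proof (COS_bound v).
  assert (C0 : 0 <= sg * cos v).
  { assert (r * (sg * cos v) = sqrt (r ^ 2 - y ^ 2)).
    { transitivity (sg * (r * cos v)); [ring|].
      rewrite <- E1; destruct Hsg as [-> | ->]; ring. }
    nra. }
  exists v; split; [now symmetry|]; split; [|trivial].
  destruct (one_minus_cos_bound r (sg * cos v) y) as (L1 & L2); trivial.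
  - split; trivial; destruct Hsg as [-> | ->]; lra.
  - rewrite E2, Rpow_mult_distr, T; destruct Hsg as [-> | ->]; ring.
  - apply Rabs_def2 in HQ; apply Rabs_def1; destruct Hsg as [E|E];
      rewrite E in *; lra.
Qed.

Lemma ring_reaches_line_dense rho eps : 0 < rho -> 0 < eps ->
  exists Q, forall r p Dv, Q < r -> dense_angles Dv -> line_at kappa zinf p ->
    Rabs (x2 p) <= rho -> exists v, Dv v /\ edist (ringpt M Z r v) p < eps.
Proof.
  intros Hrho Heps.
  destruct (ring_reaches_line rho (eps / 4)) as (Q1 & Q10 & HQ1); trivial; [lra|].
  destruct (HZ (eps / 4)) as (Q2 & HQ2); [lra|].
  exists (Rmax Q1 Q2); intros r p Dv Hr HD (E1 & E3) B; minmax.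
  destruct (HQ1 r (x2 p)) as (v & Ev & Bv & _); trivial; [lra|].
  specialize (HQ2 r ltac:(lra)).
  destruct (HD v (eps / (4 * r))) as (v' & Dv' & C & S).
  { apply Rdiv_lt_0_compat; lra. }
  exists v'; split; trivial.
  apply Rle_lt_trans with (1 := edist_le_coords _ _); rcoords.
  rewrite E1, E3, <- Ev.
  replace (M r + r * cos v' - kappa)
    with ((M r + r * cos v - kappa) + r * (cos v' - cos v)) by ring.
  replace (r * sin v' - r * sin v) with (r * (sin v' - sin v)) by ring.
  pose proof (Rabs_triang (M r + r * cos v - kappa) (r * (cos v' - cos v))) as T1.
  rewrite (Rabs_mult r) in T1; rewrite (Rabs_mult r).
  rewrite (Rabs_pos_eq r) in * by lra.
  assert (K : forall x, x < eps / (4 * r) -> r * x < eps / 4).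
  { intros x Hx; apply (Rmult_lt_compat_l r) in Hx; [|lra].
    replace (r * (eps / (4 * r))) with (eps / 4) in Hx by (field; lra); lra. }
  apply K in C; apply K in S; lra.
Qed.

Lemma limit_leaf_line (Y : R -> R -> vec) (D : R -> R -> Prop) (g : R -> R) S0 :
  (forall s v, S0 < s -> Y s v = ringpt M Z (g s) v) ->
  (forall B, exists S1, forall s, S1 < s -> B < g s) ->
  (forall s, S0 < s -> dense_angles (D s)) ->
  forall p, limit_leaf Y D p <-> line_at kappa zinf p.
Proof.
  intros HY Hg HD p; split.
  - intros Hp.
    assert (A : forall eps, 0 < eps ->
      Rabs (x1 p - kappa) < eps /\ Rabs (x3 p - zinf) < eps).
    { intros eps Heps.
      destruct (min_pos 1 (eps / 2)) as (e & e0 & e1 & e2); [lra|lra|].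
      set (rho := enorm p + 1).
      destruct (enorm_coords_le p) as (N1 & N2 & _).
      assert (0 < rho) by (unfold rho; pose proof (Rabs_pos (x1 p)); lra).
      destruct (ring_near_line rho (eps / 2)) as (Q1 & _ & HQ1); trivial; [lra|].
      destruct (HZ (eps / 2)) as (Q2 & HQ2); [lra|].
      destruct (Hg (Rmax Q1 Q2)) as (S1 & HS1).
      destruct (Hp e e0) as (S2 & HS2).
      set (s := Rmax S0 (Rmax S1 S2) + 1).
      assert (S0 < s /\ S1 < s /\ S2 < s) as (B0 & B1 & B2).
      { unfold s; minmax; lra. }
      destruct (HS2 s B2) as (v & _ & Dv); rewrite HY in Dv by trivial.
      specialize (HS1 s B1); minmax.
      destruct (edist_coords_le (ringpt M Z (g s) v) p) as (D1 & D2 & D3).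
      revert D1 D2 D3; rcoords; intros D1 D2 D3.
      assert (HQ2' := HQ2 (g s) ltac:(lra)).
      destruct (HQ1 (g s) v) as (E1 & _); [lra| | |].
      - apply Rabs_le_between in N1; apply Rabs_le_between in D1.
        apply Rabs_le; unfold rho; lra.
      - apply Rabs_le_between in N2; apply Rabs_le_between in D2.
        apply Rabs_le; unfold rho; lra.
      - apply Rabs_le_between in D1; apply Rabs_le_between in D3.
        apply Rabs_def2 in E1; apply Rabs_def2 in HQ2'.
        split; apply Rabs_def1; lra. }
    split; apply cond_eq; intros eps Heps; now apply A.
  - intros Lp eps Heps; pose proof (Rabs_pos (x2 p)).
    destruct (ring_reaches_line_dense (Rabs (x2 p) + 1) eps) as (Q & HQ);
      trivial; [lra|].
    destruct (Hg Q) as (S1 & HS1).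
    exists (Rmax S0 S1); intros s Hs; minmax.
    destruct (HQ (g s) p (D s)) as (v & Dv & B); trivial;
      [apply HS1; lra|apply HD; lra|lra|].
    exists v; split; trivial; rewrite HY; trivial; lra.
Qed.

Lemma leaves_cvg_line (P : R -> Prop) (D : R -> R -> Prop) (S T : vec -> Prop) delta0 :
  (forall r r', P r -> r <= r' -> P r') -> (exists r, P r) ->
  (forall r r', P r -> r < r' -> Z r < Z r') -> (forall r, P r -> Z r < zinf) ->
  (forall r, P r -> exists v, D r v) ->
  0 < delta0 ->
  (forall p, S p -> 0 < Rabs (x3 p - zinf) < delta0 -> exists r, P r /\ x3 p = Z r) ->
  (forall r p, P r -> (S p /\ x3 p = Z r <-> ring_leaf M Z D r p)) ->
  (forall rho eps, 0 < rho -> 0 < eps -> exists Q, forall r v, P r -> Q < r ->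
     D r v -> Rabs (M r + r * cos v) <= rho -> Rabs (r * sin v) <= rho ->
     exists p', T p' /\ edist (ringpt M Z r v) p' < eps) ->
  (forall rho eps, 0 < rho -> 0 < eps -> exists Q, forall r p', P r -> Q < r ->
     T p' -> Rabs (x2 p') <= rho ->
     exists v, D r v /\ edist (ringpt M Z r v) p' < eps) ->
  leaves_cvg_loc S T zinf.
Proof.
  intros HP (ra & Pa) HZi HZl HD Hd0 HA HB HN HR rho Hrho.
  apply (leaves_cvg_in_intro _ S T zinf P Z (ring_leaf M Z D) delta0); trivial.
  - intros delta Hd; destruct (HZ delta Hd) as (Q & HQ).
    set (r := Rmax ra Q + 1); minmax.
    assert (Pr : P r) by (apply (HP ra); trivial; unfold r; lra).
    destruct (HD r Pr) as (v & Dv).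
    exists r, (ringpt M Z r v); split; trivial; split; [now exists v|].
    split; [apply Rabs_pos_lt; specialize (HZl r Pr); lra|].
    apply HQ; unfold r; lra.
  - intros eps Heps.
    destruct (HN rho eps) as (Q1 & HQ1); trivial.
    destruct (HR rho eps) as (Q2 & HQ2); trivial.
    set (r0 := Rmax ra (Rmax Q1 Q2) + 1).
    minmax.
    assert (P0 : P r0) by (apply (HP ra); trivial; unfold r0; lra).
    exists (zinf - Z r0); split; [specialize (HZl r0 P0); lra|].
    intros r Pr (_ & Br).
    assert (Lr : r0 <= r).
    { destruct (Rle_dec r0 r) as [|N]; trivial; exfalso.
      assert (Z r < Z r0) by (apply HZi; trivial; lra).
      apply Rabs_def2 in Br; lra. }
    unfold r0 in Lr; split.
    + intros p (v & Dv & ->) Wp; destruct (enorm_coords_le (ringpt M Z r v)) as (N1 & N2 & _).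
      revert N1 N2; rcoords; intros N1 N2; apply HQ1; trivial; lra.
    + intros p' Tp' Wp'; destruct (enorm_coords_le p') as (_ & N2 & _).
      destruct (HQ2 r p') as (v & Dv & Ev); trivial; try lra.
      exists (ringpt M Z r v); split; trivial; now exists v.
Qed.

Lemma leaves_cvg_full_line (P : R -> Prop) (D : R -> R -> Prop) (S : vec -> Prop) delta0 :
  (forall r r', P r -> r <= r' -> P r') -> (exists r, P r) ->
  (forall r r', P r -> r < r' -> Z r < Z r') -> (forall r, P r -> Z r < zinf) ->
  (forall r, P r -> dense_angles (D r)) ->
  0 < delta0 ->
  (forall p, S p -> 0 < Rabs (x3 p - zinf) < delta0 -> exists r, P r /\ x3 p = Z r) ->
  (forall r p, P r -> (S p /\ x3 p = Z r <-> ring_leaf M Z D r p)) ->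
  leaves_cvg_loc S (line_at kappa zinf) zinf.
Proof.
  intros HP HPe HZi HZl HD Hd0 HA HB.
  apply (leaves_cvg_line P D S _ delta0); trivial.
  - intros r Pr; destruct (HD r Pr 0 1) as (v & Dv & _); [lra|now exists v].
  - intros rho eps Hrho Heps.
    destruct (ring_near_line rho (eps / 2)) as (Q1 & _ & HQ1); trivial; [lra|].
    destruct (HZ (eps / 2)) as (Q2 & HQ2); [lra|].
    exists (Rmax Q1 Q2); intros r v Pr Hr Dv B1 B2.
    minmax.
    exists (kappa, r * sin v, zinf); split; [unfold line_at; now coords|].
    apply Rle_lt_trans with (1 := edist_le_coords _ _); rcoords.
    rewrite Rminus_diag, Rabs_R0.
    destruct (HQ1 r v) as (E & _); trivial; try lra.
    specialize (HQ2 r ltac:(lra)); lra.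
  - intros rho eps Hrho Heps.
    destruct (ring_reaches_line_dense rho eps) as (Q & HQ); trivial.
    exists Q; intros r p' Pr Hr Lp B; apply HQ; trivial; now apply HD.
Qed.

End Line.

Definition continuous_at (f : R -> R) (x : R) : Prop :=
  forall eps, 0 < eps -> exists d, 0 < d /\
    forall y, Rabs (y - x) < d -> Rabs (f y - f x) < eps.

Lemma continuous_at_iff (f : R -> R) x : continuous f x <-> continuous_at f x.
Proof.
  split.
  - intros H eps Heps.
    destruct (proj1 (filterlim_locally f (f x)) H (mkposreal eps Heps)) as (d & Hd).
    exists d; split; [apply cond_pos|]; intros y Hy; exact (Hd y Hy).
  - intros H; apply filterlim_locally; intros eps.
    destruct (H eps (cond_pos eps)) as (d & d0 & Hd).
    exists (mkposreal d d0); intros y Hy; exact (Hd y Hy).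
Qed.

Lemma continuous_pair {T U V : UniformSpace} (f : T -> U) (g : T -> V) x :
  continuous f x -> continuous g x -> continuous (fun t => (f t, g t)) x.
Proof.
  intros Hf Hg; apply filterlim_locally; intros eps.
  generalize (filter_and _ _ (proj1 (filterlim_locally f (f x)) Hf eps)
    (proj1 (filterlim_locally g (g x)) Hg eps)).
  apply filter_imp; intros t (A & B); now split.
Qed.

Lemma mul_le_1_lt c x e : -1 <= c <= 1 -> Rabs x < e -> Rabs (c * x) < e.
Proof.
  intros Hc Hx; rewrite Rabs_mult; pose proof (Rabs_pos x).
  assert (Rabs c <= 1) by (apply Rabs_le; lra); nra.
Qed.

Lemma angle_near v0 rho : 0 < rho <= 1 ->
  exists eta, 0 < eta /\ forall v,
    Rabs (cos v - cos v0) < eta -> Rabs (sin v - sin v0) < eta ->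
    exists v', Rabs (v' - v0) <= rho /\ cos v' = cos v /\ sin v' = sin v.
Proof.
  intros Hrho; pose proof PI2_1 as P1.
  assert (C1 : cos rho < 1) by (rewrite <- cos_0; apply cos_decreasing_1; lra).
  exists ((1 - cos rho) / 2); split; [lra|]; intros v H1 H2.
  destruct (angle_reduce (v - v0)) as (t & Ht & Ec & Es).
  exists (v0 + t); rewrite cos_plus, sin_plus, Ec, Es, <- cos_plus, <- sin_plus.
  replace (v0 + (v - v0)) with v by ring; split; [|split; trivial].
  replace (v0 + t - v0) with t by ring.
  assert (B : cos rho < cos t).
  { rewrite Ec, cos_minus.
    pose proof (sin2_eq v) as T; pose proof (COS_bound v); pose proof (SIN_bound v).
    apply (mul_le_1_lt (cos v)) in H1; [|lra].
    apply (mul_le_1_lt (sin v)) in H2; [|lra].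
    apply Rabs_def2 in H1; apply Rabs_def2 in H2.
    replace (cos v * cos v0 + sin v * sin v0)
      with (1 - cos v * (cos v - cos v0) - sin v * (sin v - sin v0)) by ring [T].
    lra. }
  destruct (Rle_dec (Rabs t) rho) as [|N]; trivial; exfalso.
  assert (E : cos (Rabs t) = cos t).
  { unfold Rabs; destruct (Rcase_abs t); [apply cos_neg|trivial]. }
  rewrite <- E in B.
  assert (cos (Rabs t) < cos rho); [|lra].
  pose proof (Rabs_pos t).
  apply cos_decreasing_1; try lra; apply Rabs_le; lra.
Qed.

Lemma boundary_point_ring (M Z : R -> R) (S : vec -> Prop) r0 v0 rho0 delta0 :
  0 < r0 -> 0 < rho0 -> 0 < delta0 ->
  (forall r, r0 <= r -> continuous_at M r /\ continuous_at Z r) ->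
  (forall r r', r0 <= r < r' -> Z r < Z r') ->
  (forall r v, r0 <= r <= r0 + rho0 -> Rabs (v - v0) <= rho0 -> S (ringpt M Z r v)) ->
  (forall p, S p -> x3 p < Z r0 + delta0 ->
     exists r v, r0 <= r /\ p = ringpt M Z r v) ->
  boundary_point S (ringpt M Z r0 v0).
Proof.
  intros Hr0 Hrho0 Hd0 HC HZ HS HS'.
  destruct (min_pos 1 rho0) as (rho & rho1 & rho2 & rho3); [lra|lra|].
  exists (fun a => ringpt M Z (r0 + fst a) (v0 + snd a)), rho.
  split; trivial; split; [simpl; now rewrite !Rplus_0_r|].
  intros box; split; [|split; [|split]].
  - intros (a, b) (Ba & Bb); simpl in *; apply HS; [lra|].
    apply Rabs_le; lra.
  - intros (a, b) (Ba & Bb); simpl in Ba, Bb.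
    assert (K : forall f : R -> R, continuous_at f (r0 + a) ->
      continuous (fun c : R * R => f (r0 + fst c)) (a, b)).
    { intros f Hf; apply (continuous_comp (fun c : R * R => r0 + fst c) f).
      - apply (continuous_plus (fun _ => r0) fst);
          [apply continuous_const|apply continuous_fst].
      - now apply continuous_at_iff. }
    assert (KI : continuous (fun c : R * R => r0 + fst c) (a, b)).
    { apply (continuous_plus (fun _ => r0) fst);
        [apply continuous_const|apply continuous_fst]. }
    assert (KV : forall f : R -> R, continuous f (v0 + b) ->
      continuous (fun c : R * R => f (v0 + snd c)) (a, b)).
    { intros f Hf; apply (continuous_comp (fun c : R * R => v0 + snd c) f); trivial.
      apply (continuous_plus (fun _ => v0) snd);
        [apply continuous_const|apply continuous_snd]. }
    destruct (HC (r0 + a)) as (CM & CZ); [lra|].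
    unfold continuous_on.
    cut (continuous (fun c : R * R => ringpt M Z (r0 + fst c) (v0 + snd c)) (a, b)).
    { intros C P HP; generalize (C P HP); unfold filtermap, within.
      apply filter_imp; auto. }
    unfold ringpt.
    apply (continuous_pair (fun c : R * R => (M (r0 + fst c) + (r0 + fst c) *
      cos (v0 + snd c), (r0 + fst c) * sin (v0 + snd c))) (fun c => Z (r0 + fst c))).
    + apply (continuous_pair (fun c : R * R => M (r0 + fst c) + (r0 + fst c) *
        cos (v0 + snd c)) (fun c => (r0 + fst c) * sin (v0 + snd c))).
      * apply (continuous_plus (fun c : R * R => M (r0 + fst c))
          (fun c => (r0 + fst c) * cos (v0 + snd c))); [now apply K|].
        apply (continuous_mult (fun c : R * R => r0 + fst c)
          (fun c => cos (v0 + snd c))); trivial.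
        apply KV, continuous_cos.
      * apply (continuous_mult (fun c : R * R => r0 + fst c)
          (fun c => sin (v0 + snd c))); trivial.
        apply KV, continuous_sin.
    + now apply K.
  - intros (a, b) (a', b') (Ba & Bb) (Ba' & Bb'); simpl in *; intros E.
    pose proof (f_equal x1 E) as E1; pose proof (f_equal x2 E) as E2.
    pose proof (f_equal x3 E) as E3; revert E1 E2 E3; rcoords; intros E1 E2 E3.
    assert (a = a').
    { destruct (Rtotal_order a a') as [L|[|L]]; trivial; exfalso;
        [pose proof (HZ (r0 + a) (r0 + a'))|pose proof (HZ (r0 + a') (r0 + a))]; lra. }
    subst a'; f_equal.
    assert (cos (v0 + b) = cos (v0 + b')) by (apply (Rmult_eq_reg_l (r0 + a)); lra).
    assert (sin (v0 + b) = sin (v0 + b')) by (apply (Rmult_eq_reg_l (r0 + a)); lra).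
    assert (C : cos (b - b') = 1).
    { replace (b - b') with ((v0 + b) - (v0 + b')) by ring.
      rewrite cos_minus, H, H0; pose proof (sin2_eq (v0 + b')); lra. }
    pose proof PI2_1.
    assert (C' : cos (Rabs (b - b')) = 1).
    { unfold Rabs; destruct (Rcase_abs (b - b')); rewrite ?cos_neg; trivial. }
    destruct (Req_dec b b') as [|N]; trivial; exfalso.
    assert (0 < Rabs (b - b')) by (apply Rabs_pos_lt; lra).
    assert (Rabs (b - b') <= 2) by (apply Rabs_le; lra).
    assert (cos (Rabs (b - b')) < cos 0) by (apply cos_decreasing_1; lra).
    rewrite cos_0 in *; lra.
  - destruct (angle_near v0 rho) as (eta & eta0 & Heta); [lra|].
    destruct (HC r0) as (CM & _); [lra|].
    set (e := r0 * eta / 3).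
    assert (e0 : 0 < e) by (unfold e; nra).
    destruct (CM e e0) as (d1 & d10 & Hd1).
    set (d2 := Rmin rho (Rmin d1 e) / 2).
    assert (m0 : 0 < Rmin rho (Rmin d1 e)) by (repeat apply Rmin_glb_lt; lra).
    assert (d20 : 0 < d2) by (unfold d2; lra).
    assert (d2 < rho /\ d2 < d1 /\ d2 < e) as (L1 & L2 & L3).
    { minmax; unfold d2; lra. }
    set (delta := Rmin e (Rmin delta0 (Z (r0 + d2) - Z r0))).
    assert (Zd : Z r0 < Z (r0 + d2)) by (apply HZ; lra).
    assert (D0 : 0 < delta) by (repeat apply Rmin_glb_lt; lra).
    assert (delta <= e /\ delta <= delta0 /\ delta <= Z (r0 + d2) - Z r0) as (M1 & M2 & M3).
    { minmax; unfold delta; lra. }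
    exists delta; split; trivial; intros x Sx Dx.
    destruct (edist_coords_le x (ringpt M Z r0 v0)) as (X1 & X2 & X3).
    revert X1 X2 X3; rcoords; intros X1 X2 X3.
    apply Rabs_le_between in X1; apply Rabs_le_between in X2.
    apply Rabs_le_between in X3.
    destruct (HS' x Sx) as (r & v & Hr & ->); [lra|].
    revert X1 X2 X3; rcoords; intros X1 X2 X3.
    assert (Lr : r < r0 + d2).
    { destruct (Rlt_dec r (r0 + d2)) as [|N]; trivial; exfalso.
      destruct (Req_dec r (r0 + d2)) as [E|NE]; [rewrite E in *; lra|].
      assert (Z (r0 + d2) < Z r) by (apply HZ; lra); lra. }
    assert (DM := Hd1 r ltac:(rewrite Rabs_pos_eq; lra)); apply Rabs_def2 in DM.
    pose proof (COS_bound v); pose proof (SIN_bound v).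
    destruct (Heta v) as (v' & Bv & Ec & Es).
    + apply Rabs_def1; apply (Rmult_lt_reg_l r0); trivial; unfold e in *; nra.
    + apply Rabs_def1; apply (Rmult_lt_reg_l r0); trivial; unfold e in *; nra.
    + exists (r - r0, v' - v0); split.
      * apply Rabs_le_between in Bv; unfold box; simpl; lra.
      * simpl; replace (r0 + (r - r0)) with r by ring.
        replace (v0 + (v' - v0)) with v' by ring.
        unfold ringpt; now rewrite Ec, Es.
Qed.

Lemma leaves_cvg_circle (M Z : R -> R) (S : vec -> Prop) r1 :
  0 < r1 ->
  continuous_at M r1 -> continuous_at Z r1 ->
  (forall r r', 0 < r < r' -> r' <= r1 -> Z r < Z r') ->
  (forall p, S p <-> exists r v, 0 < r < r1 /\ p = ringpt M Z r v) ->
  leaves_cvg S (fun p => exists v, p = ringpt M Z r1 v) (Z r1).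
Proof.
  intros H1 CM CZ HZ HS.
  apply (leaves_cvg_in_intro _ S _ (Z r1) (fun r => 0 < r < r1) Z
    (ring_leaf M Z (fun _ _ => True)) 1); [lra| | | |].
  - intros p Sp _; apply HS in Sp; destruct Sp as (r & v & Hr & ->); now exists r.
  - intros r p Hr; split.
    + intros (Sp & Ep); apply HS in Sp; destruct Sp as (r' & v & Hr' & ->).
      exists v; split; trivial; rewrite x3_ringpt in Ep.
      destruct (Rtotal_order r r') as [L|[-> |L]]; trivial; exfalso;
        [pose proof (HZ r r')|pose proof (HZ r' r)]; lra.
    + intros (v & _ & ->); split; [|apply x3_ringpt].
      apply HS; now exists r, v.
  - intros delta Hd; destruct (CZ delta Hd) as (d & d0 & HCZ).
    set (r := r1 - Rmin r1 d / 2).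
    assert (0 < Rmin r1 d) by (apply Rmin_glb_lt; lra).
    minmax.
    assert (Hr : 0 < r < r1) by (unfold r; lra).
    exists r, (ringpt M Z r 0); split; trivial; split; [now exists 0|].
    split; [apply Rabs_pos_lt; pose proof (HZ r r1); lra|].
    apply HCZ; rewrite Rabs_left1; unfold r; lra.
  - intros eps Heps.
    destruct (CZ (eps / 4)) as (d1 & d10 & HCZ); [lra|].
    destruct (CM (eps / 4)) as (d2 & d20 & HCM); [lra|].
    set (d := Rmin (Rmin d1 d2) (Rmin (r1 / 2) (eps / 8))).
    assert (d0 : 0 < d) by (repeat apply Rmin_glb_lt; lra).
    assert (d <= d1 /\ d <= d2 /\ d <= r1 / 2 /\ d <= eps / 8) as (L1 & L2 & L3 & L4).
    { minmax.
      unfold d; lra. }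
    exists (Z r1 - Z (r1 - d)); split; [pose proof (HZ (r1 - d) r1); lra|].
    intros r Hr (_ & Br).
    assert (Lr : r1 - d < r).
    { destruct (Rlt_dec (r1 - d) r) as [|N]; trivial; exfalso.
      apply Rabs_def2 in Br.
      destruct (Req_dec r (r1 - d)) as [E|NE]; [rewrite E in *; lra|].
      pose proof (HZ r (r1 - d)); lra. }
    assert (C : forall v, edist (ringpt M Z r v) (ringpt M Z r1 v) < eps).
    { intros v; apply Rle_lt_trans with (1 := edist_le_coords _ _); rcoords.
      assert (BM := HCM r ltac:(rewrite Rabs_left1; lra)).
      assert (BZ := HCZ r ltac:(rewrite Rabs_left1; lra)).
      replace (M r + r * cos v - (M r1 + r1 * cos v))
        with ((M r - M r1) + (r - r1) * cos v) by ring.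
      replace (r * sin v - r1 * sin v) with ((r - r1) * sin v) by ring.
      pose proof (Rabs_triang (M r - M r1) ((r - r1) * cos v)) as T1.
      rewrite (Rabs_mult (r - r1)) in T1; rewrite (Rabs_mult (r - r1)).
      rewrite (Rabs_left1 (r - r1)) in * by lra.
      assert (Rabs (cos v) <= 1) by (apply Rabs_le, COS_bound).
      assert (Rabs (sin v) <= 1) by (apply Rabs_le, SIN_bound).
      assert (- (r - r1) * Rabs (cos v) <= - (r - r1)) by nra.
      assert (- (r - r1) * Rabs (sin v) <= - (r - r1)) by nra.
      lra. }
    split.
    + intros p (v & _ & ->) _; exists (ringpt M Z r1 v); split; [now exists v|apply C].
    + intros p' (v & ->) _; exists (ringpt M Z r v); split; [now exists v|apply C].
Qed.

(** * Radial primitives *)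

Section CausalRiemann.

Variables (lam : R) (m z : R -> R) (q v : R).
Hypothesis Hq : 0 < q.
Hypothesis Hc : 0 < cubic lam q.
Hypothesis Hm : is_derive m q (1 / 2 * (q / sqrt (cubic lam q))).
Hypothesis Hz : is_derive z q (1 / 2 * / sqrt (cubic lam q)).

Let s := sqrt (q ^ 2 + lam * q + 1).
Let z' := / (2 * (sqrt q * s)).

Let quad_pos : 0 < q ^ 2 + lam * q + 1.
Proof.
  apply (Rmult_lt_reg_l q); trivial; rewrite Rmult_0_r.
  unfold cubic in Hc; lra.
Qed.
Let s_pos : 0 < s.
Proof. now apply sqrt_lt_R0. Qed.
Let r_pos : 0 < sqrt q.
Proof. now apply sqrt_lt_R0. Qed.
Let sqrt_cubic : sqrt (cubic lam q) = sqrt q * s.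
Proof.
  unfold s; rewrite <- sqrt_mult; [f_equal; unfold cubic; ring|lra|lra].
Qed.
Let z'_pos : 0 < z'.
Proof.
  apply Rinv_0_lt_compat; apply Rmult_lt_0_compat; [lra|].
  now apply Rmult_lt_0_compat.
Qed.

Let d1_X : d1 (riemann_X m z) q v =
  (q * z' + / (2 * sqrt q) * cos v, 0 + / (2 * sqrt q) * sin v, z').
Proof.
  unfold d1; rewrite (dvec_ext_loc _ (fun u => fcomb std1 std2 std3
    (m u + sqrt u * cos v) (0 + sqrt u * sin v) (z u))).
  2:{ apply filter_forall; intros u; unfold riemann_X; rewrite fcomb_std.
      apply vec_eq; coords; ring. }
  rewrite (dvec_fcomb std1 std2 std3 _ _ _ q (q * z' + / (2 * sqrt q) * cos v)
    (0 + / (2 * sqrt q) * sin v) z'); [apply fcomb_std| | |].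
  - rewrite sqrt_cubic in Hm; auto_derive; [repeat split; trivial; eexists; exact Hm|].
    derive_values; unfold z'; field; lra.
  - auto_derive; trivial; field; lra.
  - rewrite sqrt_cubic in Hz; replace z' with (1 / 2 * / (sqrt q * s)); trivial.
    unfold z'; field; lra.
Qed.

Let d2_X : d2 (riemann_X m z) q v = (- sqrt q * sin v, sqrt q * cos v, 0).
Proof.
  unfold d2; rewrite (dvec_ext_loc _ (fun u => fcomb std1 std2 std3
    (m q + sqrt q * cos u) (sqrt q * sin u) (z q))).
  2:{ apply filter_forall; intros u; unfold riemann_X; rewrite fcomb_std.
      apply vec_eq; coords; ring. }
  rewrite (dvec_fcomb std1 std2 std3 _ _ _ v (- sqrt q * sin v)
    (sqrt q * cos v) 0); [apply fcomb_std| | |]; auto_derive; trivial; ring.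
Qed.

Let phi_X : q * z' * cos v + 0 * sin v + / (2 * sqrt q) = z' * (q * cos v + s).
Proof. unfold z'; field; lra. Qed.

Lemma riemann_X_spacelike :
  1 < q * cos v + sqrt (q ^ 2 + lam * q + 1) -> spacelike_at (riemann_X m z) q v.
Proof.
  fold s; intros H; apply (spacelike_intro _ _ _ _ _ _ _ _ d1_X d2_X r_pos).
  rewrite phi_X, Rpow_mult_distr.
  assert (0 < z' ^ 2) by now apply pow_lt.
  assert (1 < (q * cos v + s) ^ 2) by nra; nra.
Qed.

Lemma riemann_X_timelike :
  -1 < q * cos v + sqrt (q ^ 2 + lam * q + 1) < 1 -> timelike_at (riemann_X m z) q v.
Proof.
  fold s; intros H; apply (timelike_intro _ _ _ _ _ _ _ _ d1_X d2_X r_pos).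
  rewrite phi_X, Rpow_mult_distr.
  assert (0 < z' ^ 2) by now apply pow_lt.
  assert ((q * cos v + s) ^ 2 < 1) by nra; nra.
Qed.

Lemma riemann_X_lightlike :
  q * cos v + sqrt (q ^ 2 + lam * q + 1) = 1 -> lightlike_at (riemann_X m z) q v.
Proof.
  fold s; intros H; apply (lightlike_intro _ _ _ _ _ _ _ _ d1_X d2_X r_pos); [lra|].
  rewrite phi_X, H; ring.
Qed.

End CausalRiemann.

Definition quartic (lam r : R) : R := r ^ 4 + lam * r ^ 2 + 1.

Definition radial_pair (lam : R) (U : R -> Prop) (M Z : R -> R) : Prop :=
  forall r, U r -> 0 < quartic lam r /\
    is_derive M r (r ^ 2 / sqrt (quartic lam r)) /\
    is_derive Z r (1 / sqrt (quartic lam r)).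

Lemma riemann_primitives_of_radial lam (U J : R -> Prop) M Z :
  radial_pair lam U M Z -> (forall q, J q -> 0 < q /\ U (sqrt q)) ->
  riemann_primitives lam J (fun q => M (sqrt q)) (fun q => Z (sqrt q)).
Proof.
  intros H HJ q Jq; destruct (HJ q Jq) as (Hq & Uq).
  destruct (H _ Uq) as (P0 & HM & HZ).
  assert (r0 : 0 < sqrt q) by now apply sqrt_lt_R0.
  assert (Er : sqrt q ^ 2 = q) by (apply pow2_sqrt; lra).
  assert (E : sqrt (cubic lam q) = sqrt q * sqrt (quartic lam (sqrt q))).
  { rewrite <- sqrt_mult by lra; f_equal; unfold cubic, quartic.
    replace (sqrt q ^ 4) with ((sqrt q ^ 2) ^ 2) by ring; rewrite Er; ring. }
  pose proof (sqrt_lt_R0 _ P0) as w0; rewrite E.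
  set (w := sqrt (quartic lam (sqrt q))) in *.
  split; auto_derive; try (repeat split; trivial; eexists; eassumption);
    derive_values; rewrite ?Er; field; lra.
Qed.

Lemma derive_at_0_bound (f : R -> R) l eps :
  is_derive f 0 l -> f 0 = 0 -> 0 < eps ->
  exists d, 0 < d /\ forall r, 0 < r < d -> Rabs (f r - l * r) <= eps * r.
Proof.
  intros Hf F0 Heps; apply is_derive_Reals in Hf.
  destruct (Hf eps Heps) as (d & Hd); exists d; split; [apply cond_pos|].
  intros r (r0 & r1).
  specialize (Hd r ltac:(lra) ltac:(rewrite Rabs_pos_eq; lra)).
  rewrite Rplus_0_l, F0, Rminus_0_r in Hd.
  replace (f r - l * r) with ((f r / r - l) * r) by (field; lra).
  rewrite Rabs_mult, (Rabs_pos_eq r) by lra.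
  apply Rmult_le_compat_r; lra.
Qed.

Lemma radial_pair_near_0 lam (U : R -> Prop) M Z :
  radial_pair lam U M Z -> U 0 -> M 0 = 0 -> Z 0 = 0 ->
  forall eps, 0 < eps -> exists d, 0 < d /\ forall r, 0 < r < d ->
    Rabs (M r) <= eps * r /\ Rabs (Z r - r) <= eps * r.
Proof.
  intros H U0 M0 Z0 eps Heps; destruct (H 0 U0) as (_ & HM & HZ).
  replace (quartic lam 0) with 1 in HM, HZ by (unfold quartic; ring).
  rewrite sqrt_1 in HM, HZ.
  destruct (derive_at_0_bound M _ eps HM M0 Heps) as (d1 & d10 & H1).
  destruct (derive_at_0_bound Z _ eps HZ Z0 Heps) as (d2 & d20 & H2).
  exists (Rmin d1 d2); split; [now apply Rmin_glb_lt|]; intros r Hr.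
  minmax.
  specialize (H1 r ltac:(lra)); specialize (H2 r ltac:(lra)).
  replace (M r - 0 ^ 2 / 1 * r) with (M r) in H1 by field.
  replace (Z r - 1 / 1 * r) with (Z r - r) in H2 by field.
  now split.
Qed.

Lemma radial_pair_increasing lam (U : R -> Prop) M Z r r' :
  convex U -> radial_pair lam U M Z -> U r -> U r' -> r < r' -> Z r < Z r'.
Proof.
  intros HU H Ur Ur' L.
  destruct (MVT_convex U Z (fun r => 1 / sqrt (quartic lam r)) r r')
    as (c & _ & Uc & E); trivial.
  - intros t Ut; apply (H t Ut).
  - assert (0 < 1 / sqrt (quartic lam c)).
    { apply Rdiv_lt_0_compat; [lra|]; apply sqrt_lt_R0, (H c Uc). }
    nra.
Qed.

(* The quartic is palindromic, so the inversion [r -> / r] exchanges the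
   radial primitives near [0] with those near infinity. *)
Definition M_inv (lam c : R) (M : R -> R) (r : R) : R :=
  sqrt (quartic lam r) / r - M (/ r) + c.
Definition Z_inv (c : R) (Z : R -> R) (r : R) : R := c - Z (/ r).

Lemma quartic_inv lam r : 0 < r -> quartic lam (/ r) = quartic lam r / r ^ 4.
Proof. intros H; unfold quartic; field; lra. Qed.

Lemma radial_pair_inv lam (U : R -> Prop) M Z cm cz :
  radial_pair lam U M Z ->
  radial_pair lam (fun r => 0 < r /\ U (/ r)) (M_inv lam cm M) (Z_inv cz Z).
Proof.
  intros H r (Hr & Ur); destruct (H _ Ur) as (P0 & HM & HZ).
  rewrite quartic_inv in P0 by trivial.
  assert (r4 : 0 < r ^ 4) by now apply pow_lt.
  assert (Q0 : 0 < quartic lam r).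
  { replace (quartic lam r) with (quartic lam r / r ^ 4 * r ^ 4) by (field; lra).
    now apply Rmult_lt_0_compat. }
  rewrite quartic_inv in HM, HZ by trivial.
  replace (sqrt (quartic lam r / r ^ 4)) with (sqrt (quartic lam r) / r ^ 2) in HM, HZ.
  2:{ rewrite sqrt_div_alt by trivial; replace (r ^ 4) with ((r ^ 2) ^ 2) by ring.
      rewrite (sqrt_pow2 (r ^ 2)); trivial; apply pow2_ge_0. }
  pose proof (sqrt_lt_R0 _ Q0) as w0.
  assert (Ew : sqrt (quartic lam r) ^ 2 = quartic lam r) by (apply pow2_sqrt; lra).
  assert (DQ : is_derive (quartic lam) r (4 * r ^ 3 + 2 * lam * r)).
  { unfold quartic; auto_derive; trivial; ring. }
  split; trivial; split.
  - unfold M_inv; auto_derive.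
    + repeat split; try (eexists; eassumption); trivial; lra.
    + derive_values; set (w := sqrt (quartic lam r)) in *.
      transitivity ((2 * r ^ 4 + lam * r ^ 2 - w ^ 2 + 1) / (r ^ 2 * w)).
      * field; lra.
      * rewrite Ew; unfold quartic; field; lra.
  - unfold Z_inv; auto_derive.
    + repeat split; try (eexists; eassumption); trivial; lra.
    + derive_values; field; lra.
Qed.

Lemma inv_tends_at_infty lam cm cz M Z :
  (forall eps, 0 < eps -> exists d, 0 < d /\ forall r, 0 < r < d ->
     Rabs (M r) <= eps * r /\ Rabs (Z r - r) <= eps * r) ->
  tends_at_infty (fun r => M_inv lam cm M r + -1 * r) cm /\
  tends_at_infty (Z_inv cz Z) cz.
Proof.
  intros H; destruct (H 1) as (d & d0 & Hd); [lra|].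
  assert (B : forall eps, 0 < eps -> exists Q, 0 < Q /\ forall r, Q < r ->
    Rabs (M (/ r)) < eps /\ Rabs (Z (/ r)) < eps).
  { intros eps Heps; exists (/ d + 2 / eps).
    assert (0 < / d) by now apply Rinv_0_lt_compat.
    assert (0 < 2 / eps) by (apply Rdiv_lt_0_compat; lra).
    split; [lra|]; intros r Hr.
    assert (r0 : 0 < / r) by (apply Rinv_0_lt_compat; lra).
    assert (r1 : / r < d).
    { rewrite <- (Rinv_inv d); apply Rinv_lt_contravar; [|lra].
      apply Rmult_lt_0_compat; lra. }
    assert (r2 : / r < eps / 2).
    { replace (eps / 2) with (/ (2 / eps)) by (field; lra).
      apply Rinv_lt_contravar; [|lra]; apply Rmult_lt_0_compat; lra. }
    destruct (Hd (/ r)) as (A1 & A2); [lra|].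
    apply Rabs_le_between in A2; split; [lra|apply Rabs_def1; lra]. }
  split; intros eps Heps.
  - destruct (B (eps / 2)) as (Q & Q0 & HQ); [lra|].
    set (C := Rabs lam + 1).
    assert (C0 : 0 < C) by (unfold C; pose proof (Rabs_pos lam); lra).
    assert (0 < 2 * C / eps) by (apply Rdiv_lt_0_compat; lra).
    exists (Q + 1 + 2 * C / eps); intros r Hr.
    destruct (HQ r) as (BM & _); [lra|].
    assert (r0 : 1 < r) by lra.
    assert (r1 : 2 * C / eps < r) by lra.
    apply Rlt_div_l in r1; trivial.
    set (w := sqrt (quartic lam r)).
    assert (w0 : 0 <= w) by apply sqrt_pos.
    assert (Bw : Rabs (w ^ 2 - r ^ 4) <= C * r ^ 2).
    { unfold w; destruct (Rle_dec 0 (quartic lam r)) as [L|L].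
      - rewrite pow2_sqrt by trivial; unfold quartic.
        replace (r ^ 4 + lam * r ^ 2 + 1 - r ^ 4) with (lam * r ^ 2 + 1) by ring.
        apply Rle_trans with (1 := Rabs_triang _ _).
        rewrite Rabs_mult, Rabs_R1, (Rabs_pos_eq (r ^ 2)) by apply pow2_ge_0.
        unfold C; nra.
      - rewrite sqrt_neg_0 by lra; unfold quartic in L.
        rewrite Rabs_left1 by (pose proof (pow_lt r 4); nra).
        pose proof (Rle_abs (- lam)); rewrite Rabs_Ropp in H1.
        pose proof (pow2_ge_0 r); unfold C; nra. }
    assert (E : w / r - r = (w ^ 2 - r ^ 4) / (r * (w + r ^ 2))).
    { field; split; nra. }
    assert (Bd : Rabs (w / r - r) < eps / 2).
    { rewrite E; unfold Rdiv at 1; rewrite Rabs_mult, Rabs_inv.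
      assert (D0 : r ^ 3 <= r * (w + r ^ 2)) by nra.
      assert (r3 : 0 < r ^ 3) by (apply pow_lt; lra).
      rewrite (Rabs_pos_eq (r * (w + r ^ 2))) by lra.
      apply Rlt_div_l; [lra|].
      apply Rle_lt_trans with (1 := Bw).
      apply Rlt_le_trans with (eps / 2 * r ^ 3); [|apply Rmult_le_compat_l; lra].
      assert (0 < r ^ 2) by (apply pow_lt; lra).
      replace (eps / 2 * r ^ 3) with ((eps * r / 2) * r ^ 2) by field.
      apply Rmult_lt_compat_r; lra. }
    unfold M_inv; fold w.
    apply Rabs_def2 in BM; apply Rabs_def2 in Bd; apply Rabs_def1; lra.
  - destruct (B eps Heps) as (Q & Q0 & HQ); exists Q; intros r Hr.
    destruct (HQ r Hr) as (_ & BZ); unfold Z_inv.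
    apply Rabs_def2 in BZ; apply Rabs_def1; lra.
Qed.

Lemma is_derive_RInt_continuous (g : R -> R) a x :
  (forall t, continuous g t) -> is_derive (RInt g a) x (g x).
Proof.
  intros Hg; apply (is_derive_RInt_between (fun _ => True)); trivial.
  apply open_true.
Qed.

Lemma constant_difference (J : R -> Prop) (f g l : R -> R) x y :
  convex J -> (forall s, J s -> is_derive f s (l s) /\ is_derive g s (l s)) ->
  J x -> J y -> f x - g x = f y - g y.
Proof.
  intros HJ H; apply (derive_zero_constant J (fun s => f s - g s)); trivial.
  intros s Js; destruct (H s Js) as (D1 & D2).
  auto_derive; [repeat split; eexists; eassumption|derive_values; ring].
Qed.

Lemma complete_radial_pair lam : -2 < lam ->
  exists M Z cm cz, radial_pair lam (fun _ => True) M Z /\ M 0 = 0 /\ Z 0 = 0 /\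
    forall r, 0 < r -> M r = M_inv lam cm M r /\ Z r = Z_inv cz Z r.
Proof.
  intros Hl.
  assert (Q0 : forall r, 0 < quartic lam r).
  { intros r; unfold quartic; destruct (Req_dec r 0) as [->|N]; [lra|].
    assert (0 < r ^ 2) by now apply pow2_gt_0.
    pose proof (pow2_ge_0 (r ^ 2 - 1)); nra. }
  assert (C : forall (g : R -> R) r, continuous g r ->
    continuous (fun r => g r / sqrt (quartic lam r)) r).
  { intros g r Hg; apply (continuous_mult g (fun r => / sqrt (quartic lam r))); trivial.
    specialize (Q0 r).
    apply (ex_derive_continuous (fun r => / sqrt (quartic lam r))).
    assert (ex_derive (quartic lam) r) by (unfold quartic; auto_derive; trivial).
    auto_derive; repeat split; trivial; now apply Rgt_not_eq, sqrt_lt_R0. }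
  pose (M := RInt (fun r => r ^ 2 / sqrt (quartic lam r)) 0 : R -> R).
  pose (Z := RInt (fun r => 1 / sqrt (quartic lam r)) 0 : R -> R).
  assert (H : radial_pair lam (fun _ => True) M Z).
  { intros r _; split; trivial; split.
    - apply (is_derive_RInt_continuous (fun r => r ^ 2 / sqrt (quartic lam r))).
      intros t; apply C, (ex_derive_continuous (fun t => t ^ 2)); auto_derive; trivial.
    - apply (is_derive_RInt_continuous (fun r => 1 / sqrt (quartic lam r))).
      intros t; apply (C (fun _ => 1)), continuous_const. }
  pose proof (radial_pair_inv lam _ M Z 0 0 H) as HI.
  assert (Cv : convex (fun r => 0 < r)) by (intros x y s Hx Hy Hs; lra).
  exists M, Z, (M 1 - M_inv lam 0 M 1), (Z 1 - Z_inv 0 Z 1).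
  split; trivial.
  split; [exact (RInt_point 0 (fun r => r ^ 2 / sqrt (quartic lam r)))|].
  split; [exact (RInt_point 0 (fun r => 1 / sqrt (quartic lam r)))|].
  intros r Hr; split.
  - assert (E : M r - M_inv lam 0 M r = M 1 - M_inv lam 0 M 1).
    { apply (constant_difference (fun r => 0 < r) M (M_inv lam 0 M)
        (fun r => r ^ 2 / sqrt (quartic lam r))); trivial; [|lra].
      intros s Hs; split; [apply (H s I)|apply (HI s (conj Hs I))]. }
    rewrite <- E; unfold M_inv; ring.
  - assert (E : Z r - Z_inv 0 Z r = Z 1 - Z_inv 0 Z 1).
    { apply (constant_difference (fun r => 0 < r) Z (Z_inv 0 Z)
        (fun r => 1 / sqrt (quartic lam r))); trivial; [|lra].
      intros s Hs; split; [apply (H s I)|apply (HI s (conj Hs I))]. }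
    rewrite <- E; unfold Z_inv; ring.
Qed.

Lemma continuous_asin x : -1 < x <= 1 -> continuous asin x.
Proof.
  intros (H1 & [H2|H2]).
  - apply continuity_pt_filterlim, derivable_continuous_pt.
    now apply derivable_pt_asin.
  - subst x; apply continuous_at_iff; intros eps Heps; pose proof PI_RGT_0.
    destruct (min_pos eps (PI / 2)) as (e & e0 & e1 & e2); [lra|lra|].
    assert (S : sin (PI / 2 - e) < 1).
    { rewrite <- sin_PI2; apply sin_increasing_1; lra. }
    assert (S' : 0 <= sin (PI / 2 - e)) by (apply sin_ge_0; lra).
    exists (1 - sin (PI / 2 - e)); split; [lra|]; intros y Hy.
    apply Rabs_def2 in Hy; rewrite asin_1.
    pose proof (asin_bound y).
    destruct (Rle_dec 1 y) as [L|L].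
    + assert (asin y = PI / 2) as ->.
      { unfold asin; destruct (Rle_dec y (-1)); [lra|].
        destruct (Rle_dec 1 y); [trivial|lra]. }
      rewrite Rminus_diag, Rabs_R0; lra.
    + assert (PI / 2 - e < asin y).
      { apply sin_increasing_0; try lra; rewrite sin_asin; lra. }
      rewrite Rabs_left1; lra.
Qed.

Lemma is_derive_asin x : -1 < x < 1 -> is_derive asin x (1 / sqrt (1 - x ^ 2)).
Proof.
  intros H; apply is_derive_Reals.
  replace (x ^ 2) with (x²) by (unfold Rsqr; ring).
  rewrite <- (derive_pt_asin x H).
  apply (derive_pt_eq_1 asin x _ (derivable_pt_asin x H)); reflexivity.
Qed.

Section ArcsinePrimitive.

Variables (a b : R) (k : R -> R).
Hypothesis Hab : 0 < a < b.
Hypothesis Hk : forall t, continuous k t.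

(* The substitution [r = a sin t] removes the singularity at [r = a]. *)
Definition arcsine_density t := k (a * sin t) / sqrt (b ^ 2 - (a * sin t) ^ 2).
Definition arcsine_primitive r := RInt arcsine_density 0 (asin (r / a)).

Let den_pos t : 0 < b ^ 2 - (a * sin t) ^ 2.
Proof.
  pose proof (SIN_bound t); assert (sin t ^ 2 <= 1) by nra.
  rewrite Rpow_mult_distr; assert (0 < a ^ 2) by (apply pow_lt; lra); nra.
Qed.

Lemma arcsine_density_continuous t : continuous arcsine_density t.
Proof.
  pose proof (den_pos t).
  apply (continuous_mult (fun t => k (a * sin t))
    (fun t => / sqrt (b ^ 2 - (a * sin t) ^ 2))).
  - apply (continuous_comp (fun t => a * sin t) k); [|apply Hk].
    apply (ex_derive_continuous (fun t => a * sin t)); auto_derive; trivial.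
  - apply (ex_derive_continuous (fun t => / sqrt (b ^ 2 - (a * sin t) ^ 2))).
    auto_derive; repeat split; [lra|].
    apply Rgt_not_eq, sqrt_lt_R0; lra.
Qed.

Lemma arcsine_primitive_0 : arcsine_primitive 0 = 0.
Proof.
  unfold arcsine_primitive; replace (0 / a) with 0 by (field; lra).
  rewrite asin_0; apply (RInt_point 0 arcsine_density).
Qed.

Lemma arcsine_primitive_derive r : - a < r < a ->
  is_derive arcsine_primitive r (k r / sqrt ((a ^ 2 - r ^ 2) * (b ^ 2 - r ^ 2))).
Proof.
  intros Hr.
  assert (B : -1 < r / a < 1) by (split; [apply Rlt_div_r|apply Rlt_div_l]; lra).
  assert (P1 : 0 < a ^ 2 - r ^ 2) by nra.
  assert (P2 : 0 < b ^ 2 - r ^ 2) by nra.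
  assert (D1 : is_derive (fun r => r / a) r (1 / a)).
  { auto_derive; [lra|field; lra]. }
  pose proof (is_derive_comp asin (fun r => r / a) r _ _ (is_derive_asin _ B) D1) as D2.
  pose proof (is_derive_comp (RInt arcsine_density 0) (fun r => asin (r / a)) r _ _
    (is_derive_RInt_continuous _ 0 _ arcsine_density_continuous) D2) as D3.
  replace (k r / sqrt ((a ^ 2 - r ^ 2) * (b ^ 2 - r ^ 2)))
    with (scal (scal (1 / a) (1 / sqrt (1 - (r / a) ^ 2))) (arcsine_density (asin (r / a))));
    [exact D3|].
  change (1 / a * (1 / sqrt (1 - (r / a) ^ 2)) * arcsine_density (asin (r / a))
    = k r / sqrt ((a ^ 2 - r ^ 2) * (b ^ 2 - r ^ 2))).
  unfold arcsine_density.
  rewrite sin_asin by lra.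
  replace (a * (r / a)) with r by (field; lra).
  replace (1 - (r / a) ^ 2) with ((a ^ 2 - r ^ 2) / a ^ 2) by (field; lra).
  rewrite sqrt_div_alt, sqrt_pow2 by (try apply pow_lt; lra).
  rewrite sqrt_mult by lra.
  pose proof (sqrt_lt_R0 _ P1); pose proof (sqrt_lt_R0 _ P2).
  field; repeat split; lra.
Qed.

Lemma arcsine_primitive_continuous r :
  - a < r <= a -> continuous_at arcsine_primitive r.
Proof.
  intros Hr; apply continuous_at_iff.
  apply (continuous_comp (fun r => asin (r / a)) (RInt arcsine_density 0)).
  - apply (continuous_comp (fun r => r / a) asin).
    + apply (ex_derive_continuous (fun r => r / a)); auto_derive; lra.
    + apply continuous_asin; split; [apply Rlt_div_r|apply Rle_div_l]; lra.
  - apply (ex_derive_continuous (RInt arcsine_density 0)); eexists.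
    apply is_derive_RInt_continuous, arcsine_density_continuous.
Qed.

Lemma arcsine_primitive_increasing r r' :
  (forall t, 0 < k t) -> - a <= r < r' -> r' <= a ->
  arcsine_primitive r < arcsine_primitive r'.
Proof.
  intros K0 Hr Hr'.
  assert (B : forall s, - a <= s <= a -> -1 <= s / a <= 1).
  { intros s Hs; split; [apply Rle_div_r|apply Rle_div_l]; lra. }
  assert (L : asin (r / a) < asin (r' / a)).
  { pose proof (asin_bound (r / a)); pose proof (asin_bound (r' / a)).
    apply sin_increasing_0; try lra.
    rewrite !sin_asin by (apply B; lra).
    apply Rmult_lt_compat_r; [apply Rinv_0_lt_compat|]; lra. }
  unfold arcsine_primitive.
  destruct (MVT_convex (fun _ => True) (RInt arcsine_density 0) arcsine_density
    (asin (r / a)) (asin (r' / a))) as (c & _ & _ & E); trivial.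
  - intros ? ? ? ? ? ?; exact I.
  - intros s _; apply is_derive_RInt_continuous, arcsine_density_continuous.
  - assert (0 < arcsine_density c); [|nra].
    apply Rdiv_lt_0_compat; [apply K0|apply sqrt_lt_R0, den_pos].
Qed.

End ArcsinePrimitive.

Lemma cubic_roots lam : lam < -2 ->
  let q1 := (- lam - sqrt (lam ^ 2 - 4)) / 2 in
  let q2 := (- lam + sqrt (lam ^ 2 - 4)) / 2 in
  0 < q1 < 1 /\ 1 < q2 /\ q1 * q2 = 1 /\ q1 + q2 = - lam.
Proof.
  intros Hl q1 q2.
  assert (D0 : 0 < lam ^ 2 - 4) by nra.
  pose proof (sqrt_lt_R0 _ D0) as S0.
  assert (E : sqrt (lam ^ 2 - 4) ^ 2 = lam ^ 2 - 4) by (apply pow2_sqrt; lra).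
  unfold q1, q2; set (d := sqrt (lam ^ 2 - 4)) in *.
  repeat split; nra.
Qed.

Lemma inner_radial_pair lam r1 r2 :
  0 < r1 < 1 -> 1 < r2 -> r1 * r2 = 1 -> r1 ^ 2 + r2 ^ 2 = - lam ->
  exists M Z, radial_pair lam (fun r => - r1 < r < r1) M Z /\ M 0 = 0 /\ Z 0 = 0 /\
    (forall r, - r1 < r <= r1 -> continuous_at M r /\ continuous_at Z r) /\
    (forall r r', - r1 <= r < r' -> r' <= r1 -> Z r < Z r').
Proof.
  intros H1 H2 E1 E2.
  assert (H12 : 0 < r1 < r2) by lra.
  assert (C2 : forall t, continuous (fun r : R => r ^ 2) t).
  { intros t; apply (ex_derive_continuous (fun r => r ^ 2)); auto_derive; trivial. }
  assert (C1 : forall t : R, continuous (fun _ : R => 1) t).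
  { intros t; apply continuous_const. }
  assert (EQ : forall r, quartic lam r = (r1 ^ 2 - r ^ 2) * (r2 ^ 2 - r ^ 2)).
  { intros r; unfold quartic.
    replace lam with (- (r1 ^ 2 + r2 ^ 2)) by lra.
    transitivity (r ^ 4 + - (r1 ^ 2 + r2 ^ 2) * r ^ 2 + (r1 * r2) ^ 2); [|ring].
    rewrite E1; ring. }
  exists (arcsine_primitive r1 r2 (fun r => r ^ 2)), (arcsine_primitive r1 r2 (fun _ => 1)).
  split; [|split; [|split; [|split]]].
  - intros r Hr; rewrite EQ; split; [apply Rmult_lt_0_compat; nra|].
    split; [now apply (arcsine_primitive_derive r1 r2 (fun r => r ^ 2))|].
    now apply (arcsine_primitive_derive r1 r2 (fun _ => 1)).
  - now apply arcsine_primitive_0.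
  - now apply arcsine_primitive_0.
  - intros r Hr; split; now apply arcsine_primitive_continuous.
  - intros r r' Hr Hr'; apply arcsine_primitive_increasing; trivial; intros; lra.
Qed.

(** * The cases of the parameter *)

Lemma riemann_X_ringpt (M Z : R -> R) q v :
  riemann_X (fun q => M (sqrt q)) (fun q => Z (sqrt q)) q v = ringpt M Z (sqrt q) v.
Proof. unfold riemann_X; apply vec_eq; rcoords; ring. Qed.

Lemma surf_riemann_X (M Z : R -> R) (U V : R -> Prop) p :
  (forall q, U q -> 0 < q /\ V (sqrt q)) -> (forall r, V r -> 0 < r /\ U (r ^ 2)) ->
  surf (riemann_X (fun q => M (sqrt q)) (fun q => Z (sqrt q))) (fun q v => U q) p <->
  exists r v, V r /\ p = ringpt M Z r v.
Proof.
  intros HU HV; split.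
  - intros (q & v & Uq & ->); exists (sqrt q), v; split; [now apply HU|].
    apply riemann_X_ringpt.
  - intros (r & v & Vr & ->); exists (r ^ 2), v; destruct (HV r Vr) as (Hr & Ur).
    split; trivial; rewrite riemann_X_ringpt, sqrt_pow2; trivial; lra.
Qed.

Lemma horizontal_circle_ring (M Z : R -> R) r : 0 < r ->
  horizontal_circle (fun x => exists v, x = ringpt M Z r v).
Proof.
  intros Hr; exists (M r), 0, (Z r), r; split; trivial; intros x; unfold ringpt.
  split; intros (v & ->); exists v; now rewrite Rplus_0_l.
Qed.

Lemma sqrt_unbounded B : exists S, forall s, S < s -> B < sqrt s.
Proof.
  exists (B ^ 2); intros s Hs; apply Rle_lt_trans with (1 := Rle_abs B).
  rewrite <- (sqrt_pow2 (Rabs B)) by apply Rabs_pos; rewrite pow2_abs.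
  apply sqrt_lt_1_alt; split; trivial; apply pow2_ge_0.
Qed.

Lemma tends_at_infty_ext (f g : R -> R) l :
  (forall r, 0 < r -> f r = g r) -> tends_at_infty g l -> tends_at_infty f l.
Proof.
  intros E H eps Heps; destruct (H eps Heps) as (Q & HQ).
  exists (Rmax Q 0); intros r Hr; minmax.
  rewrite E by lra; apply HQ; lra.
Qed.

Lemma limit_leaf_riemann_X (M Z : R -> R) (U : R -> Prop) kappa zinf S0 p :
  tends_at_infty (fun r => M r + -1 * r) kappa -> tends_at_infty Z zinf ->
  (forall q, S0 < q -> U q) ->
  limit_leaf (riemann_X (fun q => M (sqrt q)) (fun q => Z (sqrt q))) (fun q v => U q) p
  <-> line_at kappa zinf p.
Proof.
  intros HM HZ HU.
  apply (limit_leaf_line M Z (-1) kappa zinf ltac:(now right) HM HZ _ _ sqrt S0).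
  - intros; apply riemann_X_ringpt.
  - apply sqrt_unbounded.
  - intros s Hs v eps Heps; destruct (dense_angles_full v eps Heps) as (v' & _ & H).
    exists v'; split; trivial; now apply HU.
Qed.

Lemma riemann_X_complete lam : -2 < lam ->
  let D q (v : R) := 0 < q in
  exists (m z : R -> R) (z0 : R),
    riemann_primitives lam (fun q => 0 < q) m z /\
    (forall p, full_surf (riemann_X m z) D p -> 0 < x3 p <= z0) /\
    (exists p, x3 p = 0 /\ conelike_point (full_surf (riemann_X m z) D) p) /\
    (exists L, line_orthogonal_to_Pi L /\
       (forall p, full_surf (riemann_X m z) D p /\ x3 p = z0 <-> L p)).
Proof.
  intros Hl D.
  destruct (complete_radial_pair lam Hl) as (M & Z & cm & cz & H & M0 & Z0 & HI).
  assert (Cv : convex (fun _ => True)) by (intros ? ? ? ? ? ?; exact I).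
  assert (Zi : forall r r', r < r' -> Z r < Z r').
  { intros r r' L; now apply (radial_pair_increasing lam (fun _ => True) M). }
  assert (Zb : forall r, 0 < r -> 0 < Z r < cz).
  { assert (Zp : forall r, 0 < r -> 0 < Z r) by (intros r Hr; rewrite <- Z0; now apply Zi).
    intros r Hr; split; [now apply Zp|].
    rewrite (proj2 (HI r Hr)); unfold Z_inv.
    specialize (Zp (/ r) ltac:(now apply Rinv_0_lt_compat)); lra. }
  pose proof (radial_pair_near_0 lam _ M Z H I M0 Z0) as N0.
  destruct (inv_tends_at_infty lam cm cz M Z N0) as (TM & TZ).
  apply (tends_at_infty_ext (fun r => M r + -1 * r)) in TM.
  2:{ intros r Hr; now rewrite (proj1 (HI r Hr)) at 1. }
  apply (tends_at_infty_ext Z) in TZ.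
  2:{ intros r Hr; apply (HI r Hr). }
  set (m := fun q => M (sqrt q)); set (z := fun q => Z (sqrt q)).
  assert (HS : forall p, full_surf (riemann_X m z) D p <->
    (exists r v, 0 < r /\ p = ringpt M Z r v) \/ line_at cm cz p).
  { intros p; unfold full_surf, D, m, z.
    rewrite (surf_riemann_X M Z (fun q => 0 < q) (fun r => 0 < r)),
      (limit_leaf_riemann_X M Z (fun q => 0 < q) cm cz 0); trivial; [reflexivity| |].
    - intros q Hq; split; trivial; now apply sqrt_lt_R0.
    - intros r Hr; split; trivial; now apply pow_lt. }
  exists m, z, cz; split; [|split; [|split]].
  - apply (riemann_primitives_of_radial lam (fun _ => True)); trivial.
    intros q Hq; now split.
  - intros p Sp; apply HS in Sp; destruct Sp as [(r & v & Hr & ->)|(_ & ->)].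
    + rewrite x3_ringpt; specialize (Zb r Hr); lra.
    + specialize (Zb 1 Rlt_0_1); lra.
  - exists (0, 0, 0); split; [reflexivity|].
    apply (conelike_ring M Z (fun _ => True) _ cz).
    + apply dense_angles_full.
    + intros p Sp; apply HS in Sp; destruct Sp as [(r & v & Hr & ->)|(_ & ->)];
        [left; now exists r, v|now right].
    + intros r v Hr _; apply HS; left; now exists r, v.
    + exact Zb.
    + intros r r' Hr; now apply Zi.
    + exact N0.
  - exists (line_at cm cz); split; [apply line_at_orthogonal|].
    intros p; rewrite HS; split.
    + intros ([(r & v & Hr & ->)|Lp] & E); trivial.
      exfalso; rewrite x3_ringpt in E; specialize (Zb r Hr); lra.
    + intros Lp; split; [now right|apply Lp].
Qed.

Lemma three_causal_characters_subcritical lam m z : lam ^ 2 < 4 ->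
  riemann_primitives lam (fun q => 0 < q) m z ->
  three_causal_characters (riemann_X m z) (fun q v => 0 < q).
Proof.
  intros Hl Hp; assert (H1 : -2 < lam < 2) by (split; nra).
  destruct (Hp 1 Rlt_0_1) as (Dm & Dz).
  assert (C1 : 0 < cubic lam 1) by (unfold cubic; lra).
  set (s := sqrt (1 ^ 2 + lam * 1 + 1)).
  assert (s0 : 0 < s) by (apply sqrt_lt_R0; lra).
  assert (s1 : s < 2).
  { rewrite <- (sqrt_pow2 2) by lra; apply sqrt_lt_1_alt; lra. }
  split; [|split].
  - exists 1, 0; split; [lra|].
    apply (riemann_X_spacelike lam m z 1 0); trivial; [lra|].
    fold s; rewrite cos_0; lra.
  - exists 1, PI; split; [lra|].
    apply (riemann_X_timelike lam m z 1 PI); trivial; [lra|].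
    fold s; rewrite cos_PI; lra.
  - exists 1, (acos (1 - s)); split; [lra|].
    apply (riemann_X_lightlike lam m z 1 _); trivial; [lra|].
    fold s; rewrite cos_acos; lra.
Qed.

Lemma spacelike_supercritical lam m z q v : 2 < lam ->
  riemann_primitives lam (fun q => 0 < q) m z -> 0 < q ->
  spacelike_at (riemann_X m z) q v.
Proof.
  intros Hl Hp Hq; destruct (Hp q Hq) as (Dm & Dz).
  assert (H1 : 0 < q ^ 2 + lam * q + 1) by nra.
  apply (riemann_X_spacelike lam m z q v); trivial.
  - replace (cubic lam q) with (q * (q ^ 2 + lam * q + 1)) by (unfold cubic; ring).
    now apply Rmult_lt_0_compat.
  - assert (1 + q < sqrt (q ^ 2 + lam * q + 1)).
    { rewrite <- (sqrt_pow2 (1 + q)) by lra; apply sqrt_lt_1_alt; nra. }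
    pose proof (COS_bound v); nra.
Qed.

Section Case3.

Variable lam : R.
Hypothesis Hl : lam < -2.
Let q1 := (- lam - sqrt (lam ^ 2 - 4)) / 2.
Let q2 := (- lam + sqrt (lam ^ 2 - 4)) / 2.
Let r1 := sqrt q1.
Let r2 := sqrt q2.

Let roots : 0 < q1 < 1 /\ 1 < q2 /\ q1 * q2 = 1 /\ q1 + q2 = - lam.
Proof. exact (cubic_roots lam Hl). Qed.

Lemma cubic_factor q : cubic lam q = q * ((q - q1) * (q - q2)).
Proof.
  destruct roots as (_ & _ & E1 & E2); unfold cubic.
  replace lam with (- (q1 + q2)) by lra.
  transitivity (q * (q ^ 2 - (q1 + q2) * q + q1 * q2)); [rewrite E1|]; ring.
Qed.

Lemma cubic_pos_iff q : 0 < q -> (0 < cubic lam q <-> 0 < q < q1 \/ q2 < q).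
Proof.
  intros Hq; destruct roots as (B1 & B2 & _ & _); rewrite cubic_factor; split.
  - intros H; rewrite <- (Rmult_0_r q) in H; apply Rmult_lt_reg_l in H; trivial.
    destruct (Rlt_dec q q1); [left; lra|].
    destruct (Rlt_dec q2 q); [now right|]; exfalso; nra.
  - intros [H|H]; apply Rmult_lt_0_compat; trivial; nra.
Qed.

Let radii : 0 < r1 < 1 /\ 1 < r2 /\ r1 * r2 = 1 /\ r1 ^ 2 = q1 /\ r2 ^ 2 = q2.
Proof.
  destruct roots as (B1 & B2 & E1 & E2); unfold r1, r2.
  repeat split.
  - apply sqrt_lt_R0; lra.
  - rewrite <- sqrt_1; apply sqrt_lt_1_alt; lra.
  - rewrite <- sqrt_1 at 1; apply sqrt_lt_1_alt; lra.
  - rewrite <- sqrt_mult, E1 by lra; apply sqrt_1.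
  - apply pow2_sqrt; lra.
  - apply pow2_sqrt; lra.
Qed.

Lemma riemann_X_case3a :
  let D q (v : R) := 0 < q < q1 in
  exists (m z : R -> R) (z0 : R),
    riemann_primitives lam (fun q => 0 < q < q1) m z /\
    (forall q v, D q v -> timelike_at (riemann_X m z) q v) /\
    (forall p, surf (riemann_X m z) D p -> 0 < x3 p < z0) /\
    (exists p, x3 p = 0 /\
       leaves_cvg (surf (riemann_X m z) D) (fun p' => p' = p) 0) /\
    (exists C, horizontal_circle C /\ at_height z0 C /\
       leaves_cvg (surf (riemann_X m z) D) C z0).
Proof.
  intros D; destruct roots as (B1 & B2 & _ & E).
  destruct radii as (R1 & R2 & R12 & Er1 & Er2).
  destruct (inner_radial_pair lam r1 r2) as (M & Z & H & M0 & Z0 & HC & Zi);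
    trivial; [lra|].
  pose proof (radial_pair_near_0 lam _ M Z H ltac:(lra) M0 Z0) as N0.
  set (m := fun q => M (sqrt q)); set (z := fun q => Z (sqrt q)).
  assert (HU : forall q, 0 < q < q1 -> 0 < q /\ 0 < sqrt q < r1).
  { intros q Hq; split; [lra|]; split; [apply sqrt_lt_R0; lra|].
    apply sqrt_lt_1_alt; lra. }
  assert (HS : forall p, surf (riemann_X m z) D p <->
    exists r v, 0 < r < r1 /\ p = ringpt M Z r v).
  { intros p; unfold m, z, D.
    apply (surf_riemann_X M Z (fun q => 0 < q < q1) (fun r => 0 < r < r1)); trivial.
    intros r Hr; split; [lra|]; split; [apply pow_lt; lra|]; nra. }
  assert (HP : riemann_primitives lam (fun q => 0 < q < q1) m z).
  { apply (riemann_primitives_of_radial lam (fun r => - r1 < r < r1)); trivial.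
    intros q Hq; destruct (HU q Hq); split; trivial; lra. }
  assert (Zb : forall r, 0 < r < r1 -> 0 < Z r < Z r1).
  { intros r Hr; split; [rewrite <- Z0|]; apply Zi; lra. }
  exists m, z, (Z r1); split; [exact HP|]; split; [|split; [|split]].
  - intros q v Hq; unfold D in Hq; destruct (HP q Hq) as (Dm & Dz).
    assert (Cq : 0 < cubic lam q) by (apply cubic_pos_iff; [lra|now left]).
    apply (riemann_X_timelike lam m z q v); trivial; [lra|].
    assert (0 < q ^ 2 + lam * q + 1).
    { apply (Rmult_lt_reg_l q); [lra|]; unfold cubic in Cq; lra. }
    assert (sqrt (q ^ 2 + lam * q + 1) < 1 - q).
    { rewrite <- (sqrt_pow2 (1 - q)) by lra; apply sqrt_lt_1_alt; nra. }
    pose proof (sqrt_pos (q ^ 2 + lam * q + 1)); pose proof (COS_bound v); nra.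
  - intros p Sp; apply HS in Sp; destruct Sp as (r & v & Hr & ->).
    rewrite x3_ringpt; now apply Zb.
  - exists (0, 0, 0); split; [reflexivity|].
    apply (leaves_cvg_point M Z (fun r => 0 < r < r1) (fun _ _ => True) _ 1).
    + intros; lra.
    + intros; lra.
    + exists (r1 / 2); lra.
    + intros r Hr; now apply Zb.
    + intros r r' Hr Hr' L; apply Zi; lra.
    + intros; now exists 0.
    + lra.
    + intros p Sp _; apply HS in Sp; destruct Sp as (r & v & Hr & ->); now exists r.
    + intros r p Hr; rewrite HS; split.
      * intros ((r' & v & Hr' & ->) & Ez); exists v; split; trivial.
        rewrite x3_ringpt in Ez.
        destruct (Rtotal_order r r') as [L|[-> |L]]; trivial; exfalso;
          [pose proof (Zi r r')|pose proof (Zi r' r)]; lra.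
      * intros (v & _ & ->); split; [now exists r, v|apply x3_ringpt].
    + exact N0.
  - exists (fun p => exists v, p = ringpt M Z r1 v); split; [|split].
    + apply horizontal_circle_ring; lra.
    + intros p (v & ->); apply x3_ringpt.
    + apply leaves_cvg_circle; trivial; try (apply HC; lra); [lra|].
      intros r r' Hr Hr'; apply Zi; lra.
Qed.

Lemma riemann_X_case3b :
  let D q (v : R) := q2 <= q in
  exists (m z : R -> R) (z0 : R),
    riemann_primitives lam (fun q => q2 < q) m z /\
    filterlim m (at_right q2) (locally (m q2)) /\
    filterlim z (at_right q2) (locally (z q2)) /\
    three_causal_characters (riemann_X m z) (fun q v => q2 < q) /\
    (forall p, full_surf (riemann_X m z) D p -> 0 <= x3 p <= z0) /\
    (exists C, horizontal_circle C /\
       (forall p, full_surf (riemann_X m z) D p /\ x3 p = 0 <-> C p) /\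
       (forall p, C p -> boundary_point (full_surf (riemann_X m z) D) p)) /\
    (exists L, line_orthogonal_to_Pi L /\
       (forall p, full_surf (riemann_X m z) D p /\ x3 p = z0 <-> L p)).
Proof.
  intros D; destruct roots as (B1 & B2 & _ & E).
  destruct radii as (R1 & R2 & R12 & Er1 & Er2).
  destruct (inner_radial_pair lam r1 r2) as (M & Z & H & M0 & Z0 & HC & Zi);
    trivial; [lra|].
  pose proof (radial_pair_near_0 lam _ M Z H ltac:(lra) M0 Z0) as N0.
  set (z0 := Z r1).
  assert (z0p : 0 < z0) by (unfold z0; rewrite <- Z0; apply Zi; lra).
  pose proof (radial_pair_inv lam _ M Z 0 z0 H) as HI.
  destruct (inv_tends_at_infty lam 0 z0 M Z N0) as (TM & TZ).
  set (M' := M_inv lam 0 M) in *; set (Z' := Z_inv z0 Z) in *.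
  assert (Er : / r2 = r1).
  { apply (Rmult_eq_reg_r r2); [|lra]; rewrite R12; field; lra. }
  assert (inv_lt : forall r r', 0 < r < r' -> / r' < / r).
  { intros r r' L; apply Rinv_lt_contravar; [apply Rmult_lt_0_compat|]; lra. }
  assert (inv_r : forall r, r2 <= r -> 0 < / r <= r1).
  { intros r Hr; split; [apply Rinv_0_lt_compat; lra|].
    rewrite <- Er; destruct Hr as [L|<-]; [left; apply inv_lt|right]; lra. }
  assert (HC' : forall r, r2 <= r -> continuous_at M' r /\ continuous_at Z' r).
  { intros r Hr; destruct (HC (/ r)) as (CM & CZ); [specialize (inv_r r Hr); lra|].
    assert (CI : continuous Rinv r).
    { apply (ex_derive_continuous Rinv); auto_derive; lra. }
    apply continuous_at_iff in CM; apply continuous_at_iff in CZ.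
    split; apply continuous_at_iff.
    - apply (continuous_plus (fun r => sqrt (quartic lam r) / r - M (/ r)) (fun _ => 0));
        [|apply continuous_const].
      apply (continuous_minus (fun r => sqrt (quartic lam r) / r) (fun r => M (/ r))).
      + apply (continuous_mult (fun r => sqrt (quartic lam r)) Rinv); trivial.
        apply continuous_sqrt_comp, (ex_derive_continuous (quartic lam)).
        unfold quartic; auto_derive; trivial.
      + now apply (continuous_comp Rinv M).
    - apply (continuous_minus (fun _ => z0) (fun r => Z (/ r))).
      + apply continuous_const.
      + now apply (continuous_comp Rinv Z). }
  assert (Zi' : forall r r', r2 <= r < r' -> Z' r < Z' r').
  { intros r r' Hr; unfold Z', Z_inv; specialize (inv_lt r r' ltac:(lra)).
    pose proof (inv_r r ltac:(lra)); pose proof (inv_r r' ltac:(lra)).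
    assert (Z (/ r') < Z (/ r)) by (apply Zi; lra); lra. }
  assert (Zr2 : Z' r2 = 0) by (unfold Z', Z_inv; rewrite Er; unfold z0; ring).
  assert (Zb : forall r, r2 <= r -> 0 <= Z' r < z0).
  { intros r Hr; split.
    - rewrite <- Zr2; destruct Hr as [L|<-]; [left; apply Zi'; lra|now right].
    - unfold Z', Z_inv; pose proof (inv_r r Hr).
      assert (Z 0 < Z (/ r)) by (apply Zi; lra); lra. }
  set (m := fun q => M' (sqrt q)); set (z := fun q => Z' (sqrt q)).
  assert (HS : forall p, full_surf (riemann_X m z) D p <->
    (exists r v, r2 <= r /\ p = ringpt M' Z' r v) \/ line_at 0 z0 p).
  { intros p; unfold full_surf, D, m, z.
    rewrite (surf_riemann_X M' Z' (fun q => q2 <= q) (fun r => r2 <= r)),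
      (limit_leaf_riemann_X M' Z' (fun q => q2 <= q) 0 z0 q2); trivial; [reflexivity| | |].
    - intros q; lra.
    - intros q Hq; split; [lra|]; now apply sqrt_le_1_alt.
    - intros r Hr; split; [lra|]; rewrite <- Er2; nra. }
  assert (HP : riemann_primitives lam (fun q => q2 < q) m z).
  { apply (riemann_primitives_of_radial lam (fun r => 0 < r /\ - r1 < / r < r1)); trivial.
    intros q Hq; assert (r2 < sqrt q) by (apply sqrt_lt_1_alt; lra).
    pose proof (inv_r (sqrt q) ltac:(lra)).
    specialize (inv_lt r2 (sqrt q) ltac:(lra)); lra. }
  assert (Clim : forall f : R -> R, continuous_at f r2 ->
    filterlim (fun q => f (sqrt q)) (at_right q2) (locally (f (sqrt q2)))).
  { intros f Cf P HPf; apply continuous_at_iff in Cf.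
    assert (C : continuous (fun q => f (sqrt q)) q2).
    { apply (continuous_comp sqrt f); [apply continuous_sqrt|exact Cf]. }
    generalize (C P HPf); unfold filtermap, at_right, within.
    apply filter_imp; auto. }
  exists m, z, z0; split; [exact HP|]; split; [|split; [|split; [|split; [|split]]]].
  - apply Clim, HC'; lra.
  - apply Clim, HC'; lra.
  - set (q := q2 + 1).
    assert (Hq : q2 < q) by (unfold q; lra).
    destruct (HP q Hq) as (Dm & Dz).
    assert (Cq : 0 < cubic lam q) by (apply cubic_pos_iff; [lra|now right]).
    assert (Q0 : 0 < q ^ 2 + lam * q + 1).
    { apply (Rmult_lt_reg_l q); [lra|]; unfold cubic in Cq; lra. }
    set (s := sqrt (q ^ 2 + lam * q + 1)).
    assert (s0 : 0 < s) by now apply sqrt_lt_R0.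
    assert (s1 : s < q).
    { rewrite <- (sqrt_pow2 q) by lra; apply sqrt_lt_1_alt; nra. }
    split; [|split].
    + exists q, 0; split; trivial.
      apply (riemann_X_spacelike lam m z q 0); trivial; [lra|].
      fold s; rewrite cos_0; lra.
    + exists q, (acos (- s / q)); split; trivial.
      apply (riemann_X_timelike lam m z q _); trivial; [lra|].
      fold s; rewrite cos_acos; [|split; [apply Rle_div_r|apply Rle_div_l]; lra].
      replace (q * (- s / q)) with (- s) by (field; lra); lra.
    + exists q, (acos ((1 - s) / q)); split; trivial.
      apply (riemann_X_lightlike lam m z q _); trivial; [lra|].
      fold s; rewrite cos_acos; [field; lra|].
      split; [apply Rle_div_r|apply Rle_div_l]; lra.
  - intros p Sp; apply HS in Sp; destruct Sp as [(r & v & Hr & ->)|(_ & ->)].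
    + rewrite x3_ringpt; specialize (Zb r Hr); lra.
    + lra.
  - exists (fun p => exists v, p = ringpt M' Z' r2 v); split; [|split].
    + apply horizontal_circle_ring; lra.
    + intros p; rewrite HS; split.
      * intros ([(r & v & Hr & ->)|(_ & Ez)] & E0); [|lra].
        rewrite x3_ringpt in E0; destruct Hr as [L|<-]; [|now exists v].
        exfalso; specialize (Zi' r2 r); lra.
      * intros (v & ->); split; [left; exists r2, v; split; trivial; lra|].
        now rewrite x3_ringpt.
    + intros p (v & ->).
      apply (boundary_point_ring M' Z' _ r2 v 1 z0); trivial; try lra.
      * intros r w Hr _; apply HS; left; exists r, w; split; trivial; lra.
      * intros p Sp Hp; apply HS in Sp; destruct Sp as [Sp|(_ & Ez)]; trivial; lra.
  - exists (line_at 0 z0); split; [apply line_at_orthogonal|].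
    intros p; rewrite HS; split.
    + intros ([(r & v & Hr & ->)|Lp] & E0); trivial.
      exfalso; rewrite x3_ringpt in E0; specialize (Zb r Hr); lra.
    + intros Lp; split; [now right|apply Lp].
Qed.

End Case3.

Section CausalRing.

Variables (Y : R -> R -> vec) (M Z : R -> R) (r v A H : R).
Hypothesis HY : forall r v, Y r v = ringpt M Z r v.
Hypothesis Hr : 0 < r.
Hypothesis HM : is_derive M r A.
Hypothesis HZ : is_derive Z r H.

Let d1_Y : d1 Y r v = (A + 1 * cos v, 0 + 1 * sin v, H).
Proof.
  unfold d1; rewrite (dvec_ext_loc _ (fun u => fcomb std1 std2 std3
    (M u + u * cos v) (u * sin v) (Z u))).
  2:{ apply filter_forall; intros u; rewrite HY, fcomb_std; reflexivity. }
  rewrite (dvec_fcomb std1 std2 std3 _ _ _ r (A + 1 * cos v) (0 + 1 * sin v) H);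
    [apply fcomb_std| | |exact HZ].
  - auto_derive; [now exists A|derive_values; ring].
  - auto_derive; trivial; ring.
Qed.

Let d2_Y : d2 Y r v = (- r * sin v, r * cos v, 0).
Proof.
  unfold d2; rewrite (dvec_ext_loc _ (fun u => fcomb std1 std2 std3
    (M r + r * cos u) (r * sin u) (Z r))).
  2:{ apply filter_forall; intros u; rewrite HY, fcomb_std; reflexivity. }
  rewrite (dvec_fcomb std1 std2 std3 _ _ _ v (- r * sin v) (r * cos v) 0);
    [apply fcomb_std| | |]; auto_derive; trivial; ring.
Qed.

Variables (k : R).
Hypothesis Hk : 0 < k.
Hypothesis EH : H = 1 / k.

Let EP : A * cos v + 0 * sin v + 1 = (k * (A * cos v + 1)) / k.
Proof. field; lra. Qed.

Lemma ring_immersed : immersed_at Y r v.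
Proof.
  apply (immersed_intro _ _ _ _ _ _ _ _ d1_Y d2_Y Hr).
  rewrite EH; apply Rgt_not_eq, Rdiv_lt_0_compat; lra.
Qed.

Lemma ring_spacelike : 1 < k * (A * cos v + 1) -> spacelike_at Y r v.
Proof.
  intros L; apply (spacelike_intro _ _ _ _ _ _ _ _ d1_Y d2_Y Hr).
  rewrite EP, EH; unfold Rdiv; rewrite !Rpow_mult_distr.
  apply Rmult_lt_compat_r; [apply pow_lt, Rinv_0_lt_compat; lra|nra].
Qed.

Lemma ring_timelike : -1 < k * (A * cos v + 1) < 1 -> timelike_at Y r v.
Proof.
  intros L; apply (timelike_intro _ _ _ _ _ _ _ _ d1_Y d2_Y Hr).
  rewrite EP, EH; unfold Rdiv; rewrite !Rpow_mult_distr.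
  apply Rmult_lt_compat_r; [apply pow_lt, Rinv_0_lt_compat; lra|nra].
Qed.

Lemma ring_lightlike : k * (A * cos v + 1) = 1 -> lightlike_at Y r v.
Proof.
  intros L; apply (lightlike_intro _ _ _ _ _ _ _ _ d1_Y d2_Y Hr).
  - rewrite EH; apply Rgt_not_eq, Rdiv_lt_0_compat; lra.
  - now rewrite EP, EH, L.
Qed.

End CausalRing.

Lemma refl1_riemann_X (M Z : R -> R) r v : 0 < r ->
  refl1 (riemann_X (fun q => M (sqrt q)) (fun q => Z (sqrt q)) (r ^ 2) (PI - v))
  = ringpt (fun r => - M r) Z r v.
Proof.
  intros Hr; rewrite riemann_X_ringpt, sqrt_pow2 by lra.
  unfold refl1; apply vec_eq; rcoords; trivial;
    rewrite ?cos_minus, ?sin_minus, cos_PI, sin_PI; ring.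
Qed.

Lemma cos_lt_1 v : 0 < v < 2 * PI -> cos v < 1.
Proof.
  intros Hv; replace v with (2 * (v / 2)) by field.
  rewrite cos_2a_sin; assert (0 < sin (v / 2)) by (apply sin_gt_0; lra); nra.
Qed.

Definition M_pos2 (r : R) : R := - r + atan r.

Lemma X_pos2_ringpt r v : X_pos2 r v = ringpt M_pos2 atan r v.
Proof. unfold X_pos2, M_pos2; apply vec_eq; rcoords; ring. Qed.

Lemma is_derive_atan' r : is_derive atan r (1 / (1 + r ^ 2)).
Proof.
  apply is_derive_Reals; replace (1 / (1 + r ^ 2)) with (/ (1 + r ^ 2)).
  - apply derivable_pt_lim_atan.
  - unfold Rdiv; ring.
Qed.

Lemma is_derive_M_pos2 r : is_derive M_pos2 r (- 1 + 1 / (1 + r ^ 2)).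
Proof.
  pose proof (is_derive_atan' r) as Da; unfold M_pos2.
  auto_derive; [now eexists; exact Da|derive_values].
  change (r * (r * 1)) with (r ^ 2); unfold Rdiv; ring.
Qed.

Lemma atan_tends : tends_at_infty atan (PI / 2).
Proof.
  intros eps Heps; pose proof PI_RGT_0.
  destruct (min_pos eps (PI / 4)) as (e & e0 & e1 & e2); [lra|lra|].
  exists (tan (PI / 2 - e)); intros r Hr; apply atan_increasing in Hr.
  rewrite atan_tan in Hr by lra; pose proof (atan_bound r).
  apply Rabs_def1; lra.
Qed.

Lemma atan_pos r : 0 < r -> 0 < atan r < PI / 2.
Proof.
  intros Hr; split; [rewrite <- atan_0; now apply atan_increasing|].
  pose proof (atan_bound r); lra.
Qed.

Lemma X_pos2_primitives :
  exists m z, riemann_primitives 2 (fun q => 0 < q) m z /\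
    forall r v, 0 < r -> X_pos2 r v = refl1 (riemann_X m z (r ^ 2) (PI - v)).
Proof.
  exists (fun q => (fun r => r - atan r) (sqrt q)), (fun q => atan (sqrt q)); split.
  - apply (riemann_primitives_of_radial 2 (fun r => 0 < r) _ (fun r => r - atan r) atan).
    + intros r Hr.
      assert (E : quartic 2 r = (1 + r ^ 2) ^ 2) by (unfold quartic; ring).
      assert (0 < 1 + r ^ 2) by (pose proof (pow2_ge_0 r); lra).
      rewrite E, sqrt_pow2 by lra; pose proof (is_derive_atan' r) as Da.
      split; [now apply pow_lt|]; split; trivial.
      auto_derive; [now eexists; exact Da|derive_values; field; lra].
    + intros q Hq; split; trivial; now apply sqrt_lt_R0.
  - intros r v Hr; rewrite (refl1_riemann_X (fun r => r - atan r)) by trivial.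
    rewrite X_pos2_ringpt; unfold ringpt, M_pos2; apply vec_eq; rcoords; ring.
Qed.

Lemma X_pos2_properties :
  let D r v := 0 < r /\ 0 < v < 2 * PI in
  (forall r v, D r v -> spacelike_at X_pos2 r v) /\
  (forall r, 0 < r -> exists C p, horizontal_circle C /\ C p /\
     forall x, (exists v, D r v /\ x = X_pos2 r v) <-> C x /\ x <> p) /\
  (forall p, full_surf X_pos2 D p -> 0 < x3 p <= PI / 2) /\
  (exists p, x3 p = 0 /\ conelike_point (full_surf X_pos2 D) p) /\
  (exists L, line_orthogonal_to_Pi L /\ at_height (PI / 2) L /\
     leaves_cvg_loc (full_surf X_pos2 D) L (PI / 2) /\
     (forall p, L p -> full_surf X_pos2 D p)) /\
  asymptotic_to_plane (full_surf X_pos2 D) (PI / 2) /\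
  extends_to_lightlike_line X_pos2 (fun r => 0 < r) D 0.
Proof.
  intros D; pose proof PI_RGT_0 as PI0.
  assert (TM : tends_at_infty (fun r => M_pos2 r + 1 * r) (PI / 2)).
  { apply (tends_at_infty_ext _ atan); [|apply atan_tends].
    intros; unfold M_pos2; ring. }
  assert (DA : forall s, 0 < s -> dense_angles (D s)).
  { intros s Hs v eps Heps; destruct (dense_angles_punctured v eps Heps) as (v' & B & H).
    exists v'; split; trivial; now split. }
  assert (HL : forall p, limit_leaf X_pos2 D p <-> line_at (PI / 2) (PI / 2) p).
  { apply (limit_leaf_line M_pos2 atan 1 (PI / 2) (PI / 2) ltac:(now left) TM
      atan_tends _ _ (fun r => r) 0); trivial.
    - intros; apply X_pos2_ringpt.
    - intros B; now exists B. }
  assert (HS : forall p, full_surf X_pos2 D p <->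
    (exists r v, 0 < r /\ 0 < v < 2 * PI /\ p = ringpt M_pos2 atan r v) \/
    line_at (PI / 2) (PI / 2) p).
  { intros p; unfold full_surf; rewrite HL; unfold surf, D.
    split; (intros [(r & v & H)|H]; [left; exists r, v|now right]).
    - rewrite <- X_pos2_ringpt; tauto.
    - rewrite X_pos2_ringpt; tauto. }
  assert (HB : forall r p, 0 < r ->
    (full_surf X_pos2 D p /\ x3 p = atan r <-> ring_leaf M_pos2 atan D r p)).
  { intros r p Hr; rewrite HS; pose proof (atan_pos r Hr); split.
    - intros ([(r' & v & Hr' & Hv & ->)|(_ & E)] & E3); [|lra].
      rewrite x3_ringpt in E3; exists v.
      assert (r' = r) as <-; [|now split].
      destruct (Rtotal_order r r') as [L|[|L]]; [|lra|];
        apply atan_increasing in L; lra.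
    - intros (v & (_ & Hv) & ->); split; [|apply x3_ringpt].
      left; now exists r, v. }
  split; [|split; [|split; [|split; [|split; [|split]]]]].
  - intros r v (Hr & Hv); pose proof (cos_lt_1 v Hv) as Cv.
    apply (ring_spacelike X_pos2 M_pos2 atan r v _ _ X_pos2_ringpt Hr
      (is_derive_M_pos2 r) (is_derive_atan' r) (1 + r ^ 2)); trivial; [nra|].
    replace ((1 + r ^ 2) * ((-1 + 1 / (1 + r ^ 2)) * cos v + 1))
      with (1 + r ^ 2 * (1 - cos v)) by (field; nra).
    assert (0 < r ^ 2) by now apply pow_lt.
    assert (0 < r ^ 2 * (1 - cos v)) by (apply Rmult_lt_0_compat; lra); lra.
  - intros r Hr; exists (fun x => exists v, x = ringpt M_pos2 atan r v),
      (ringpt M_pos2 atan r 0).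
    split; [now apply horizontal_circle_ring|]; split; [now exists 0|].
    intros x; split.
    + intros (v & (_ & Hv) & ->); rewrite X_pos2_ringpt; split; [now exists v|].
      intros E; apply (f_equal x1) in E; revert E; rcoords; rewrite cos_0; intros E.
      pose proof (cos_lt_1 v Hv); nra.
    + intros ((v & ->) & N).
      destruct (angle_reduce v) as (t & Ht & Ec & Es).
      assert (t <> 0).
      { intros ->; apply N; unfold ringpt; now rewrite Ec, Es. }
      destruct (Rlt_dec 0 t).
      * exists t; split; [split; trivial; lra|].
        rewrite X_pos2_ringpt; unfold ringpt; now rewrite Ec, Es.
      * exists (t + 2 * PI); split; [split; trivial; lra|].
        rewrite X_pos2_ringpt; unfold ringpt.
        rewrite cos_plus, sin_plus, cos_2PI, sin_2PI, Ec, Es.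
        apply vec_eq; coords; ring.
  - intros p Sp; apply HS in Sp; destruct Sp as [(r & v & Hr & _ & ->)|(_ & ->)];
      [rewrite x3_ringpt; pose proof (atan_pos r Hr)|]; lra.
  - exists (0, 0, 0); split; [reflexivity|].
    apply (conelike_ring M_pos2 atan (fun v => 0 < v < 2 * PI) _ (PI / 2)).
    + apply dense_angles_punctured.
    + intros p Sp; apply HS in Sp; destruct Sp as [Sp|(_ & E)]; [now left|now right].
    + intros r v Hr Hv; apply HS; left; now exists r, v.
    + apply atan_pos.
    + intros r r' Hr; apply atan_increasing; lra.
    + intros eps Heps.
      destruct (derive_at_0_bound M_pos2 _ eps (is_derive_M_pos2 0)) as (d1 & d10 & H1);
        [unfold M_pos2; rewrite atan_0; ring|trivial|].
      destruct (derive_at_0_bound atan _ eps (is_derive_atan' 0) atan_0 Heps)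
        as (d2 & d20 & H2).
      exists (Rmin d1 d2); split; [now apply Rmin_glb_lt|]; intros r Hr.
      minmax.
      specialize (H1 r ltac:(lra)); specialize (H2 r ltac:(lra)).
      replace (M_pos2 r - (-1 + 1 / (1 + 0 ^ 2)) * r) with (M_pos2 r) in H1 by field.
      replace (atan r - 1 / (1 + 0 ^ 2) * r) with (atan r - r) in H2 by field.
      now split.
  - exists (line_at (PI / 2) (PI / 2)); split; [apply line_at_orthogonal|].
    split; [now intros p (_ & ->)|]; split.
    + apply (leaves_cvg_full_line M_pos2 atan 1 (PI / 2) (PI / 2) ltac:(now left) TM
        atan_tends (fun r => 0 < r) D _ 1); trivial; try lra.
      * intros; lra.
      * exists 1; lra.
      * intros r r' _; apply atan_increasing.
      * intros r Hr; now apply atan_pos.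
      * intros p Sp Bp; apply HS in Sp; destruct Sp as [(r & v & Hr & _ & ->)|(_ & E)].
        -- now exists r.
        -- exfalso; rewrite E, Rminus_diag, Rabs_R0 in Bp; lra.
    + intros p Lp; apply HS; now right.
  - split.
    + intros rho; exists (PI / 2, Rabs rho + 1, PI / 2); split.
      * apply HS; right; now split.
      * destruct (enorm_coords_le (PI / 2, Rabs rho + 1, PI / 2)) as (_ & B & _).
        revert B; coords; intros B; pose proof (Rle_abs rho); pose proof (Rabs_pos rho).
        rewrite Rabs_pos_eq in B; lra.
    + intros eps Heps; destruct (atan_tends eps Heps) as (Q & HQ).
      exists (3 * Rabs Q + PI); intros p Sp Np; apply HS in Sp.
      destruct Sp as [(r & v & Hr & _ & ->)|(_ & ->)].
      2:{ rewrite Rminus_diag, Rabs_R0; lra. }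
      rewrite x3_ringpt; apply HQ.
      pose proof (enorm_le_coords (ringpt M_pos2 atan r v)) as B.
      revert B; rcoords; change (M_pos2 r) with (- r + atan r); intros B.
      pose proof (atan_pos r Hr).
      pose proof (COS_bound v); pose proof (SIN_bound v).
      assert (Rabs (- r + atan r + r * cos v) <= 2 * r + PI / 2).
      { apply Rabs_le; split; nra. }
      assert (Rabs (r * sin v) <= r) by (apply Rabs_le; split; nra).
      rewrite (Rabs_pos_eq (atan r)) in B by lra.
      pose proof (Rle_abs Q); lra.
  - exists (0, 0, 0), (1, 0, 1); split; [intros E; injection E; lra|].
    split; [unfold lprod; coords; ring|].
    intros r Hr; rewrite X_pos2_ringpt; split; [|split; [|split]].
    + intros (r' & v & (Hr' & Hv) & E); rewrite X_pos2_ringpt in E.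
      pose proof (f_equal x3 E) as E3; apply (f_equal x1) in E.
      revert E E3; rcoords; unfold M_pos2; intros E E3.
      assert (r = r') as <-.
      { destruct (Rtotal_order r r') as [L|[|L]]; trivial; exfalso;
          apply atan_increasing in L; lra. }
      rewrite cos_0 in E; pose proof (cos_lt_1 v Hv); nra.
    + intros eps Heps; exists (Rmin 1 (eps / 2)).
      assert (0 < Rmin 1 (eps / 2)) by (apply Rmin_glb_lt; lra).
      minmax.
      pose proof PI2_1.
      split; [split; trivial; lra|]; rewrite Rminus_0_r, Rabs_pos_eq; lra.
    + apply (ring_immersed X_pos2 M_pos2 atan r 0 _ _ X_pos2_ringpt Hr
        (is_derive_M_pos2 r) (is_derive_atan' r) (1 + r ^ 2)); trivial; nra.
    + exists (atan r); apply vec_eq; rcoords; unfold M_pos2;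
        rewrite ?cos_0, ?sin_0; ring.
Qed.

Definition Z_out (r : R) : R := / 2 * ln ((r - 1) / (r + 1)).
Definition M_out (r : R) : R := - r - Z_out r.

Lemma X_neg2_out_ringpt r v : X_neg2_out r v = ringpt M_out Z_out r v.
Proof. unfold X_neg2_out, M_out, Z_out; apply vec_eq; rcoords; ring. Qed.

Lemma is_derive_Z_out r : 1 < r -> is_derive Z_out r (1 / (r ^ 2 - 1)).
Proof.
  intros Hr; unfold Z_out; auto_derive.
  - split; [lra|split; [|trivial]].
    apply Rdiv_lt_0_compat; lra.
  - field; repeat split; nra.
Qed.

Lemma is_derive_M_out r : 1 < r -> is_derive M_out r (- 1 - 1 / (r ^ 2 - 1)).
Proof.
  intros Hr; pose proof (is_derive_Z_out r Hr) as D; unfold M_out.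
  auto_derive; [eexists; exact D|derive_values; ring].
Qed.

Lemma Z_out_increasing r r' : 1 < r < r' -> Z_out r < Z_out r'.
Proof.
  intros Hr; unfold Z_out; apply Rmult_lt_compat_l; [lra|].
  apply ln_increasing; [apply Rdiv_lt_0_compat; lra|].
  replace ((r - 1) / (r + 1)) with (1 - 2 * / (r + 1)) by (field; lra).
  replace ((r' - 1) / (r' + 1)) with (1 - 2 * / (r' + 1)) by (field; lra).
  assert (/ (r' + 1) < / (r + 1)); [|lra].
  apply Rinv_lt_contravar; [apply Rmult_lt_0_compat|]; lra.
Qed.

Lemma Z_out_bound r : 1 < r -> - (1 / (r - 1)) <= Z_out r < 0.
Proof.
  intros Hr; unfold Z_out.
  assert (P : 0 < (r - 1) / (r + 1)) by (apply Rdiv_lt_0_compat; lra).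
  split.
  - pose proof (exp_ineq1_le (- ln ((r - 1) / (r + 1)))) as E.
    rewrite exp_Ropp, exp_ln in E by trivial.
    replace (/ ((r - 1) / (r + 1))) with (1 + 2 * (1 / (r - 1))) in E by (field; lra).
    lra.
  - assert (ln ((r - 1) / (r + 1)) < ln 1); [|rewrite ln_1 in *; lra].
    apply ln_increasing; trivial; apply Rlt_div_l; lra.
Qed.

Lemma Z_out_tends : tends_at_infty Z_out 0.
Proof.
  intros eps Heps; exists (1 + 1 / eps); intros r Hr.
  assert (0 < 1 / eps) by (apply Rdiv_lt_0_compat; lra).
  destruct (Z_out_bound r) as (B1 & B2); [lra|].
  assert (1 / (r - 1) < eps).
  { assert (H1 : 1 / eps < r - 1) by lra.
    apply Rlt_div_l in H1; trivial; apply Rlt_div_l; lra. }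
  rewrite Rminus_0_r; apply Rabs_def1; lra.
Qed.

Lemma M_out_tends : tends_at_infty (fun r => M_out r + 1 * r) 0.
Proof.
  intros eps Heps; destruct (Z_out_tends eps Heps) as (Q & HQ); exists Q; intros r Hr.
  specialize (HQ r Hr); unfold M_out.
  replace (- r - Z_out r + 1 * r - 0) with (- (Z_out r - 0)) by ring.
  now rewrite Rabs_Ropp.
Qed.

Lemma X_neg2_out_primitives :
  exists m z, riemann_primitives (-2) (fun q => 1 < q) m z /\
    forall r v, 1 < r -> X_neg2_out r v = refl1 (riemann_X m z (r ^ 2) (PI - v)).
Proof.
  exists (fun q => (fun r => r + Z_out r) (sqrt q)), (fun q => Z_out (sqrt q)); split.
  - apply (riemann_primitives_of_radial (-2) (fun r => 1 < r) _ (fun r => r + Z_out r) Z_out).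
    + intros r Hr.
      assert (E : quartic (-2) r = (r ^ 2 - 1) ^ 2) by (unfold quartic; ring).
      assert (0 < r ^ 2 - 1) by nra.
      rewrite E, sqrt_pow2 by lra; pose proof (is_derive_Z_out r Hr) as D.
      split; [now apply pow_lt|]; split; trivial.
      auto_derive; [eexists; exact D|derive_values; field; lra].
    + intros q Hq; split; [lra|]; rewrite <- sqrt_1; apply sqrt_lt_1_alt; lra.
  - intros r v Hr; rewrite (refl1_riemann_X (fun r => r + Z_out r)) by lra.
    rewrite X_neg2_out_ringpt; unfold ringpt, M_out; apply vec_eq; rcoords; ring.
Qed.

Lemma X_neg2_out_properties r0 : 1 < r0 ->
  let z0 := / 2 * ln ((r0 - 1) / (r0 + 1)) in
  let Dspace r v := r0 <= r /\ cos v < 1 - 2 / r ^ 2 in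
  let Dtime r v := r0 <= r /\ 1 - 2 / r ^ 2 < cos v < 1 in
  let Dext r (v : R) := r0 <= r in
  (forall r v, Dspace r v -> spacelike_at X_neg2_out r v) /\
  (forall r, r0 <= r ->
     horizontal_circle (fun x => exists v, Dext r v /\ x = X_neg2_out r v)) /\
  (forall r v, Dext r v -> cos v = 1 - 2 / r ^ 2 -> lightlike_at X_neg2_out r v) /\
  (forall r v, Dtime r v -> timelike_at X_neg2_out r v) /\
  (forall p, surf X_neg2_out Dext p -> z0 <= x3 p < 0) /\
  (exists C, horizontal_circle C /\ at_height z0 C /\
     (forall p, surf X_neg2_out Dext p /\ x3 p = z0 <-> C p) /\
     (forall p, C p -> boundary_point (surf X_neg2_out Dext) p) /\
     (exists p, surf X_neg2_out Dspace p /\ x3 p = z0) /\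
     (forall p, surf X_neg2_out Dspace p -> x3 p = z0 ->
        C p /\ boundary_point (surf X_neg2_out Dspace) p)) /\
  (exists L, line_orthogonal_to_Pi L /\ at_height 0 L /\
     leaves_cvg_loc (surf X_neg2_out Dext) L 0 /\
     (forall p, L p -> full_surf X_neg2_out Dext p) /\
     leaves_cvg_loc (surf X_neg2_out Dspace) (fun p => L p /\ 2 <= Rabs (x2 p)) 0).
Proof.
  intros H0 z0 Dspace Dtime Dext.
  change z0 with (Z_out r0); clear z0.
  assert (K : forall r v, r0 <= r -> 0 < r ^ 2 - 1 /\
    (r ^ 2 - 1) * ((-1 - 1 / (r ^ 2 - 1)) * cos v + 1) = r ^ 2 * (1 - cos v) - 1).
  { intros r v Hr; assert (0 < r ^ 2 - 1) by nra; split; trivial; field; lra. }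
  assert (Q : forall r, r0 <= r -> r ^ 2 * (2 / r ^ 2) = 2).
  { intros r Hr; field; lra. }
  assert (P2 : forall r, r0 <= r -> 0 < r ^ 2) by (intros; apply pow_lt; lra).
  assert (Zi : forall r r', r0 <= r < r' -> Z_out r < Z_out r').
  { intros r r' Hr; apply Z_out_increasing; lra. }
  assert (Zinj : forall r r', r0 <= r -> r0 <= r' -> Z_out r = Z_out r' -> r = r').
  { intros r r' Hr Hr' E; destruct (Rtotal_order r r') as [L|[|L]]; trivial; exfalso;
      [pose proof (Zi r r')|pose proof (Zi r' r)]; lra. }
  assert (HC : forall r, r0 <= r -> continuous_at M_out r /\ continuous_at Z_out r).
  { intros r Hr; split; apply continuous_at_iff.
    - apply (ex_derive_continuous M_out); eexists; apply is_derive_M_out; lra.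
    - apply (ex_derive_continuous Z_out); eexists; apply is_derive_Z_out; lra. }
  assert (HB : forall D : R -> R -> Prop, (forall r v, D r v -> r0 <= r) ->
    forall r p, r0 <= r ->
    (surf X_neg2_out D p /\ x3 p = Z_out r <-> ring_leaf M_out Z_out D r p)).
  { intros D HD r p Hr; split.
    - intros ((r' & v & Dv & ->) & E); rewrite X_neg2_out_ringpt in *.
      exists v; rewrite x3_ringpt in E.
      rewrite <- (Zinj r' r) by (trivial; now apply (HD r' v)); now split.
    - intros (v & Dv & ->); split; [|apply x3_ringpt].
      exists r, v; split; trivial; now rewrite X_neg2_out_ringpt. }
  assert (HDs : forall r v, Dspace r v -> r0 <= r) by (intros r v; now intros []).
  assert (HDe : forall r v, Dext r v -> r0 <= r) by (intros r v; trivial).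
  assert (HA : forall (D : R -> R -> Prop) p, (forall r v, D r v -> r0 <= r) ->
    surf X_neg2_out D p -> exists r v, r0 <= r /\ p = ringpt M_out Z_out r v).
  { intros D p HD (r & v & Dv & ->); exists r, v.
    split; [now apply (HD r v)|apply X_neg2_out_ringpt]. }
  split; [|split; [|split; [|split; [|split; [|split]]]]].
  - intros r v (Hr & Hv); destruct (K r v Hr) as (K1 & K2).
    assert (r1 : 1 < r) by lra.
    apply (ring_spacelike X_neg2_out M_out Z_out r v _ _ X_neg2_out_ringpt ltac:(lra)
      (is_derive_M_out r r1) (is_derive_Z_out r r1) (r ^ 2 - 1)); trivial.
    rewrite K2; specialize (Q r Hr); specialize (P2 r Hr).
    assert (r ^ 2 * (2 / r ^ 2) < r ^ 2 * (1 - cos v)); [|lra].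
    apply Rmult_lt_compat_l; lra.
  - intros r Hr; destruct (horizontal_circle_ring M_out Z_out r ltac:(lra))
      as (a & b & h & rho & Hrho & E).
    exists a, b, h, rho; split; trivial; intros x; rewrite <- E; split.
    + intros (v & _ & ->); exists v; apply X_neg2_out_ringpt.
    + intros (v & ->); exists v; split; trivial; now rewrite X_neg2_out_ringpt.
  - intros r v Hr Hv; destruct (K r v Hr) as (K1 & K2).
    assert (r1 : 1 < r) by (unfold Dext in Hr; lra).
    apply (ring_lightlike X_neg2_out M_out Z_out r v _ _ X_neg2_out_ringpt ltac:(lra)
      (is_derive_M_out r r1) (is_derive_Z_out r r1) (r ^ 2 - 1)); trivial.
    rewrite K2, Hv; specialize (Q r Hr); lra.
  - intros r v (Hr & Hv1 & Hv2); destruct (K r v Hr) as (K1 & K2).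
    assert (r1 : 1 < r) by lra.
    apply (ring_timelike X_neg2_out M_out Z_out r v _ _ X_neg2_out_ringpt ltac:(lra)
      (is_derive_M_out r r1) (is_derive_Z_out r r1) (r ^ 2 - 1)); trivial.
    rewrite K2; specialize (Q r Hr); specialize (P2 r Hr).
    assert (r ^ 2 * (1 - cos v) < r ^ 2 * (2 / r ^ 2)).
    { apply Rmult_lt_compat_l; lra. }
    assert (0 < r ^ 2 * (1 - cos v)) by (apply Rmult_lt_0_compat; lra); lra.
  - intros p Sp; destruct (HA _ p HDe Sp) as (r & v & Hr & ->); rewrite x3_ringpt.
    split; [|apply Z_out_bound; lra].
    destruct Hr as [L| ->]; [left; apply Zi; lra|now right].
  - exists (fun x => exists v, x = ringpt M_out Z_out r0 v).
    split; [apply horizontal_circle_ring; lra|]; split.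
    { intros p (v & ->); apply x3_ringpt. }
    split; [|split; [|split]].
    + intros p; rewrite (HB Dext HDe r0 p) by lra; split.
      * intros (v & _ & ->); now exists v.
      * intros (v & ->); exists v; split; trivial; unfold Dext; lra.
    + intros p (v & ->); apply (boundary_point_ring M_out Z_out _ r0 v 1 1);
        trivial; try lra.
      * intros r w Hr _; exists r, w; split; [apply Hr|].
        now rewrite X_neg2_out_ringpt.
      * intros p Sp _; now apply (HA Dext).
    + exists (ringpt M_out Z_out r0 PI); apply (HB Dspace HDs r0); [lra|].
      exists PI; split; trivial; split; [lra|].
      rewrite cos_PI; assert (2 / r0 ^ 2 < 2); [apply Rlt_div_l; nra|lra].
    + intros p Sp Ep.
      destruct (proj1 (HB Dspace HDs r0 p ltac:(lra)) (conj Sp Ep)) as (v & (_ & Hv) & ->).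
      split; [now exists v|].
      assert (Cc : continuous_at cos v) by apply continuous_at_iff, continuous_cos.
      destruct (Cc (1 - 2 / r0 ^ 2 - cos v)) as (d & d0 & Hd); [lra|].
      apply (boundary_point_ring M_out Z_out _ r0 v (d / 2) 1); trivial; try lra.
      * intros r w Hr Hw; exists r, w; split; [|now rewrite X_neg2_out_ringpt].
        split; [apply Hr|].
        specialize (Hd w ltac:(lra)); apply Rabs_def2 in Hd.
        assert (2 / r ^ 2 <= 2 / r0 ^ 2); [|lra].
        apply Rmult_le_compat_l; [lra|]; apply Rinv_le_contravar; [apply pow_lt; lra|nra].
      * intros p Sp' _; now apply (HA Dspace).
  - exists (line_at 0 0); split; [apply line_at_orthogonal|].
    split; [now intros p (_ & ->)|]; split; [|split].
    + apply (leaves_cvg_full_line M_out Z_out 1 0 0 ltac:(now left) M_out_tends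
        Z_out_tends (fun r => r0 <= r) Dext _ 1); try lra.
      * intros; lra.
      * exists r0; lra.
      * intros; apply Zi; lra.
      * intros r Hr; apply Z_out_bound; lra.
      * intros r Hr v eps Heps; destruct (dense_angles_full v eps Heps) as (v' & _ & E).
        now exists v'.
      * intros p Sp _; destruct (HA _ p HDe Sp) as (r & v & Hr & ->); now exists r.
      * now apply HB.
    + intros p Lp; right.
      apply (limit_leaf_line M_out Z_out 1 0 0 ltac:(now left) M_out_tends Z_out_tends
        X_neg2_out Dext (fun r => r) r0); trivial.
      * intros; apply X_neg2_out_ringpt.
      * intros B; now exists B.
      * intros s Hs v eps Heps; destruct (dense_angles_full v eps Heps) as (v' & _ & E).
        exists v'; split; trivial; unfold Dext; lra.
    + apply (leaves_cvg_line M_out Z_out 0 Z_out_tends (fun r => r0 <= r) Dspace _ _ 1);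
        try lra.
      * intros; lra.
      * exists r0; lra.
      * intros; apply Zi; lra.
      * intros r Hr; apply Z_out_bound; lra.
      * intros r Hr; exists PI; split; trivial; rewrite cos_PI.
        assert (2 / r ^ 2 < 2); [apply Rlt_div_l; nra|lra].
      * intros p Sp _; destruct (HA _ p HDs Sp) as (r & v & Hr & ->); now exists r.
      * now apply HB.
      * intros rho eps Hrho Heps.
        destruct (ring_near_line M_out 1 0 ltac:(now left) M_out_tends rho (eps / 4))
          as (Q1 & Q10 & HQ1); trivial; [lra|].
        destruct (Z_out_tends (eps / 4)) as (Q2 & HQ2); [lra|].
        exists (Rmax Q1 (Rmax Q2 (rho ^ 2 / (eps / 4)))); intros r v Hr Lr (_ & Hv) B1 B2.
        minmax.
        destruct (HQ1 r v) as (E1 & Cv); trivial; [lra|].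
        specialize (HQ2 r ltac:(lra)).
        set (y := r * sin v) in *.
        assert (SQ := sq_div_lt y rho r (eps / 4) ltac:(lra) ltac:(lra) B2 ltac:(lra)).
        specialize (Q r Hr); specialize (P2 r Hr).
        pose proof (COS_bound v) as CB; pose proof (sin2_eq v) as T.
        assert (D2 : 2 < r ^ 2 * (1 - cos v)).
        { rewrite <- Q; apply Rmult_lt_compat_l; lra. }
        assert (Ey : y ^ 2 = r ^ 2 * (1 - cos v) * (1 + cos v)).
        { unfold y; rewrite Rpow_mult_distr, T; ring. }
        assert (Y1 : 2 * (1 + cos v) <= y ^ 2) by (rewrite Ey; nra).
        assert (Y2 : 1 - cos v <= y ^ 2 / r).
        { apply Rle_div_r; [lra|]; rewrite Ey.
          apply Rle_trans with (r ^ 2 * (1 - cos v)); nra. }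
        assert (Hy : 2 - Rabs y < eps / 4).
        { rewrite <- (pow2_abs y) in Y1; pose proof (Rabs_pos y).
          destruct (Rle_dec 2 (Rabs y)); [lra|]; nra. }
        assert (exists y', 2 <= Rabs y' /\ Rabs (y - y') < eps / 4) as (y' & Hy' & Dy).
        { destruct (Rle_dec 2 (Rabs y)) as [L|L].
          - exists y; split; trivial; rewrite Rminus_diag, Rabs_R0; lra.
          - revert Hy L; unfold Rabs at 1 2; destruct (Rcase_abs y); intros Hy L.
            + exists (-2); split; [rewrite Rabs_left; lra|].
              rewrite Rabs_pos_eq; lra.
            + exists 2; split; [rewrite Rabs_pos_eq; lra|].
              rewrite Rabs_left; lra. }
        exists (0, y', 0); split; [split; [now split|coords; trivial]|].
        apply Rle_lt_trans with (1 := edist_le_coords _ _); rcoords; fold y; lra.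
      * intros rho eps Hrho Heps.
        destruct (ring_reaches_line M_out 1 0 ltac:(now left) M_out_tends rho (eps / 4))
          as (Q1 & Q10 & HQ1); trivial; [lra|].
        destruct (Z_out_tends (eps / 4)) as (Q2 & HQ2); [lra|].
        exists (Rmax Q1 Q2); intros r p' Hr Lr ((E1 & E3) & Hp) B.
        minmax.
        destruct (HQ1 r (x2 p')) as (v & Ev & Bv & Cv); trivial; [lra|].
        specialize (HQ2 r ltac:(lra)); specialize (Q r Hr); specialize (P2 r Hr).
        exists v; split.
        -- split; trivial.
           pose proof (COS_bound v) as CB; pose proof (sin2_eq v) as T.
           assert (Ey : x2 p' ^ 2 = r ^ 2 * (1 - cos v) * (1 + cos v)).
           { rewrite <- Ev, Rpow_mult_distr, T; ring. }
           assert (Y4 : 4 <= x2 p' ^ 2) by (rewrite <- (pow2_abs (x2 p')); nra).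
           assert (D2 : 2 < r ^ 2 * (1 - cos v)).
           { assert (0 <= r ^ 2 * (1 - cos v)) by (apply Rmult_le_pos; lra).
             assert (cos v <> 1) by (intros C; rewrite C in Ey; lra).
             rewrite Ey in Y4; nra. }
           rewrite <- Q in D2; apply Rmult_lt_reg_l in D2; lra.
        -- apply Rle_lt_trans with (1 := edist_le_coords _ _); rcoords.
           rewrite E1, E3, Ev, Rminus_diag, Rabs_R0; lra.
Qed.

Definition M_in (r : R) : R := r - artanh r.

Lemma X_neg2_in_ringpt r v : X_neg2_in r v = ringpt M_in artanh r v.
Proof. unfold X_neg2_in, M_in; apply vec_eq; rcoords; ring. Qed.

Lemma is_derive_artanh r : -1 < r < 1 -> is_derive artanh r (1 / (1 - r ^ 2)).
Proof.
  intros Hr; unfold artanh; auto_derive.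
  - split; [lra|split; [|trivial]]; apply Rdiv_lt_0_compat; lra.
  - field; repeat split; nra.
Qed.

Lemma is_derive_M_in r : -1 < r < 1 -> is_derive M_in r (1 - 1 / (1 - r ^ 2)).
Proof.
  intros Hr; pose proof (is_derive_artanh r Hr) as D; unfold M_in.
  auto_derive; [eexists; exact D|derive_values; ring].
Qed.

Lemma artanh_increasing r r' : -1 < r < r' -> r' < 1 -> artanh r < artanh r'.
Proof.
  intros Hr Hr'; destruct (MVT_convex (fun r => -1 < r < 1) artanh
    (fun r => 1 / (1 - r ^ 2)) r r') as (c & _ & Hc & E); try lra.
  - intros x y s Hx Hy Hs; lra.
  - apply is_derive_artanh.
  - assert (0 < 1 / (1 - c ^ 2)) by (apply Rdiv_lt_0_compat; nra); nra.
Qed.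

Lemma artanh_0 : artanh 0 = 0.
Proof.
  unfold artanh; replace ((1 + 0) / (1 - 0)) with 1 by field; rewrite ln_1; ring.
Qed.

Lemma artanh_at_left_1 : filterlim artanh (at_left 1) (Rbar_locally p_infty).
Proof.
  intros P (B & HB).
  assert (e0 : 0 < Rmin 1 (exp (- (2 * B)))).
  { apply Rmin_glb_lt; [lra|apply exp_pos]. }
  exists (mkposreal _ e0); intros r Hr Lr; apply HB.
  assert (Hr' : Rabs (r - 1) < Rmin 1 (exp (- (2 * B)))) by exact Hr.
  pose proof (Rmin_l 1 (exp (- (2 * B)))); pose proof (Rmin_r 1 (exp (- (2 * B)))).
  rewrite Rabs_left in Hr' by lra.
  unfold artanh; assert (2 * B < ln ((1 + r) / (1 - r))); [|lra].
  rewrite <- (ln_exp (2 * B)); apply ln_increasing; [apply exp_pos|].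
  apply Rlt_div_r; [lra|].
  assert (exp (2 * B) * (1 - r) < exp (2 * B) * exp (- (2 * B))).
  { apply Rmult_lt_compat_l; [apply exp_pos|lra]. }
  rewrite <- exp_plus, Rplus_opp_r, exp_0 in H1; lra.
Qed.

Lemma X_neg2_in_primitives :
  exists m z, riemann_primitives (-2) (fun q => 0 < q < 1) m z /\
    forall r v, 0 < r < 1 -> X_neg2_in r v = refl1 (riemann_X m z (r ^ 2) (PI - v)).
Proof.
  exists (fun q => (fun r => - r + artanh r) (sqrt q)), (fun q => artanh (sqrt q)); split.
  - apply (riemann_primitives_of_radial (-2) (fun r => 0 < r < 1) _
      (fun r => - r + artanh r) artanh).
    + intros r Hr.
      assert (E : quartic (-2) r = (1 - r ^ 2) ^ 2) by (unfold quartic; ring).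
      assert (0 < 1 - r ^ 2) by nra.
      rewrite E, sqrt_pow2 by lra.
      pose proof (is_derive_artanh r ltac:(lra)) as D.
      split; [now apply pow_lt|]; split; trivial.
      auto_derive; [eexists; exact D|derive_values; field; lra].
    + intros q Hq; split; [lra|]; split; [apply sqrt_lt_R0; lra|].
      rewrite <- sqrt_1; apply sqrt_lt_1_alt; lra.
  - intros r v Hr; rewrite (refl1_riemann_X (fun r => - r + artanh r)) by lra.
    rewrite X_neg2_in_ringpt; unfold ringpt, M_in; apply vec_eq; rcoords; ring.
Qed.

Lemma X_neg2_in_properties :
  let D r v := 0 < r < 1 /\ - PI < v < PI in
  (forall r v, D r v -> timelike_at X_neg2_in r v) /\
  extends_to_lightlike_line X_neg2_in (fun r => 0 < r < 1) D PI /\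
  (forall p, surf X_neg2_in D p -> 0 < x3 p) /\
  (forall v, filterlim (fun r => x3 (X_neg2_in r v))
               (at_left 1) (Rbar_locally p_infty)).
Proof.
  intros D; pose proof PI_RGT_0 as PI0.
  assert (Cv : forall v, - PI < v < PI -> -1 < cos v).
  { intros v Hv; pose proof (cos_lt_1 (v + PI) ltac:(lra)) as H.
    rewrite cos_plus, cos_PI, sin_PI in H; lra. }
  split; [|split; [|split]].
  - intros r v (Hr & Hv); specialize (Cv v Hv).
    assert (Hr' : -1 < r < 1) by lra; assert (0 < 1 - r ^ 2) by nra.
    apply (ring_timelike X_neg2_in M_in artanh r v _ _ X_neg2_in_ringpt ltac:(lra)
      (is_derive_M_in r Hr') (is_derive_artanh r Hr') (1 - r ^ 2)); trivial.
    replace ((1 - r ^ 2) * ((1 - 1 / (1 - r ^ 2)) * cos v + 1))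
      with (1 - r ^ 2 * (1 + cos v)) by (field; lra).
    assert (0 < r ^ 2) by (apply pow_lt; lra); pose proof (COS_bound v); nra.
  - exists (0, 0, 0), (-1, 0, 1); split; [intros E; injection E; lra|].
    split; [unfold lprod; coords; ring|].
    intros r Hr; rewrite X_neg2_in_ringpt; split; [|split; [|split]].
    + intros (r' & v & (Hr' & Hv) & E); rewrite X_neg2_in_ringpt in E.
      pose proof (f_equal x3 E) as E3; apply (f_equal x1) in E.
      revert E E3; rcoords; unfold M_in; intros E E3.
      assert (r = r') as <-.
      { destruct (Rtotal_order r r') as [L|[|L]]; trivial; exfalso;
          [pose proof (artanh_increasing r r')|pose proof (artanh_increasing r' r)]; lra. }
      rewrite cos_PI in E; specialize (Cv v Hv); nra.
    + intros eps Heps; exists (PI - Rmin 1 (eps / 2)).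
      assert (0 < Rmin 1 (eps / 2)) by (apply Rmin_glb_lt; lra).
      minmax.
      pose proof PI2_1.
      split; [split; trivial; lra|]; rewrite Rabs_left1; lra.
    + assert (Hr' : -1 < r < 1) by lra; assert (0 < 1 - r ^ 2) by nra.
      apply (ring_immersed X_neg2_in M_in artanh r PI _ _ X_neg2_in_ringpt ltac:(lra)
        (is_derive_M_in r Hr') (is_derive_artanh r Hr') (1 - r ^ 2)); trivial.
    + exists (artanh r); apply vec_eq; rcoords; unfold M_in;
        rewrite ?cos_PI, ?sin_PI; ring.
  - intros p (r & v & (Hr & _) & ->); rewrite X_neg2_in_ringpt, x3_ringpt.
    rewrite <- artanh_0; apply artanh_increasing; lra.
  - intros v; apply (filterlim_ext artanh); [|apply artanh_at_left_1].
    intros r; now rewrite X_neg2_in_ringpt.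
Qed.

Theorem theorem3p5 :
  (* every Riemann ZMC example with circles of nonconstant radii is, up to a
     rigid motion and a homothety, parametrized by [riemann_X] *)
  (forall (I : R -> Prop) (D : R -> R -> Prop) (Y : R -> R -> vec) (r : R -> R),
     riemann_zmc_example I D Y r -> nonconstant_on I r ->
     (forall s eps, I s -> 0 < eps ->
        exists s', I s' /\ Rabs (s' - s) < eps /\ Derive r s' <> 0) /\
     exists lam mu : R, 0 < mu /\
       forall J : R -> Prop,
         is_open_interval J -> (forall s, J s -> I s /\ Derive r s <> 0) ->
         exists (m z : R -> R) (Phi : vec -> vec) (theta : R),
           rigid_motion Phi /\
           (forall s, J s -> 0 < cubic lam (mu ^ 2 * r s ^ 2)) /\
           riemann_primitives lam
             (fun q => exists s, J s /\ q = mu ^ 2 * r s ^ 2) m z /\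
           (forall s v, J s -> D s v ->
              Phi (scal mu (Y s v))
              = riemann_X m z (mu ^ 2 * r s ^ 2) (v + theta)))
  /\
  (* conversely, every [lam] gives Riemann ZMC examples *)
  (forall (lam : R) (J : R -> Prop) (D : R -> R -> Prop) (m z : R -> R),
     arc_domain J D -> (forall q, J q -> 0 < q /\ 0 < cubic lam q) ->
     riemann_primitives lam J m z ->
     riemann_zmc_example J D (riemann_X m z) sqrt /\ nonconstant_on J sqrt)
  /\
  (* (1.i) *)
  ((exists m z, riemann_primitives 2 (fun q => 0 < q) m z /\
      forall r v, 0 < r -> X_pos2 r v = refl1 (riemann_X m z (r ^ 2) (PI - v))) /\
   let D r v := 0 < r /\ 0 < v < 2 * PI in
   (forall r v, D r v -> spacelike_at X_pos2 r v) /\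
   (forall r, 0 < r -> exists C p, horizontal_circle C /\ C p /\
      forall x, (exists v, D r v /\ x = X_pos2 r v) <-> C x /\ x <> p) /\
   (forall p, full_surf X_pos2 D p -> 0 < x3 p <= PI / 2) /\
   (exists p, x3 p = 0 /\ conelike_point (full_surf X_pos2 D) p) /\
   (exists L, line_orthogonal_to_Pi L /\ at_height (PI / 2) L /\
      leaves_cvg_loc (full_surf X_pos2 D) L (PI / 2) /\
      (forall p, L p -> full_surf X_pos2 D p)) /\
   asymptotic_to_plane (full_surf X_pos2 D) (PI / 2) /\
   extends_to_lightlike_line X_pos2 (fun r => 0 < r) D 0)
  /\
  (* (1.ii) and (1.iii) *)
  ((exists m z, riemann_primitives (-2) (fun q => 1 < q) m z /\
      forall r v, 1 < r -> X_neg2_out r v = refl1 (riemann_X m z (r ^ 2) (PI - v))) /\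
   forall r0, 1 < r0 ->
   let z0 := / 2 * ln ((r0 - 1) / (r0 + 1)) in
   let Dspace r v := r0 <= r /\ cos v < 1 - 2 / r ^ 2 in
   let Dtime r v := r0 <= r /\ 1 - 2 / r ^ 2 < cos v < 1 in
   (* the extension by full circles *)
   let Dext r (v : R) := r0 <= r in
   (forall r v, Dspace r v -> spacelike_at X_neg2_out r v) /\
   (forall r, r0 <= r ->
      horizontal_circle (fun x => exists v, Dext r v /\ x = X_neg2_out r v)) /\
   (forall r v, Dext r v -> cos v = 1 - 2 / r ^ 2 -> lightlike_at X_neg2_out r v) /\
   (forall r v, Dtime r v -> timelike_at X_neg2_out r v) /\
   (forall p, surf X_neg2_out Dext p -> z0 <= x3 p < 0) /\
   (exists C, horizontal_circle C /\ at_height z0 C /\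
      (forall p, surf X_neg2_out Dext p /\ x3 p = z0 <-> C p) /\
      (forall p, C p -> boundary_point (surf X_neg2_out Dext) p) /\
      (exists p, surf X_neg2_out Dspace p /\ x3 p = z0) /\
      (forall p, surf X_neg2_out Dspace p -> x3 p = z0 ->
         C p /\ boundary_point (surf X_neg2_out Dspace) p)) /\
   (exists L, line_orthogonal_to_Pi L /\ at_height 0 L /\
      leaves_cvg_loc (surf X_neg2_out Dext) L 0 /\
      (forall p, L p -> full_surf X_neg2_out Dext p) /\
      (* the spacelike pieces of circles converge to a part of [L] *)
      leaves_cvg_loc (surf X_neg2_out Dspace) (fun p => L p /\ 2 <= Rabs (x2 p)) 0))
  /\
  (* (1.iv) *)
  ((exists m z, riemann_primitives (-2) (fun q => 0 < q < 1) m z /\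
      forall r v, 0 < r < 1 ->
        X_neg2_in r v = refl1 (riemann_X m z (r ^ 2) (PI - v))) /\
   let D r v := 0 < r < 1 /\ - PI < v < PI in
   (forall r v, D r v -> timelike_at X_neg2_in r v) /\
   extends_to_lightlike_line X_neg2_in (fun r => 0 < r < 1) D PI /\
   (forall p, surf X_neg2_in D p -> 0 < x3 p) /\
   (forall v, filterlim (fun r => x3 (X_neg2_in r v))
                (at_left 1) (Rbar_locally p_infty)))
  /\
  (* (2) *)
  (forall lam, lam ^ 2 < 4 ->
   let D q (v : R) := 0 < q in
   exists (m z : R -> R) (z0 : R),
     riemann_primitives lam (fun q => 0 < q) m z /\
     three_causal_characters (riemann_X m z) D /\
     (forall p, full_surf (riemann_X m z) D p -> 0 < x3 p <= z0) /\
     (exists p, x3 p = 0 /\ conelike_point (full_surf (riemann_X m z) D) p) /\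
     (exists L, line_orthogonal_to_Pi L /\
        forall p, L p -> full_surf (riemann_X m z) D p))
  /\
  (* (3) *)
  (forall lam, lam < -2 ->
   let q1 := (- lam - sqrt (lam ^ 2 - 4)) / 2 in
   let q2 := (- lam + sqrt (lam ^ 2 - 4)) / 2 in
   (forall q, 0 < q -> (0 < cubic lam q <-> 0 < q < q1 \/ q2 < q)) /\
   (* (a) *)
   (let D q (v : R) := 0 < q < q1 in
    exists (m z : R -> R) (z0 : R),
      riemann_primitives lam (fun q => 0 < q < q1) m z /\
      (forall q v, D q v -> timelike_at (riemann_X m z) q v) /\
      (forall p, surf (riemann_X m z) D p -> 0 < x3 p < z0) /\
      (exists p, x3 p = 0 /\
         leaves_cvg (surf (riemann_X m z) D) (fun p' => p' = p) 0) /\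
      (exists C, horizontal_circle C /\ at_height z0 C /\
         leaves_cvg (surf (riemann_X m z) D) C z0)) /\
   (* (b); the boundary leaf [q = q2] is added *)
   (let D q (v : R) := q2 <= q in
    exists (m z : R -> R) (z0 : R),
      riemann_primitives lam (fun q => q2 < q) m z /\
      filterlim m (at_right q2) (locally (m q2)) /\
      filterlim z (at_right q2) (locally (z q2)) /\
      three_causal_characters (riemann_X m z) (fun q v => q2 < q) /\
      (forall p, full_surf (riemann_X m z) D p -> 0 <= x3 p <= z0) /\
      (exists C, horizontal_circle C /\
         (forall p, full_surf (riemann_X m z) D p /\ x3 p = 0 <-> C p) /\
         (forall p, C p -> boundary_point (full_surf (riemann_X m z) D) p)) /\
      (exists L, line_orthogonal_to_Pi L /\
         (forall p, full_surf (riemann_X m z) D p /\ x3 p = z0 <-> L p))))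
  /\
  (* (4) *)
  (forall lam, 2 < lam ->
   let D q (v : R) := 0 < q in
   exists (m z : R -> R) (z0 : R),
     riemann_primitives lam (fun q => 0 < q) m z /\
     (forall q v, D q v -> spacelike_at (riemann_X m z) q v) /\
     (forall p, full_surf (riemann_X m z) D p -> 0 < x3 p <= z0) /\
     (exists p, x3 p = 0 /\ conelike_point (full_surf (riemann_X m z) D) p) /\
     (exists L, line_orthogonal_to_Pi L /\
        (forall p, full_surf (riemann_X m z) D p /\ x3 p = z0 <-> L p))).
Proof.
  split; [exact riemann_classification|].
  split; [exact riemann_X_example|].
  split; [split; [exact X_pos2_primitives|exact X_pos2_properties]|].
  split; [split; [exact X_neg2_out_primitives|exact X_neg2_out_properties]|].
  split; [split; [exact X_neg2_in_primitives|exact X_neg2_in_properties]|].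
  split; [|split].
  - intros lam Hl D.
    destruct (riemann_X_complete lam) as (m & z & z0 & Hp & Hh & Hc & L & HL & HL');
      [nra|].
    exists m, z, z0; split; trivial; split.
    { now apply (three_causal_characters_subcritical lam). }
    split; trivial; split; trivial.
    exists L; split; trivial; intros p Lp; now apply HL'.
  - intros lam Hl q1 q2; split; [exact (cubic_pos_iff lam Hl)|].
    split; [exact (riemann_X_case3a lam Hl)|exact (riemann_X_case3b lam Hl)].
  - intros lam Hl D.
    destruct (riemann_X_complete lam) as (m & z & z0 & Hp & HT); [lra|].
    exists m, z, z0; split; trivial; split; [|exact HT].
    intros q v Hq; now apply (spacelike_supercritical lam).
Qed.
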